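(* Let $B\Rightarrow M$ be a Lie algebroid, $(\mathfrak{k},[\cdot,\cdot]_{\mathfrak{k}})$ a Lie algebra bundle over $M$ and $(\nabla^L,U)$ coupling data. Then $A:=B\oplus\mathfrak{k}$ is a Lie algebroid with anchor $\rho_A(\alpha,\xi):=\rho_B(\alpha)$ and Lie bracket $$[(\alpha,\xi),(\beta,\eta)]_A:=\big([\alpha,\beta]_B,\;U(\alpha,\rho_B(\beta))+\nabla^L_{\rho_B(\alpha)}\eta-\nabla^L_{\rho_B(\beta)}\xi+[\xi,\eta]_{\mathfrak{k}}\big).$$ Moreover $\mathfrak{k}\subset A$ is partially split, with IM connection 1-form $(L,l)$ given by $$l=\mathrm{pr}_{\mathfrak{k}},\qquad i_XL(\alpha,\xi)=\nabla^L_X\xi-U(\alpha,X).$$ Furthermore, any Lie algebroid $A\Rightarrow M$ together with a partially split bundle of ideals $\mathfrak{k}\subset A$ is isomorphic to one of this type.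
   Context: Coupling data for a Lie algebroid $B\Rightarrow M$ (bracket $[\cdot,\cdot]_B$, anchor $\rho_B$) and a Lie algebra bundle $(\mathfrak{k},[\cdot,\cdot]_{\mathfrak{k}})\to M$ (locally trivial bundle of Lie algebras) is a pair $(\nabla^L,U)$, where $\nabla^L$ is a linear connection on $\mathfrak{k}$ and $U\in\Gamma(B^*\otimes T^*M\otimes\mathfrak{k})$, such that for all $X\in\mathfrak{X}(M)$, $\alpha,\beta\in\Gamma(B)$, $\xi,\eta\in\Gamma(\mathfrak{k})$: (S1) $\nabla^L_X[\xi,\eta]_{\mathfrak{k}}=[\nabla^L_X\xi,\eta]_{\mathfrak{k}}+[\xi,\nabla^L_X\eta]_{\mathfrak{k}}$; (S2) $\nabla^L_{\rho_B(\alpha)}\nabla^L_X-\nabla^L_X\nabla^L_{\rho_B(\alpha)}-\nabla^L_{[\rho_B(\alpha),X]}=[U(\alpha,X),\cdot]_{\mathfrak{k}}$; (S3) $\nabla^L_{\rho_B(\alpha)}U(\beta,X)-\nabla^L_{\rho_B(\beta)}U(\alpha,X)+\nabla^L_XU(\alpha,\rho_B(\beta))+U(\alpha,[\rho_B(\beta),X])-U(\beta,[\rho_B(\alpha),X])=U([\alpha,\beta]_B,X)$. A bundle of ideals in a Lie algebroid $A\Rightarrow M$ (bracket $[\cdot,\cdot]$, anchor $\rho$) is a vector subbundle $\mathfrak{k}\subset\ker\rho$ with $[\Gamma(A),\Gamma(\mathfrak{k})]\subset\Gamma(\mathfrak{k})$. An IM connection 1-form for $\mathfrak{k}$ is a pair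 of a linear map $L:\Gamma(A)\to\Omega^1(M,\mathfrak{k})$ and a bundle map $l:A\to\mathfrak{k}$ with $l|_{\mathfrak{k}}=\mathrm{id}$, $L(f\alpha)=fL(\alpha)+df\otimes l(\alpha)$ and $$L([\alpha,\beta])=\mathcal{L}_\alpha L(\beta)-\mathcal{L}_\beta L(\alpha),\qquad l([\alpha,\beta])=[\alpha,l(\beta)]-i_{\rho(\beta)}L(\alpha),$$ where $(\mathcal{L}_\alpha\gamma)(X)=[\alpha,\gamma(X)]-\gamma([\rho(\alpha),X])$. $\mathfrak{k}$ is partially split if it admits an IM connection 1-form (equivalently, if there is a VB subalgebroid $E\Rightarrow TM$ of the tangent algebroid $TA\Rightarrow TM$ complementary to the image of $A\times_M\mathfrak{k}\hookrightarrow TA$, $(a,\gamma)\mapsto\frac{d}{d\tau}|_{0}(a+\tau\gamma)$). ''Isomorphic to one of this type'' means: there is a Lie algebroid isomorphism, covering $\mathrm{id}_M$, from $A$ to some $B\oplus\mathfrak{k}$ constructed from coupling data (with $B\cong A/\mathfrak{k}$), taking $\mathfrak{k}\subset A$ to $0\oplus\mathfrak{k}$. *)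

(* Defs.v *)
From HB Require Import structures.
From mathcomp Require Import all_boot all_order all_algebra.
From mathcomp Require Import all_classical all_reals all_analysis.

Set Implicit Arguments.
Unset Strict Implicit.
Unset Printing Implicit Defensive.

Import Order.TTheory GRing.Theory Num.Theory.
Import numFieldNormedType.Exports.
Local Open Scope classical_set_scope.
Local Open Scope ring_scope.

Section EuclideanSmoothness.
Variables (R : realType) (n : nat).
Implicit Types (U W : set 'rV[R]_n) (f g : 'rV[R]_n -> R).

(* Meaningful for open U: [f] has continuous iterated directional derivatives
   of order <= k at every point of U. *)
Fixpoint Ck (k : nat) (U : set 'rV[R]_n) (f : 'rV[R]_n -> R) : Prop :=
  (forall y, U y -> {for y, continuous f}) /\
  (if k is k'.+1 then
     forall v, (forall y, U y -> derivable f y v) /\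
               Ck k' U (fun y => 'D_v f y)
   else True).

Definition Coo U f := forall k, Ck k U f.

Lemma Ck_cont k U f : Ck k U f -> forall y, U y -> {for y, continuous f}.
Proof. by case: k => [|k] []. Qed.

Lemma CkS k U f : Ck k.+1 U f -> Ck k U f.
Proof.
elim: k f => [|k IH] f [cf df]; first by split.
by split=> // v; have [? /IH ?] := df v.
Qed.

Lemma Ck_sub k U W f : W `<=` U -> Ck k U f -> Ck k W f.
Proof.
move=> WU; elim: k f => [|k IH] f [cf df].
  by split=> // y /WU; exact: cf.
split=> [y /WU|v]; first exact: cf.
by have [d1 d2] := df v; split=> [y /WU|]; [exact: d1|exact: IH].
Qed.

Lemma Ck_ext k U f g : open U -> (forall y, U y -> f y = g y) ->
  Ck k U f -> Ck k U g.
Proof.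
move=> oU; elim: k f g => [|k IH] f g fg [cf df].
  split=> // y Uy.
  have nfg : \forall z \near y, f z = g z.
    by apply: filterS (open_nbhs_nbhs (conj oU Uy)) => z; exact: fg.
  rewrite /prop_for /continuous_at -(fg y Uy).
  exact: (cvg_trans (near_eq_cvg nfg) (cf y Uy)).
have nfg y : U y -> \forall z \near y, f z = g z.
  move=> Uy.
  by apply: filterS (open_nbhs_nbhs (conj oU Uy)) => z; exact: fg.
split=> [y Uy|v].
  rewrite /prop_for /continuous_at -(fg y Uy).
  exact: (cvg_trans (near_eq_cvg (nfg y Uy)) (cf y Uy)).
have [d1 d2] := df v; split=> [y Uy|].
  exact: near_eq_derivable (nfg y Uy) (d1 y Uy).
by apply: IH d2 => y Uy; apply: near_eq_derive; exact: nfg.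
Qed.

Lemma Ck_bigcup k (P : set (set 'rV[R]_n)) U f :
  (forall y, U y -> exists2 W, P W & W y) ->
  (forall W, P W -> Ck k W f) -> Ck k U f.
Proof.
move=> UP; elim: k f => [|k IH] f CP.
  by split=> // y /UP[W /CP CW Wy]; exact: Ck_cont CW _ Wy.
split=> [y /UP[W /CP CW Wy]|v]; first exact: Ck_cont CW _ Wy.
split=> [y /UP[W /CP[_ /(_ v)[dW _]] Wy]|]; first exact: dW.
by apply: IH => W /CP[_ /(_ v)[_ CW]].
Qed.

Lemma Ck_cst k U (r : R) : Ck k U (fun=> r).
Proof.
elim: k r => [|k IH] r; first by split=> [y _|//]; exact: cst_continuous.
split=> [y _|v]; first exact: cst_continuous.
split=> [y _|]; first exact: derivable_cst.
suff -> : (fun y => 'D_v (fun=> r) y) = fun=> 0 by exact: IH.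
by apply/funext => y; exact: derive_cst.
Qed.

Lemma Ck_add k U f g : open U -> Ck k U f -> Ck k U g ->
  Ck k U (fun y => f y + g y).
Proof.
move=> oU; elim: k f g => [|k IH] f g [cf df] [cg dg].
  by split=> // y Uy; exact: continuousD (cf y Uy) (cg y Uy).
split=> [y Uy|v]; first by exact: continuousD (cf y Uy) (cg y Uy).
have [df1 df2] := df v; have [dg1 dg2] := dg v.
split=> [y Uy|]; first by apply: derivableD; [exact: df1|exact: dg1].
apply: (Ck_ext oU _ (IH _ _ df2 dg2)) => y Uy.
by rewrite -deriveD; [|exact: df1|exact: dg1].
Qed.

Lemma Ck_mul k U f g : open U -> Ck k U f -> Ck k U g ->
  Ck k U (fun y => f y * g y).
Proof.
move=> oU; elim: k f g => [|k IH] f g Cf Cg.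
  split=> // y Uy.
  exact: continuousM (Ck_cont Cf Uy) (Ck_cont Cg Uy).
have [f0 g0] := (CkS Cf, CkS Cg); case: Cf Cg => cf df [cg dg].
split=> [y Uy|v]; first by exact: continuousM (cf y Uy) (cg y Uy).
have [df1 df2] := df v; have [dg1 dg2] := dg v.
split=> [y Uy|]; first by apply: derivableM; [exact: df1|exact: dg1].
apply: (Ck_ext oU _ (Ck_add oU (IH _ _ f0 dg2) (IH _ _ g0 df2))) => y Uy.
by rewrite [RHS](deriveM (df1 y Uy) (dg1 y Uy)).
Qed.

End EuclideanSmoothness.

Record chart (R : realType) (M : topologicalType) (n : nat) := Chart {
  cdom : set M;
  cimg : set 'rV[R]_n;
  cmap : M -> 'rV[R]_n;
  cinv : 'rV[R]_n -> M;
  cdom_open : open cdom;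
  cimg_open : open cimg;
  cmap_img : forall x, cdom x -> cimg (cmap x);
  cinv_dom : forall y, cimg y -> cdom (cinv y);
  cmapK : forall x, cdom x -> cinv (cmap x) = x;
  cinvK : forall y, cimg y -> cmap (cinv y) = y;
  cmap_cont : forall x, cdom x -> {for x, continuous cmap};
  cinv_cont : forall y, cimg y -> {for y, continuous cinv} }.

Arguments cimg_open {R M n} c : rename.

Definition smooth_transition (R : realType) (M : topologicalType) (n : nat)
    (c c' : chart R M n) :=
  forall j : 'I_n,
    Coo (cimg c `&` cinv c @^-1` cdom c') (fun y => cmap c' (cinv c y) ord0 j).

(* The atlas need not be maximal. *)
Record manifold (R : realType) := Manifold {
  mtop :> topologicalType;
  mdim : nat;
  atlas : set (chart R mtop mdim);
  m_hausdorff : hausdorff_space mtop;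
  m_second_countable : @second_countable mtop;
  atlas_cover : forall x, exists2 c, atlas c & cdom c x;
  atlas_smooth : forall c c', atlas c -> atlas c' -> smooth_transition c c' }.

Section SmoothFunctions.
Variables (R : realType) (M : manifold R).
Implicit Types (U W : set M) (f g : M -> R).

Definition smooth_on U f :=
  forall c, @atlas R M c -> Coo (cimg c `&` cinv c @^-1` U) (f \o cinv c).

Lemma open_cimgI c U : open U -> open (cimg c `&` @cinv R M (mdim M) c @^-1` U).
Proof.
move=> oU; rewrite (@openE 'rV[R]_(mdim M)) => y [cy Uy].
have h1 := open_nbhs_nbhs (conj (cimg_open c) cy).
have h2 : nbhs (cinv c y) U by exact: (open_nbhs_nbhs (conj oU Uy)).
exact: (filterI h1 (cinv_cont cy h2)).
Qed.

Lemma smooth_on_sub U W f : W `<=` U -> smooth_on U f -> smooth_on W f.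
Proof.
by move=> WU sf c ac k; apply: Ck_sub (sf c ac k) => y [? /WU].
Qed.

Lemma smooth_on_ext U f g : open U -> (forall x, U x -> f x = g x) ->
  smooth_on U f -> smooth_on U g.
Proof.
move=> oU fg sf c ac k; apply: Ck_ext (sf c ac k); first exact: open_cimgI.
by move=> y [_ Uy]; exact: fg.
Qed.

Lemma smooth_on_bigcup (P : set (set M)) U f :
  (forall x, U x -> exists2 W, P W & W x) ->
  (forall W, P W -> smooth_on W f) -> smooth_on U f.
Proof.
move=> UP sP c ac k.
apply: (@Ck_bigcup _ _ k
  [set Z | exists2 W, P W & Z = cimg c `&` cinv c @^-1` W]).
  move=> y [cy /UP[W PW Wy]]; exists (cimg c `&` cinv c @^-1` W) => //.
  by exists W.
by move=> _ [W PW ->]; exact: sP.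
Qed.

Lemma smooth_on_cst U (r : R) : smooth_on U (fun=> r).
Proof. by move=> c ac k; exact: Ck_cst. Qed.

Lemma smooth_on_add U f g : open U -> smooth_on U f -> smooth_on U g ->
  smooth_on U (fun x => f x + g x).
Proof.
by move=> oU sf sg c ac k; apply: Ck_add (sf c ac k) (sg c ac k);
  exact: open_cimgI.
Qed.

Lemma smooth_on_mul U f g : open U -> smooth_on U f -> smooth_on U g ->
  smooth_on U (fun x => f x * g x).
Proof.
by move=> oU sf sg c ac k; apply: Ck_mul (sf c ac k) (sg c ac k);
  exact: open_cimgI.
Qed.

Record smfun := SmFun { sfval :> M -> R; sfP : smooth_on setT sfval }.

Lemma smfun_ext (f g : smfun) : (forall x, f x = g x) -> f = g.
Proof.
case: f g => [f fP] [g gP] /= fg.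
have e : f = g by apply/funext.
by subst g; congr SmFun; exact: Prop_irrelevance.
Qed.

Definition smcst (r : R) := SmFun (@smooth_on_cst setT r).
Definition smadd (f g : smfun) := SmFun (smooth_on_add openT (sfP f) (sfP g)).
Definition smmul (f g : smfun) := SmFun (smooth_on_mul openT (sfP f) (sfP g)).
Definition smopp (f : smfun) := smmul (smcst (-1)) f.

HB.instance Definition _ := gen_eqMixin smfun.
HB.instance Definition _ := gen_choiceMixin smfun.

Lemma smaddA : associative smadd.
Proof. by move=> f g h; apply: smfun_ext => x; exact: addrA. Qed.
Lemma smaddC : commutative smadd.
Proof. by move=> f g; apply: smfun_ext => x; exact: addrC. Qed.
Lemma smadd0 : left_id (smcst 0) smadd.
Proof. by move=> f; apply: smfun_ext => x; exact: add0r. Qed.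
Lemma smaddN : left_inverse (smcst 0) smopp smadd.
Proof. by move=> f; apply: smfun_ext => x /=; rewrite mulN1r addNr. Qed.
HB.instance Definition _ :=
  GRing.isZmodule.Build smfun smaddA smaddC smadd0 smaddN.

Lemma smmulA : associative smmul.
Proof. by move=> f g h; apply: smfun_ext => x; exact: mulrA. Qed.
Lemma smmulC : commutative smmul.
Proof. by move=> f g; apply: smfun_ext => x; exact: mulrC. Qed.
Lemma smmul1 : left_id (smcst 1) smmul.
Proof. by move=> f; apply: smfun_ext => x; exact: mul1r. Qed.
Lemma smmulDl : left_distributive smmul +%R.
Proof. by move=> f g h; apply: smfun_ext => x; exact: mulrDl. Qed.
HB.instance Definition _ :=
  GRing.Zmodule_isComPzRing.Build smfun smmulA smmulC smmul1 smmulDl.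

Lemma smfunDE (f g : smfun) x : (f + g) x = f x + g x. Proof. by []. Qed.
Lemma smfunME (f g : smfun) x : (f * g) x = f x * g x. Proof. by []. Qed.
Lemma smfunBE (f g : smfun) x : (f - g) x = f x - g x.
Proof. by rewrite smfunDE /= mulN1r. Qed.

End SmoothFunctions.

Arguments smcst {R M} r.
Arguments smooth_on_cst {R M} U r.

(* Tangent vectors at x are the derivations at x of the algebra of smooth
   functions. *)
Section TangentSpace.
Variables (R : realType) (M : manifold R) (x : M).

Record tangent := Tangent {
  tval :> smfun M -> R;
  tvalD : forall f g, tval (f + g) = tval f + tval g;
  tvalZ : forall r f, tval (smcst r * f) = r * tval f;
  tvalM : forall f g, tval (f * g) = f x * tval g + g x * tval f }.

Lemma tangent_ext (v w : tangent) : (forall f, v f = w f) -> v = w.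
Proof.
case: v w => [v v1 v2 v3] [w w1 w2 w3] /= vw.
have e : v = w by apply/funext.
by subst w; congr Tangent; exact: Prop_irrelevance.
Qed.

Definition tan0 : tangent.
Proof.
refine (@Tangent (fun=> 0) _ _ _) => *; last by rewrite !mulr0 addr0.
- by rewrite addr0.
- by rewrite mulr0.
Defined.

Definition tanD (v w : tangent) : tangent.
Proof.
refine (@Tangent (fun f => v f + w f) _ _ _) => *.
- by rewrite !tvalD addrACA.
- by rewrite !tvalZ mulrDr.
- by rewrite !tvalM !mulrDr addrACA.
Defined.

Definition tanZ (a : R) (v : tangent) : tangent.
Proof.
refine (@Tangent (fun f => a * v f) _ _ _) => *.
- by rewrite tvalD mulrDr.
- by rewrite tvalZ mulrCA.
- by rewrite tvalM mulrDr ![a * (_ * _)]mulrCA.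
Defined.

HB.instance Definition _ := gen_eqMixin tangent.
HB.instance Definition _ := gen_choiceMixin tangent.

Lemma tanDA : associative tanD.
Proof. by move=> u v w; apply: tangent_ext => f; exact: addrA. Qed.
Lemma tanDC : commutative tanD.
Proof. by move=> u v; apply: tangent_ext => f; exact: addrC. Qed.
Lemma tanD0 : left_id tan0 tanD.
Proof. by move=> u; apply: tangent_ext => f; exact: add0r. Qed.
Lemma tanDN : left_inverse tan0 (tanZ (-1)) tanD.
Proof. by move=> u; apply: tangent_ext => f /=; rewrite mulN1r addNr. Qed.
HB.instance Definition _ :=
  GRing.isZmodule.Build tangent tanDA tanDC tanD0 tanDN.

Lemma tanZA a b v : tanZ a (tanZ b v) = tanZ (a * b) v.
Proof. by apply: tangent_ext => f; exact: mulrA. Qed.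
Lemma tanZ1 : left_id 1 tanZ.
Proof. by move=> v; apply: tangent_ext => f; exact: mul1r. Qed.
Lemma tanZDr : right_distributive tanZ +%R.
Proof. by move=> a v w; apply: tangent_ext => f; exact: mulrDr. Qed.
Lemma tanZDl v : {morph tanZ^~ v : a b / a + b >-> a + b}.
Proof. by move=> a b; apply: tangent_ext => f; exact: mulrDl. Qed.
HB.instance Definition _ :=
  GRing.Zmodule_isLmodule.Build R tangent tanZA tanZ1 tanZDr tanZDl.

End TangentSpace.

(* A family of vector spaces over M with a module of smooth sections: the
   common interface of the tangent bundle and of the vector bundles below. *)
Record family (R : realType) (M : manifold R) := Family {
  fib :> M -> lmodType R;
  smooth_sec : (forall x, fib x) -> Prop;
  smooth_sec0 : smooth_sec (fun x => 0);
  smooth_secD : forall s t, smooth_sec s -> smooth_sec t ->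
    smooth_sec (fun x => s x + t x);
  smooth_secZ : forall (f : smfun M) s, smooth_sec s ->
    smooth_sec (fun x => f x *: s x) }.

Section Sections.
Variables (R : realType) (M : manifold R) (E : family M).

Record sect := Sect { sval :> forall x, E x; sectP : smooth_sec sval }.

Lemma sect_ext (s t : sect) : (forall x, s x = t x) -> s = t.
Proof.
case: s t => [s sP] [t tP] /= st.
have e : s = t by exact: functional_extensionality_dep.
by subst t; congr Sect; exact: Prop_irrelevance.
Qed.

Definition sect0 := Sect (smooth_sec0 E).
Definition sectD (s t : sect) := Sect (smooth_secD (sectP s) (sectP t)).
Definition sectZ (f : smfun M) (s : sect) := Sect (smooth_secZ f (sectP s)).

HB.instance Definition _ := gen_eqMixin sect.
HB.instance Definition _ := gen_choiceMixin sect.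

Lemma sectDA : associative sectD.
Proof. by move=> s t u; apply: sect_ext => x; exact: addrA. Qed.
Lemma sectDC : commutative sectD.
Proof. by move=> s t; apply: sect_ext => x; exact: addrC. Qed.
Lemma sectD0 : left_id sect0 sectD.
Proof. by move=> s; apply: sect_ext => x; exact: add0r. Qed.
Lemma sectDN : left_inverse sect0 (sectZ (smcst (-1))) sectD.
Proof. by move=> s; apply: sect_ext => x /=; rewrite scaleN1r addNr. Qed.
HB.instance Definition _ :=
  GRing.isZmodule.Build sect sectDA sectDC sectD0 sectDN.

Lemma sectZA f g s : sectZ f (sectZ g s) = sectZ (f * g) s.
Proof. by apply: sect_ext => x; exact: scalerA. Qed.
Lemma sectZ1 : left_id 1 sectZ.
Proof. by move=> s; apply: sect_ext => x; exact: scale1r. Qed.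
Lemma sectZDr : right_distributive sectZ +%R.
Proof. by move=> f s t; apply: sect_ext => x; exact: scalerDr. Qed.
Lemma sectZDl s : {morph sectZ^~ s : f g / f + g >-> f + g}.
Proof. by move=> f g; apply: sect_ext => x; exact: scalerDl. Qed.
HB.instance Definition _ :=
  GRing.Zmodule_isLmodule.Build (smfun M) sect sectZA sectZ1 sectZDr sectZDl.

Lemma sectDE (s t : sect) x : (s + t) x = s x + t x. Proof. by []. Qed.
Lemma sectZE (f : smfun M) (s : sect) x : (f *: s) x = f x *: s x.
Proof. by []. Qed.
Lemma sectBE (s t : sect) x : (s - t) x = s x - t x.
Proof. by rewrite sectDE /= scaleN1r. Qed.

End Sections.

(* Smooth sections are the fields X such that x |-> X_x f is smooth for every
   smooth f. *)
Definition TM (R : realType) (M : manifold R) : family M.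
Proof.
refine (@Family R M (fun x => tangent x : lmodType R)
  (fun X => forall f : smfun M, smooth_on setT (fun x => X x f)) _ _ _).
- by move=> f; exact: (smooth_on_cst setT 0).
- by move=> X Y sX sY f; apply: smooth_on_add (sX f) (sY f); exact: openT.
- by move=> g X sX f; apply: smooth_on_mul (sfP g) (sX f); exact: openT.
Defined.

Section VectorFields.
Variables (R : realType) (M : manifold R).
Implicit Types X Y : sect (TM M).

Definition vfapp X (f : smfun M) : smfun M := SmFun (sectP X f).

Definition vfbr_at X Y (x : M) : tangent x.
Proof.
refine (@Tangent R M x
  (fun f => (X x : tangent x) (vfapp Y f) - (Y x : tangent x) (vfapp X f)) _ _ _).
- move=> f g.
  have e Z : vfapp Z (f + g) = vfapp Z f + vfapp Z g.
    by apply: smfun_ext => y; exact: tvalD.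
  by rewrite !e !tvalD opprD addrACA.
- move=> r f.
  have e Z : vfapp Z (smcst r * f) = smcst r * vfapp Z f.
    by apply: smfun_ext => y; exact: tvalZ.
  by rewrite !e !tvalZ mulrBr.
- move=> f g.
  have e Z : vfapp Z (f * g) = f * vfapp Z g + g * vfapp Z f.
    by apply: smfun_ext => y; exact: tvalM.
  have e1 (Z W : sect (TM M)) : (Z x : tangent x) (vfapp W (f * g)) =
     (f x * (Z x : tangent x) (vfapp W g) + g x * (Z x : tangent x) (vfapp W f))
      + (vfapp W g x * vfapp Z f x + vfapp W f x * vfapp Z g x).
    rewrite e tvalD !tvalM addrACA; congr (_ + _).
  rewrite !e1 [vfapp X g x * _]mulrC [vfapp X f x * _]mulrC.
  rewrite [vfapp Y f x * _ + _]addrC opprD addrACA subrr addr0.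
  by rewrite !mulrBr opprD addrACA.
Defined.

Lemma vfbr_smooth X Y : @smooth_sec R M (TM M) (vfbr_at X Y).
Proof.
move=> f; have := sfP (vfapp X (vfapp Y f) - vfapp Y (vfapp X f)).
apply: smooth_on_ext; first exact: openT.
by move=> x _; rewrite smfunBE.
Qed.

Definition vfbr X Y : sect (TM M) := Sect (vfbr_smooth X Y).

End VectorFields.

Section LocalTrivializations.
Variables (R : realType) (M : manifold R) (F : M -> lmodType R) (r : nat).

(* Outside [tdom] the maps [tvec] and [tcoord] are irrelevant. *)
Record triv := Triv {
  tdom : set M;
  tvec : forall x, 'rV[R]_r -> F x;
  tcoord : forall x, F x -> 'rV[R]_r;
  tdom_open : open tdom;
  tvec_lin : forall x, tdom x -> forall a u v,
    tvec x (a *: u + v) = a *: tvec x u + tvec x v;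
  tvecK : forall x, tdom x -> cancel (tvec x) (tcoord (x := x));
  tcoordK : forall x, tdom x -> cancel (tcoord (x := x)) (tvec x) }.

Definition triv_smooth (t t' : triv) :=
  forall (v : 'rV[R]_r) (i : 'I_r),
    smooth_on (tdom t `&` tdom t') (fun x => tcoord t' (tvec t x v) ord0 i).

Lemma tcoord_lin (t : triv) x : tdom t x -> forall a (u v : F x),
  tcoord t (a *: u + v) = a *: tcoord t u + tcoord t v.
Proof.
move=> tx a u v; apply: (can_inj (tvecK tx)).
by rewrite tvec_lin // !tcoordK.
Qed.

End LocalTrivializations.

(* A smooth vector bundle presented by its fibres and a (not necessarily
   maximal) set of smoothly compatible local trivializations. *)
Record vbundle (R : realType) (M : manifold R) := VBundle {
  vfib : M -> lmodType R;
  vrank : nat;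
  vtriv : set (triv vfib vrank);
  vtriv_cover : forall x, exists2 t, vtriv t & tdom t x;
  vtriv_smooth : forall t t', vtriv t -> vtriv t' -> triv_smooth t t' }.

Section BundleSections.
Variables (R : realType) (M : manifold R) (E : vbundle M).

Definition vb_smooth (s : forall x, vfib E x) :=
  forall t, vtriv t -> forall i,
    smooth_on (tdom t) (fun x => tcoord t (s x) ord0 i).

Lemma vb_smooth0 : vb_smooth (fun x => 0).
Proof.
move=> t _ i; apply: (smooth_on_ext (tdom_open t) _ (smooth_on_cst (tdom t) 0)).
move=> x tx; have := tcoord_lin tx (-1) 0 0.
by rewrite scaler0 addr0 scaleN1r addNr => ->; rewrite mxE.
Qed.

Lemma vb_smoothD s t : vb_smooth s -> vb_smooth t ->
  vb_smooth (fun x => s x + t x).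
Proof.
move=> ss st u tu i; have oU := tdom_open u.
apply: (smooth_on_ext oU _ (smooth_on_add oU (ss u tu i) (st u tu i))).
move=> x ux /=; have := tcoord_lin ux 1 (s x) (t x).
by rewrite !scale1r => ->; rewrite mxE.
Qed.

Lemma vb_smoothZ (f : smfun M) s : vb_smooth s ->
  vb_smooth (fun x => f x *: s x).
Proof.
move=> ss u tu i; have oU := tdom_open u.
have sf : smooth_on (tdom u) f by apply: smooth_on_sub (sfP f).
apply: (smooth_on_ext oU _ (smooth_on_mul oU sf (ss u tu i))).
move=> x ux /=; have e0 : tcoord u (0 : vfib E x) = 0.
  by have := tcoord_lin ux (-1) (0 : vfib E x) 0;
    rewrite scaler0 addr0 scaleN1r addNr.
by rewrite -[f x *: _]addr0 tcoord_lin // e0 addr0 mxE.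
Qed.

End BundleSections.

Coercion vb_family (R : realType) (M : manifold R) (E : vbundle M) : family M :=
  Family (vb_smooth0 (E := E)) (@vb_smoothD R M E) (@vb_smoothZ R M E).

Section BundleMaps.
Variables (R : realType) (M : manifold R).

(* Smooth bundle maps covering the identity; for fibrewise linear maps,
   smoothness amounts to preserving smooth sections. *)
Record bmap (E F : family M) := BMap {
  bfun :> forall x, E x -> F x;
  bfun_lin : forall x a (u v : E x),
    bfun (a *: u + v) = a *: bfun u + bfun v;
  bfun_smooth : forall s : sect E, smooth_sec (fun x => bfun (s x)) }.

Definition bapp E F (phi : bmap E F) (s : sect E) : sect F :=
  Sect (bfun_smooth phi s).

(* Smooth sections of the bundle E^* (x) F^* (x) G. *)
Record bimap (E F G : family M) := BiMap {
  bifun :> forall x, E x -> F x -> G x;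
  bifun_linl : forall x a (u u' : E x) (v : F x),
    bifun (a *: u + u') v = a *: bifun u v + bifun u' v;
  bifun_linr : forall x a (u : E x) (v v' : F x),
    bifun u (a *: v + v') = a *: bifun u v + bifun u v';
  bifun_smooth : forall (s : sect E) (t : sect F),
    smooth_sec (fun x => bifun (s x) (t x)) }.

Definition biapp E F G (U : bimap E F G) (s : sect E) (t : sect F) : sect G :=
  Sect (bifun_smooth U s t).

Definition bcomp E F G (psi : bmap F G) (phi : bmap E F) : bmap E G.
Proof.
refine (@BMap E G (fun x u => psi x (phi x u)) _ _).
- by move=> x a u v; rewrite !bfun_lin.
- by move=> s; exact: bfun_smooth psi (bapp phi s).
Defined.

End BundleMaps.

Definition form1 (R : realType) (M : manifold R) (E : family M) :=
  bmap (TM M) E.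

(* A linear connection, as an operator from sections to bundle-valued
   1-forms; the last field reads D(f s) = f D(s) + df (x) s. *)
Record connection (R : realType) (M : manifold R) (E : family M) := Connection {
  conn :> sect E -> form1 E;
  conn_lin : forall r (s t : sect E) x (v : TM M x),
    conn (smcst r *: s + t) x v = r *: conn s x v + conn t x v;
  conn_leibniz : forall (f : smfun M) (s : sect E) x (v : TM M x),
    conn (f *: s) x v = f x *: conn s x v + (v : tangent x) f *: s x }.

Definition nabla (R : realType) (M : manifold R) (E : family M)
    (D : connection E) (X : sect (TM M)) (s : sect E) : sect E :=
  bapp (D s) X.

Section LieAlgebroids.
Variables (R : realType) (M : manifold R).

Record is_lie_algebroid (A : vbundle M) (br : sect A -> sect A -> sect A)
    (rho : bmap A (TM M)) : Prop := IsLieAlgebroid {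
  lad_lin : forall r a b c,
    br (smcst r *: a + b) c = smcst r *: br a c + br b c;
  lad_skew : forall a b, br a b = - br b a;
  lad_jacobi : forall a b c,
    br a (br b c) + br b (br c a) + br c (br a b) = 0;
  lad_leibniz : forall a (f : smfun M) b,
    br a (f *: b) = f *: br a b + vfapp (bapp rho a) f *: b;
  lad_anchor : forall a b, bapp rho (br a b) = vfbr (bapp rho a) (bapp rho b) }.

Record is_lie_algebra (V : lmodType R) (br : V -> V -> V) : Prop :=
  IsLieAlgebra {
  la_linl : forall a u u' v, br (a *: u + u') v = a *: br u v + br u' v;
  la_linr : forall a u v v', br u (a *: v + v') = a *: br u v + br u v';
  la_alt : forall u, br u u = 0;
  la_jacobi : forall u v w, br u (br v w) + br v (br w u) + br w (br u v) = 0 }.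

(* Each point has a neighbourhood over which k is isomorphic, by a smooth
   trivialization, to the product bundle with a fixed Lie algebra as fibre. *)
Record is_lie_algebra_bundle (k : vbundle M) (br : bimap k k k) : Prop :=
  IsLieAlgebraBundle {
  lab_fib : forall x, is_lie_algebra (br x);
  lab_triv : forall x : M, exists (t : triv (vfib k) (vrank k))
      (b : 'rV[R]_(vrank k) -> 'rV[R]_(vrank k) -> 'rV[R]_(vrank k)),
    [/\ tdom t x,
        (forall t', vtriv t' -> triv_smooth t t' /\ triv_smooth t' t),
        is_lie_algebra b &
        forall y, tdom t y -> forall u v,
          tvec t y (b u v) = br y (tvec t y u) (tvec t y v)] }.

Record is_coupling_data (B k : vbundle M) (brB : sect B -> sect B -> sect B)
    (rhoB : bmap B (TM M)) (brk : bimap k k k)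
    (D : connection k) (U : bimap B (TM M) k) : Prop := IsCouplingData {
  coupling_S1 : forall X xi eta,
    nabla D X (biapp brk xi eta) =
    biapp brk (nabla D X xi) eta + biapp brk xi (nabla D X eta);
  coupling_S2 : forall al X xi,
    nabla D (bapp rhoB al) (nabla D X xi)
    - nabla D X (nabla D (bapp rhoB al) xi)
    - nabla D (vfbr (bapp rhoB al) X) xi =
    biapp brk (biapp U al X) xi;
  coupling_S3 : forall al be X,
    nabla D (bapp rhoB al) (biapp U be X)
    - nabla D (bapp rhoB be) (biapp U al X)
    + nabla D X (biapp U al (bapp rhoB be))
    + biapp U al (vfbr (bapp rhoB be) X)
    - biapp U be (vfbr (bapp rhoB al) X) =
    biapp U (brB al be) X }.

(* The subbundle k of A is given by its inclusion map. *)
Record is_bundle_of_ideals (A k : vbundle M) (br : sect A -> sect A -> sect A)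
    (rho : bmap A (TM M)) (inc : bmap k A) : Prop := IsBundleOfIdeals {
  boi_inj : forall x, injective (inc x);
  boi_ker : forall x u, rho x (inc x u) = 0;
  boi_ideal : forall a xi, exists zeta, br a (bapp inc xi) = bapp inc zeta }.

(* The bracket identities hold in sections of k, regarded inside sections
   of A through inc; imc_L_br expands
     L[a,b](X) = (Lie_a L(b))(X) - (Lie_b L(a))(X),
     (Lie_a g)(X) = [a, g(X)] - g([rho a, X]). *)
Record is_IM_connection (A k : vbundle M) (br : sect A -> sect A -> sect A)
    (rho : bmap A (TM M)) (inc : bmap k A)
    (L : sect A -> form1 k) (l : bmap A k) : Prop := IsIMConnection {
  imc_l_inc : forall x u, l x (inc x u) = u;
  imc_L_lin : forall r a b x (v : TM M x),
    L (smcst r *: a + b) x v = r *: L a x v + L b x v;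
  imc_L_leibniz : forall (f : smfun M) a x (v : TM M x),
    L (f *: a) x v = f x *: L a x v + (v : tangent x) f *: l x (a x);
  imc_L_br : forall a b X,
    bapp inc (bapp (L (br a b)) X) =
      (br a (bapp inc (bapp (L b) X))
       - bapp inc (bapp (L b) (vfbr (bapp rho a) X)))
    - (br b (bapp inc (bapp (L a) X))
       - bapp inc (bapp (L a) (vfbr (bapp rho b) X)));
  imc_l_br : forall a b,
    bapp inc (bapp l (br a b)) =
      br a (bapp inc (bapp l b)) - bapp inc (bapp (L a) (bapp rho b)) }.

Definition partially_split (A k : vbundle M) (br : sect A -> sect A -> sect A)
    (rho : bmap A (TM M)) (inc : bmap k A) : Prop :=
  exists (L : sect A -> form1 k) (l : bmap A k),
    is_IM_connection br rho inc L l.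

Record is_lie_algebroid_iso (A A' : vbundle M)
    (br : sect A -> sect A -> sect A) (rho : bmap A (TM M))
    (br' : sect A' -> sect A' -> sect A') (rho' : bmap A' (TM M))
    (Phi : bmap A A') : Prop := IsLieAlgebroidIso {
  iso_inv : exists Psi : bmap A' A,
    forall x, cancel (Phi x) (Psi x) /\ cancel (Psi x) (Phi x);
  iso_anchor : forall x a, rho' x (Phi x a) = rho x a;
  iso_br : forall a b, bapp Phi (br a b) = br' (bapp Phi a) (bapp Phi b) }.

(* pi exhibits B as the quotient Lie algebroid A / k. *)
Record is_lie_algebroid_quotient (A k B : vbundle M)
    (br : sect A -> sect A -> sect A) (rho : bmap A (TM M)) (inc : bmap k A)
    (brB : sect B -> sect B -> sect B) (rhoB : bmap B (TM M))
    (pi : bmap A B) : Prop := IsLieAlgebroidQuotient {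
  quo_surj : forall x b, exists a, pi x a = b;
  quo_ker : forall x a, pi x a = 0 <-> exists u, a = inc x u;
  quo_anchor : forall x a, rhoB x (pi x a) = rho x a;
  quo_br : forall a b, bapp pi (br a b) = brB (bapp pi a) (bapp pi b) }.

End LieAlgebroids.

Section DirectSum.
Variables (R : realType) (M : manifold R) (E F : vbundle M).

Let S (x : M) : lmodType R := (vfib E x * vfib F x)%type.

Definition dsum_triv (t : triv (vfib E) (vrank E)) (u : triv (vfib F) (vrank F)) :
  triv S (vrank E + vrank F).
Proof.
refine (@Triv R M S _ (tdom t `&` tdom u)
  (fun x v => (tvec t x (lsubmx v), tvec u x (rsubmx v)))
  (fun x a => row_mx (tcoord t a.1) (tcoord u a.2)) _ _ _ _).
- by apply: openI; exact: tdom_open.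
- by move=> x [tx ux] a v w; rewrite !linearP !tvec_lin.
- by move=> x [tx ux] v /=; rewrite !tvecK // hsubmxK.
- by move=> x [tx ux] [a b] /=; rewrite row_mxKl row_mxKr !tcoordK.
Defined.

Definition dsum : vbundle M.
Proof.
refine (@VBundle R M S (vrank E + vrank F)
  [set w | exists t u, [/\ vtriv t, vtriv u & w = dsum_triv t u]] _ _).
- move=> x; have [t vt tx] := vtriv_cover E x; have [u vu ux] := vtriv_cover F x.
  by exists (dsum_triv t u) => //; exists t, u.
- move=> _ _ [t [u [vt vu ->]]] [t' [u' [vt' vu' ->]]] v i.
  case: (splitP i) => j ij.
    have -> : i = lshift _ j by apply: val_inj.
    have := vtriv_smooth vt vt' (lsubmx v) j.
    move=> /(smooth_on_sub (W := tdom (dsum_triv t u) `&` tdom (dsum_triv t' u'))).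
    rewrite (_ : (fun x => tcoord (dsum_triv t' u') _ _ _) =
                 (fun x => tcoord t' (tvec t x (lsubmx v)) ord0 j)).
      by apply=> x [[? ?] [? ?]].
    by apply/funext => x /=; rewrite row_mxEl.
  have -> : i = rshift _ j by apply: val_inj.
  have := vtriv_smooth vu vu' (rsubmx v) j.
  move=> /(smooth_on_sub (W := tdom (dsum_triv t u) `&` tdom (dsum_triv t' u'))).
  rewrite (_ : (fun x => tcoord (dsum_triv t' u') _ _ _) =
               (fun x => tcoord u' (tvec u x (rsubmx v)) ord0 j)).
    by apply=> x [[? ?] [? ?]].
  by apply/funext => x /=; rewrite row_mxEr.
Defined.

Lemma dsum_smoothP (s : forall x, vfib dsum x) :
  vb_smooth s <->
  @vb_smooth R M E (fun x => (s x).1) /\ @vb_smooth R M F (fun x => (s x).2).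
Proof.
split=> [ss|[s1 s2]].
  split=> t vt i.
    apply: (@smooth_on_bigcup _ _
      [set W | exists2 u, vtriv u & W = tdom (dsum_triv t u)]).
      move=> x tx; have [u vu ux] := vtriv_cover F x.
      by exists (tdom (dsum_triv t u)) => //; exists u.
    move=> _ [u vu ->].
    have vtu : vtriv (v := dsum) (dsum_triv t u) by exists t, u.
    apply: (smooth_on_ext (tdom_open _) _ (ss _ vtu (lshift _ i))).
    by move=> x _ /=; rewrite row_mxEl.
  apply: (@smooth_on_bigcup _ _
    [set W | exists2 u, vtriv u & W = tdom (dsum_triv u t)]).
    move=> x tx; have [u vu ux] := vtriv_cover E x.
    by exists (tdom (dsum_triv u t)) => //; exists u.
  move=> _ [u vu ->].
  have vtu : vtriv (v := dsum) (dsum_triv u t) by exists u, t.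
  apply: (smooth_on_ext (tdom_open _) _ (ss _ vtu (rshift _ i))).
  by move=> x _ /=; rewrite row_mxEr.
move=> _ [t [u [vt vu ->]]] i.
case: (splitP i) => j ij.
  have -> : i = lshift _ j by apply: val_inj.
  apply: (@smooth_on_ext _ _ _ _ _ (tdom_open (dsum_triv t u)) _
    (@smooth_on_sub _ _ (tdom t) _ _ _ (s1 t vt j))).
    by move=> x _ /=; rewrite row_mxEl.
  by move=> x [].
have -> : i = rshift _ j by apply: val_inj.
apply: (@smooth_on_ext _ _ _ _ _ (tdom_open (dsum_triv t u)) _
  (@smooth_on_sub _ _ (tdom u) _ _ _ (s2 u vu j))).
  by move=> x _ /=; rewrite row_mxEr.
by move=> x [].
Qed.

Definition dpr1 : bmap dsum E :=
  @BMap R M dsum E (fun x (u : vfib dsum x) => u.1)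
    (fun x a u v => erefl) (fun s => proj1 (proj1 (dsum_smoothP s) (sectP s))).

Definition dpr2 : bmap dsum F :=
  @BMap R M dsum F (fun x (u : vfib dsum x) => u.2)
    (fun x a u v => erefl) (fun s => proj2 (proj1 (dsum_smoothP s) (sectP s))).

Definition dpair (s : sect E) (t : sect F) : sect dsum :=
  @Sect R M dsum (fun x => (s x, t x))
    (proj2 (dsum_smoothP (fun x => (s x, t x))) (conj (sectP s) (sectP t))).

Definition dinr : bmap F dsum.
Proof.
refine (@BMap R M F dsum (fun x u => (0, u)) _ _).
- by move=> x a u v; congr pair; rewrite /= scaler0 addr0.
- by move=> t; exact: sectP (dpair 0 t).
Defined.

End DirectSum.

Section CouplingConstruction.
Variables (R : realType) (M : manifold R) (B k : vbundle M).
Variables (brB : sect B -> sect B -> sect B) (rhoB : bmap B (TM M)).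
Variables (brk : bimap k k k) (D : connection k) (U : bimap B (TM M) k).

Definition coupling_anchor : bmap (dsum B k) (TM M) :=
  bcomp rhoB (dpr1 B k).

Definition coupling_br (s t : sect (dsum B k)) : sect (dsum B k) :=
  let al := bapp (dpr1 B k) s in let xi := bapp (dpr2 B k) s in
  let be := bapp (dpr1 B k) t in let eta := bapp (dpr2 B k) t in
  dpair (brB al be)
    (biapp U al (bapp rhoB be) + nabla D (bapp rhoB al) eta
     - nabla D (bapp rhoB be) xi + biapp brk xi eta).

Definition coupling_L (s : sect (dsum B k)) : form1 k.
Proof.
refine (@BMap R M (TM M) k
  (fun x v => D (bapp (dpr2 B k) s) x v - U x (bapp (dpr1 B k) s x) v) _ _).
- move=> x a u v.
  by rewrite bfun_lin bifun_linr scalerBr opprD addrACA.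
- move=> X.
  have := sectP (nabla D X (bapp (dpr2 B k) s) - biapp U (bapp (dpr1 B k) s) X).
  congr smooth_sec; apply: functional_extensionality_dep => x.
  exact: sectBE.
Defined.

End CouplingConstruction.

(* Main.v *)
(* For an IM connection 1-form (L, l) the kernel of l is a complement
   j : B -> A of k, and one puts nabla_X xi = L(xi)(X), U(b, X) = - L(j b)(X),
   [xi, eta]_k = l [xi, eta] and [a, b]_B = [j a, j b] modulo k. Then (S1), (S2), (S3)
   are the equation for L([a, b]) with both, one or none of the arguments in k.

   The bundle k is locally trivial as a bundle of Lie algebras because (S1) makes its
   bracket parallel, hence invariant under parallel transport along the rays of a
   chart. Transport solves a linear ODE whose coefficients depend smoothly on the ray;
   its smoothness comes from the convergence of the Picard series together with its
   derivatives, a derivative in a parameter again solving a linear ODE. *)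

Require Import Defs.
From HB Require Import structures.
From mathcomp Require Import all_boot all_order all_algebra.
From mathcomp Require Import all_classical all_reals all_analysis.
From mathcomp Require Import ring lra.
Set Implicit Arguments.
Unset Strict Implicit.
Unset Printing Implicit Defensive.
Import Order.TTheory GRing.Theory Num.Theory.
Import numFieldNormedType.Exports.
Local Open Scope classical_set_scope.
Local Open Scope ring_scope.

(** * Linear differential equations with parameters *)

(** The notion of a bundle of ideals says nothing about local triviality of the fibrewise Lie
    algebras, which therefore has to be derived; this alone is what calls for differential
    equations. The connection form in a chart is multiplied by a bump function, so that it lives on
    all of Euclidean space and linear systems on the whole of R suffice; on a smaller ball it is
    still the true one. Bundle maps act on fibres, whereas brackets, connections and L act on global
    sections. Bump functions extend vectors and frames to global sections, and linearity over the
    smooth functions shows that a value such as [xi, eta](x), for sections of k, depends only on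
    xi(x) and eta(x). Skew-symmetry of the bracket on the direct sum of B and k amounts to U(a, rho
    b) = - U(b, rho a), which has to be extracted from (S3). As a vector bundle, ker l takes its
    trivializations from the smooth idempotent a - inc(l a), whose rank is constant. *)

Section DirectionalDerivatives.
Variables (R : realType) (V : normedModType R).
Implicit Types (f g : V -> R) (y v : V) (d e : R).

(** Multiplying the difference quotient by h removes the division: the bound also makes sense at h =
    0, so estimates run over full neighbourhoods of 0. *)
Lemma is_derive_epsP f y v d :
  is_derive y v f d <->
  forall e : R, 0 < e -> \forall h \near (0 : R),
    `|f (h *: v + y) - f y - h * d| <= e * `|h|.
Proof.
split=> [[fd dE] e e0|H].
  have fv : h^-1 *: (f (h *: v + y) - f y) @[h --> (0:R)^'] --> d.
    by rewrite -dE; exact: fd.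
  move/cvgrPdist_le : fv => /(_ e e0); rewrite near_withinE => H.
  near=> h; have [->|h0] := eqVneq h 0.
    by rewrite scale0r add0r subrr mul0r subr0 normr0 mulr0.
  have : `|d - h^-1 * (f (h *: v + y) - f y)| <= e.
    by move: h0; near: h; exact: H.
  rewrite -(ler_pM2r (_ : 0 < `|h|)) ?normr_gt0 // -normrM.
  by rewrite mulrBl mulrAC mulVf // mul1r distrC (mulrC d).
have fv : h^-1 *: (f (h *: v + y) - f y) @[h --> (0:R)^'] --> d.
  apply/cvgrPdist_le => e e0; rewrite near_withinE.
  apply: filterS (H e e0) => h + h0.
  rewrite -[h^-1 *: _]/(h^-1 * _) -ler_pdivrMr ?normr_gt0 //.
  rewrite -normfV -normrM mulrBl mulrAC mulfV // mul1r distrC.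
  by rewrite (mulrC h^-1).
by split; [apply/cvg_ex; exists d|exact/cvg_lim].
Unshelve. all: by end_near. Qed.

End DirectionalDerivatives.

Section Lines.
Variables (R : realType) (V : normedModType R).
Implicit Types (f g : V -> R) (y v : V) (d e : R).

(** Both sides have the same first-order expansion. This reduces directional derivatives to
    functions on R, where the mean value theorem and the one-variable chain rule are at hand. *)
Lemma is_derive_line f y v d :
  is_derive y v f d <-> is_derive (0 : R) 1 (fun h => f (h *: v + y)) d.
Proof.
split => [/is_derive_epsP H|/(is_derive_epsP _ _ _ _) H]; apply/is_derive_epsP => eps e0;
  apply: filterS (H _ e0) => h;
  by rewrite /= addr0 scale0r add0r [_ *: (1 : R)]mulr1.
Qed.

Lemma is_derive_lineD f y v h d :
  is_derive (h *: v + y) v f d <-> is_derive h 1 (fun h => f (h *: v + y)) d.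
Proof.
split => [/is_derive_epsP H|/(is_derive_epsP _ _ _ _) H]; apply/is_derive_epsP => eps e0;
  by apply: filterS (H _ e0) => k; rewrite /= [_ *: (1 : R)]mulr1 scalerDl addrA.
Qed.

End Lines.

Section MeanValue.
Variable R : realType.
Implicit Types f df : R -> R.

Lemma is_derive1_continuous f (x d : R) : is_derive (x : R) (1 : R) f d -> {for x, continuous f}.
Proof. by case=> /derivable1_diffP /differentiable_continuous. Qed.

Lemma MVT_le f df (a b C : R) : a <= b ->
  (forall x, a <= x <= b -> is_derive (x : R) (1 : R) f (df x)) ->
  (forall x, a <= x <= b -> `|df x| <= C) ->
  `|f b - f a| <= C * (b - a).
Proof.
move=> ab fd dC.
have [x xab ->] : exists2 c, c \in `[a, b]%R & f b - f a = df c * (b - a).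
  apply: MVT_segment => // [x|].
    by rewrite in_itv /= => /andP[/ltW ? /ltW ?]; apply: fd; apply/andP.
  apply: derivable_within_continuous => x; rewrite in_itv /= => xab.
  by case: (fd x xab).
rewrite normrM (ger0_norm (_ : 0 <= b - a)) ?subr_ge0 //.
by apply: ler_wpM2r; [rewrite subr_ge0|apply: dC; move: xab; rewrite in_itv].
Qed.

Lemma MVT_le_sym f df (r C : R) :
  (forall x, `|x| <= r -> is_derive (x : R) (1 : R) f (df x)) ->
  (forall x, `|x| <= r -> `|df x| <= C) ->
  forall x, `|x| <= r -> `|f x - f 0| <= C * `|x|.
Proof.
move=> fd dC x; rewrite ler_norml => /andP[x1 x2].
have [x0|x0] := leP 0 x.
  rewrite (ger0_norm x0) -[X in _ * X]subr0.
  by apply: (MVT_le x0) => y /andP[y1 y2]; [apply: fd|apply: dC];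
    rewrite ler_norml; apply/andP; split; lra.
rewrite (ltr0_norm x0) distrC -[X in _ * X]add0r.
by apply: (MVT_le (ltW x0)) => y /andP[y1 y2]; [apply: fd|apply: dC];
  rewrite ler_norml; apply/andP; split; lra.
Qed.

Lemma is_derive0_const f (a b : R) : a <= b ->
  (forall x, a <= x <= b -> is_derive (x : R) (1 : R) f 0) -> f b = f a.
Proof.
move=> ab fd; apply/eqP; rewrite -subr_eq0 -normr_le0.
have := @MVT_le f (fun=> 0) a b 0 ab fd; rewrite mul0r; apply.
by move=> x _; rewrite normr0.
Qed.

Lemma MVT_le0 f df (r C : R) : f 0 = 0 ->
  (forall x : R, `|x| <= r -> is_derive (x : R) (1 : R) f (df x)) ->
  (forall x : R, `|x| <= r -> `|df x| <= C) ->
  forall x : R, `|x| <= r -> `|f x| <= C * `|x|.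
Proof. by move=> f0 fd dC x /(MVT_le_sym fd dC); rewrite f0 subr0. Qed.

(** For the remainder of a first-order expansion: its derivative d - c' is small when the derivative
    of f is continuous, and [MVT_le0] then bounds the remainder by a small multiple of the
    increment. *)
Lemma is_derive_sub_affine f (x d c c' : R) : is_derive (x : R) (1 : R) f d ->
  is_derive (x : R) (1 : R) (fun k => f k - c - k * c') (d - c').
Proof.
move=> fd; apply: is_deriveB.
  by rewrite -[d]subr0; apply: is_deriveB.
have := is_deriveZ (f := id) c' (is_derive_id x 1).
by rewrite [c' *: _]mulr1; congr is_derive; apply/funext => k; rewrite mulrC.
Qed.

(* Comparison with [expR (l * |t|)], whose derivative for t > 0 is l times itself. *)
Lemma exp_comparison f df (T B l : R) : 0 <= B -> 0 < l -> f 0 = 0 ->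
  (forall x, is_derive (x : R) (1 : R) f (df x)) ->
  (forall s, `|s| <= T -> `|df s| <= B * l * expR (l * `|s|)) ->
  forall t, `|t| <= T -> `|f t| <= B * expR (l * `|t|).
Proof.
move=> B0 l0 f0 fd dle.
(* One-sided case: the difference [G] of the two sides is nondecreasing on [0, t], and its value at
   0 is B >= 0. The lower bound follows by applying this to - f, negative times by applying it to
   f(- t). *)
have pos (g dg : R -> R) : g 0 = 0 -> (forall x, is_derive (x : R) (1 : R) g (dg x)) ->
    (forall s : R, 0 <= s <= T -> dg s <= B * l * expR (l * s)) ->
    forall t : R, 0 <= t <= T -> g t <= B * expR (l * t).
  move=> g0 gd gle t /andP[t0 tT].
  pose G x := B * expR (l * x) - g x.
  have Gd x : is_derive (x : R) (1 : R) G (B * l * expR (l * x) - dg x).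
    apply: is_deriveB; rewrite -mulrA; apply: is_deriveZ; rewrite (mulrC l (expR _)).
    have := @is_derive1_comp R expR (fun x => l * x) x _ _ (is_derive_expR _).
    by apply; rewrite -[X in is_derive _ _ _ X]mulr1; apply: is_deriveZ.
  have : G 0 <= G t.
    have d1 x : x \in `]0, t[%R -> derivable G x 1 by move=> _; case: (Gd x).
    have d2 x : x \in `]0, t[%R -> 0 <= derive1 G x.
      rewrite in_itv /= => /andP[/ltW x0 /ltW xt]; rewrite derive1E.
      have [_ ->] := Gd x.
      by rewrite subr_ge0; apply: gle; rewrite x0 (le_trans xt).
    have cG : {within `[0, t], continuous G}.
      by apply: derivable_within_continuous => x _; case: (Gd x).
    by apply: (ger0_derive1_le_cc d1 d2 cG) => //; rewrite in_itv /= lexx t0.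
  rewrite /G g0 subr0 mulr0 expR0 mulr1 => le; rewrite -subr_ge0.
  exact: le_trans le.
have N (g dg : R -> R) : (forall x, is_derive (x : R) (1 : R) g (dg x)) ->
    forall x, is_derive (x : R) (1 : R) (fun x => - g x) (- dg x).
  by move=> gd x; apply: is_deriveN.
have Rv (g dg : R -> R) : (forall x, is_derive (x : R) (1 : R) g (dg x)) ->
    forall x, is_derive (x : R) (1 : R) (fun x => g (- x)) (- dg (- x)).
  move=> gd x; rewrite -mulrN1; exact: is_derive1_comp.
move=> t tT; have [t0|t0] := leP 0 t.
  have tT' : 0 <= t <= T by rewrite t0 -(ger0_norm t0).
  rewrite (ger0_norm t0) ler_norml lerNl; apply/andP; split; last first.
    apply: (pos f df) tT' => // s /andP[s0 sT].
    by rewrite -[in leRHS](ger0_norm s0) (le_trans (ler_norm _)) ?dle ?ger0_norm.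
  apply: (pos _ _ _ (N _ _ fd)) tT' => [|s /andP[s0 sT]]; first by rewrite f0 oppr0.
  by rewrite -[in leRHS](ger0_norm s0) (le_trans (ler_norm _)) ?normrN ?dle ?ger0_norm.
have tT' : 0 <= - t <= T by rewrite oppr_ge0 (ltW t0) -(ltr0_norm t0).
rewrite (ltr0_norm t0) -[f t]/((f \o id) t) -[t in `|_ t|]opprK.
rewrite ler_norml lerNl; apply/andP; split; last first.
  apply: (pos _ _ _ (Rv _ _ fd)) tT' => [|s /andP[s0 sT]]; first by rewrite oppr0.
  rewrite -[in leRHS](ger0_norm s0) -normrN.
  by rewrite (le_trans (ler_norm _)) // !normrN -(normrN s) dle // normrN ger0_norm.
apply: (pos _ _ _ (N _ _ (Rv _ _ fd))) tT' => [|s /andP[s0 sT]]; first by rewrite oppr0 f0 oppr0.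
rewrite opprK -[in leRHS](ger0_norm s0) -normrN.
by rewrite (le_trans (ler_norm _)) ?dle ?normrN ?ger0_norm.
Qed.

Lemma primitive_ex f : continuous f ->
  exists F : R -> R, F 0 = 0 /\ forall x : R, is_derive (x : R) (1 : R) F (f x).
Proof.
move=> cf.
pose Fa (a x : R) : R := (\int[lebesgue_measure]_(t in [set` `[a, x]]) (f t))%R.
have Fad (a x : R) : a < x -> is_derive (x : R) (1 : R) (Fa a) (f x).
  move=> ax; have [d1 d2] := @continuous_FTC1_closed R f a x (x + 1)
    (ltac:(by rewrite ltrDl)) (ltac:(apply: continuous_compact_integrable;
      [exact: segment_compact|exact: continuous_subspaceT])) ax (cf x).
  by rewrite derive1E in d2; exact: DeriveDef d1 d2.
(* The lower limit has to lie to the left of both 0 and x, so it moves with x; [FE] shows that it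
   can be frozen, two such primitives differing by a constant. *)
pose base (x : R) : R := - `|x| - 1.
pose F x := Fa (base x) x - Fa (base x) 0.
have FE (a x : R) : a < 0 -> a < x -> F x = Fa a x - Fa a 0.
  move=> a0 ax; rewrite /F.
  have b0 : base x < 0 by rewrite /base; have := normr_ge0 x; lra.
  have bx : base x < x by rewrite /base; have := ler_norm (- x); rewrite normrN; lra.
  pose H y := Fa (base x) y - Fa a y.
  have Hd y : a < y -> base x < y -> is_derive (y : R) (1 : R) H 0.
    by move=> ay by'; rewrite -(subrr (f y)); apply: is_deriveB; exact: Fad.
  suff : H x = H 0 by rewrite /H => e; lra.
  have [x0|/ltW x0] := leP 0 x.
    by apply: is_derive0_const => // y /andP[y0 _]; apply: Hd; lra.
  by apply/esym/is_derive0_const => // y /andP[y0 _]; apply: Hd; lra.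
exists F; split=> [|x]; first by rewrite /F subrr.
have x1 : base x < x by rewrite /base; have := ler_norm (- x); rewrite normrN; lra.
have x2 : base x < 0 by rewrite /base; have := normr_ge0 x; lra.
apply: (@near_eq_is_derive _ _ _ (fun y => Fa (base x) y - Fa (base x) 0)).
  near=> y; apply/esym/FE => //; near: y; exact: lt_nbhsr.
rewrite -[f x]subr0; apply: is_deriveB; exact: Fad.
Unshelve. all: by end_near. Qed.

(** A total function, with the zero function as default value, so that iterated primitives can be
    formed before continuity is known. *)
Definition prim f : R -> R :=
  if pselect (continuous f) is left cf then projT1 (cid (primitive_ex cf)) else fun=> 0.

Lemma primP f : continuous f ->
  prim f 0 = 0 /\ forall x : R, is_derive (x : R) (1 : R) (prim f) (f x).
Proof. by move=> cf; rewrite /prim; case: pselect => // cf'; case: cid. Qed.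

End MeanValue.

(** * Jointly continuous functions and their primitives in time *)

Section JointContinuity.
Variables (R : realType) (V : normedModType R).
Implicit Types (f g : R -> V -> R) (t : R) (y : V).

Definition jcont f := continuous (fun z : R * V => f z.1 z.2).

Lemma jcontP f : jcont f <-> forall t y e, 0 < e ->
  \forall t' \near t & y' \near y, `|f t' y' - f t y| < e.
Proof.
split=> [cf t y e e0|H [t y]].
  have := cf (t, y) => /cvgrPdist_lt /(_ e e0).
  by apply: filterS => -[t' y'] /=; rewrite distrC.
apply/cvgrPdist_lt => e e0; apply: filterS (H t y e e0) => -[t' y'] /=.
by rewrite distrC.
Qed.

Lemma jcont_time f : jcont f -> forall y, continuous (f ^~ y).
Proof.
move=> /jcontP cf y t; apply/cvgrPdist_lt => e e0.
have [[/= P Q] [nP nQ] PQ] := cf t y e e0.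
by apply: filterS nP => t' Pt'; rewrite distrC; exact: (PQ (t', y) (conj Pt' (nbhs_singleton nQ))).
Qed.

(** Tube lemma: compactness of [-T, T] makes one neighbourhood of y serve for all s. *)
Lemma jcont_tube f (T : R) y (e : R) : jcont f -> 0 < e ->
  \forall y' \near y, forall s, `|s| <= T -> `|f s y' - f s y| <= e.
Proof.
move=> /jcontP cf e0.
have e2 : 0 < e / 2 by rewrite divr_gt0.
have cT : compact `[- T, T]%classic by exact: segment_compact.
have /compact_near_coveringP/(_ V (nbhs y) (fun y' s => `|f s y' - f s y| <= e)) := cT.
move=> A; have {}A : \forall y' \near y, `[- T, T]%classic `<=` (fun s => `|f s y' - f s y| <= e).
  apply: A => s _.
  have [[/= P Q] [nP nQ] PQ] := cf s y _ e2.
  exists (P, Q) => //= -[s' y'] [/= Ps Qy]; have Qy0 := nbhs_singleton nQ.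
  have := PQ (s', y') (conj Ps Qy); have := PQ (s', y) (conj Ps Qy0) => /=.
  move=> h1 h2; rewrite -(subrKA (f s y)); rewrite (le_trans (ler_normD _ _)) //.
  by rewrite (distrC (f s y)); lra.
by apply: filterS A => y' H s sT; apply: H; rewrite /= in_itv /= -ler_norml.
Qed.

Lemma jcont_bounded f (T : R) y : jcont f ->
  exists2 K, 0 <= K & \forall y' \near y, forall s, `|s| <= T -> `|f s y'| <= K.
Proof.
move=> cf.
have [T0|T0] := ltP T 0.
  by exists 0 => //; near=> y' => s sT; have := normr_ge0 s; lra.
have c1 : {within `[- T, T], continuous (fun s => `|f s y|)}.
  apply: continuous_subspaceT => s.
  apply: (@continuous_comp R R R (f ^~ y) Num.norm s (@jcont_time _ cf y s)).
  exact: norm_continuous.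
have [|c _ cmax] := EVT_max _ c1; first by lra.
(* The maximum over the segment at y, plus the error 1 granted by [jcont_tube]. *)
exists (`|f c y| + 1); first by rewrite addr_ge0.
apply: filterS (@jcont_tube f T y 1 cf ltr01) => y' H s sT.
rewrite -(subrK (f s y) (f s y')) addrC (le_trans (ler_normD _ _)) // lerD ?H //.
by apply: cmax; rewrite in_itv /= -ler_norml.
Unshelve. all: by end_near. Qed.

Lemma jcont_cst (c : R) : jcont (fun _ _ => c).
Proof. by move=> z; exact: cst_continuous. Qed.

Lemma jcontD f g : jcont f -> jcont g -> jcont (fun t y => f t y + g t y).
Proof. by move=> cf cg z; exact: continuousD (cf z) (cg z). Qed.

Lemma jcontM f g : jcont f -> jcont g -> jcont (fun t y => f t y * g t y).
Proof. by move=> cf cg z; exact: continuousM (cf z) (cg z). Qed.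

Lemma jcont_sum (I : Type) (r : seq I) (f : I -> R -> V -> R) :
  (forall i, jcont (f i)) -> jcont (fun t y => \sum_(i <- r) f i t y).
Proof.
move=> cf; elim: r => [|i r IH].
  rewrite (_ : (fun t y => _) = fun _ _ => 0) //; first exact: jcont_cst.
  by apply/funext => t; apply/funext => y; rewrite big_nil.
rewrite (_ : (fun t y => _) = fun t y => f i t y + \sum_(i <- r) f i t y).
  exact: jcontD.
by apply/funext => t; apply/funext => y; rewrite big_cons.
Qed.

Lemma jcont_comp (g : V -> R) (phi : R -> V -> V) :
  continuous (fun z : R * V => phi z.1 z.2) -> continuous g -> jcont (fun t y => g (phi t y)).
Proof. by move=> cphi cg z; exact: continuous_comp (cphi z) (cg _). Qed.

End JointContinuity.

Section ParametricPrimitive.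
Variables (R : realType) (V : normedModType R).
Implicit Types (f g : R -> V -> R) (t : R) (y v : V).

Definition primt f : R -> V -> R := fun t y => prim (f ^~ y) t.

Lemma primt0 f y : jcont f -> primt f 0 y = 0.
Proof. by move=> cf; case: (primP (@jcont_time _ _ _ cf y)). Qed.

Lemma is_derive_primt f t y : jcont f -> is_derive (t : R) (1 : R) (primt f ^~ y) (f t y).
Proof. by move=> cf; case: (primP (@jcont_time _ _ _ cf y)). Qed.

Lemma primt_lipschitz f y y' (T e : R) : jcont f ->
  (forall s : R, `|s| <= T -> `|f s y' - f s y| <= e) ->
  forall t : R, `|t| <= T -> `|primt f t y' - primt f t y| <= e * `|t|.
Proof.
move=> cf H t tT.
apply: (@MVT_le0 R (fun t => primt f t y' - primt f t y) (fun t => f t y' - f t y) T e) => //.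
  by rewrite !primt0 // subrr.
by move=> s _; apply: is_deriveB; exact: is_derive_primt.
Qed.

(** The increment splits into a change of y at the moving time t', bounded by |t'| times a tube
    estimate over |s| <= |t| + 1, and a change of time at fixed y. *)
Lemma jcont_primt f : jcont f -> jcont (primt f).
Proof.
move=> cf; apply/jcontP => t y e e0.
have T0 : 0 < `|t| + 1 by rewrite ltr_wpDl.
have e2 : 0 < e / 2 by rewrite divr_gt0.
have ct : {for t, continuous (primt f ^~ y)}.
  exact: is_derive1_continuous (is_derive_primt t y cf).
have e3 : 0 < e / 3 / (`|t| + 1) by rewrite !divr_gt0.
have A := @jcont_tube R V f (`|t| + 1) y _ cf e3.
have B : \forall t' \near t, `|t'| <= `|t| + 1.
  exists 1 => //= t' /ltW h; rewrite -(subrK t t') addrC (le_trans (ler_normD _ _)) //.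
  by rewrite lerD2l distrC.
move/cvgrPdist_lt : ct => /(_ _ e2) C.
near=> t' y'.
rewrite -(subrKA (primt f t' y)) (le_lt_trans (ler_normD _ _)) //.
have h1 : `|primt f t' y' - primt f t' y| <= e / 3 / (`|t| + 1) * `|t'|.
  apply: (primt_lipschitz (T := `|t| + 1)) => //.
    by near: y'.
  by near: t'.
have h2 : `|primt f t y - primt f t' y| < e / 2 by near: t'.
have h3 : e / 3 / (`|t| + 1) * `|t'| <= e / 3.
  rewrite -[leRHS](divfK (_ : `|t| + 1 != 0)) ?gt_eqF // ler_wpM2l ?(ltW e3) //.
  by near: t'.
rewrite (distrC (primt f t' y)); lra.
Unshelve. all: by end_near. Qed.

(** Differentiation under the integral sign. The remainder of f s in direction v is at most a small
    multiple of |h|, uniformly in s by the tube lemma for f'. The remainder of the primitive has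
    this one as its time derivative, so a second mean value bound adds the factor |t|. *)
Lemma derive_primt f f' v : jcont f -> jcont f' ->
  (forall t y, is_derive y v (f t) (f' t y)) ->
  forall t y, is_derive y v (primt f t) (primt f' t y).
Proof.
move=> cf cf' fd t y; apply/is_derive_epsP => e e0.
have e3 : 0 < e / (`|t| + 1) by rewrite !divr_gt0 // ltr_wpDl.
have A := @jcont_tube R V f' `|t| y _ cf' e3.
have B : \forall h \near (0:R), forall s, `|s| <= `|t| -> `|f' s (h *: v + y) - f' s y| <= e / (`|t| + 1).
  have c : (fun h : R => h *: v + y) @ 0 --> y.
    rewrite -[X in _ --> X]add0r -(scale0r v); apply: cvgD; last exact: cvg_cst.
    by apply: cvgZr_tmp; exact: cvg_id.
  exact: c _ A.
have [/= d d0 {}B] := B.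
exists d => //= h; rewrite /ball /= sub0r normrN => hd.
have H s : `|s| <= `|t| -> `|f s (h *: v + y) - f s y - h * f' s y| <= e / (`|t| + 1) * `|h|.
  move=> st.
  apply: (@MVT_le0 R (fun k => f s (k *: v + y) - f s y - k * f' s y)
    (fun k => f' s (k *: v + y) - f' s y) `|h| (e / (`|t| + 1))) => //.
    by rewrite scale0r add0r mul0r subrr !subr0.
    by move=> k kh; apply: is_derive_sub_affine; exact: (is_derive_lineD _ _ _ _ _).1.
  by move=> k kh; apply: B => //=; rewrite sub0r normrN (le_lt_trans kh).
have le : `|primt f t (h *: v + y) - primt f t y - h * primt f' t y| <=
    e / (`|t| + 1) * `|h| * `|t|.
  apply: (@MVT_le0 R (fun s => primt f s (h *: v + y) - primt f s y - h * primt f' s y)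
    (fun s => f s (h *: v + y) - f s y - h * f' s y) `|t|) => //.
    by rewrite !primt0 // mulr0 !subr0.
  move=> s _; apply: is_deriveB; first by apply: is_deriveB; exact: is_derive_primt.
  by apply: is_deriveZ; exact: is_derive_primt.
apply: (le_trans le).
rewrite mulrAC ler_wpM2r // -[leRHS](divfK (_ : `|t| + 1 != 0)); last by rewrite gt_eqF // ltr_wpDl.
by rewrite ler_wpM2l ?(ltW e3) // lerDl.
Qed.

End ParametricPrimitive.

(** * Series with geometric bounds and their derivatives *)

Section GeometricSeries.
Variable R : realType.
Implicit Types (u : nat -> R) (B C : R).

Lemma geometric_small C (e : R) : 0 < e -> exists N, C / 2 ^+ N <= e.
Proof.
move=> e0; exists (Num.truncn `|C / e|).+1; set N := _.+1.
rewrite ler_pdivrMr ?exprn_gt0 // mulrC -ler_pdivrMr //.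
apply: (le_trans (ler_norm _)); apply: (le_trans (ltW (truncnS_gt _))).
by rewrite -natrX ler_nat ltnW // ltn_expl.
Qed.

Definition gsum u : R := limn (series u).

Lemma series_geometric_diff u B N m : (forall n, `|u n| <= B / 2 ^+ n) -> (N <= m)%N ->
  `|series u m - series u N| <= 2 * B / 2 ^+ N - 2 * B / 2 ^+ m.
Proof.
move=> uB; elim: m => [|m IH].
  by rewrite leqn0 => /eqP ->; rewrite !subrr normr0.
rewrite leq_eqVlt => /orP[/eqP ->|Nm]; first by rewrite !subrr normr0.
have -> : series u m.+1 - series u N = (series u m - series u N) + u m.
  by rewrite seriesSr; lra.
apply: (le_trans (ler_normD _ _)); have := IH Nm; have := uB m.
rewrite exprSr invfM.
have : 0 < (2 : R) ^+ m by rewrite exprn_gt0.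
lra.
Qed.

Lemma gsum_cvg u B : (forall n, `|u n| <= B / 2 ^+ n) -> cvgn (series u).
Proof.
move=> uB; apply: normed_cvg.
have uB' n : `|u n| <= geometric B 2^-1 n by rewrite /= exprVn.
apply: (series_le_cvg (v_ := geometric B 2^-1)) => [n|n|n|].
- exact: normr_ge0.
- exact: le_trans (normr_ge0 _) (uB' n).
- exact: uB'.
- by apply: is_cvg_geometric_series; rewrite ger0_norm; lra.
Qed.

Lemma gsum_tail u B N : (forall n, `|u n| <= B / 2 ^+ n) ->
  `|gsum u - series u N| <= 2 * B / 2 ^+ N.
Proof.
move=> uB; have cu := gsum_cvg uB.
have B0 : 0 <= B by have := uB 0; rewrite expr0 divr1; exact: le_trans.
have c : `|series u m - series u N| @[m --> \oo] --> `|gsum u - series u N|.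
  by apply: cvg_norm; apply: cvgB => //; exact: cvg_cst.
apply: (cvgr_to_le c); near=> m.
apply: (le_trans (series_geometric_diff uB _)); first by near: m; exact: nbhs_infty_ge.
by rewrite gerBl divr_ge0 // ?mulr_ge0 // exprn_ge0.
Unshelve. all: by end_near. Qed.

(** Both s and the sum are within a multiple of 2^-N of the N-th partial sum. Used to identify sums
    without handling limits. *)
Lemma gsum_uniq u B C s : (forall n, `|u n| <= B / 2 ^+ n) ->
  (forall N, `|s - series u N| <= C / 2 ^+ N) -> s = gsum u.
Proof.
move=> uB sC; apply/eqP; rewrite -subr_eq0 -normr_le0; apply/ler_addgt0Pl => e e0.
have [N le] := geometric_small (C + 2 * B) e0; rewrite addr0; apply: le_trans le.
rewrite -(subrKA (series u N)) (le_trans (ler_normD _ _)) // mulrDl lerD ?sC //.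
by rewrite distrC gsum_tail.
Qed.

Lemma gsumB u v B C : (forall n, `|u n| <= B / 2 ^+ n) ->
  (forall n, `|v n| <= C / 2 ^+ n) -> gsum (fun n => u n - v n) = gsum u - gsum v.
Proof.
move=> uB vC; apply/esym/(@gsum_uniq _ (B + C) (2 * B + 2 * C)) => [n|N].
  by rewrite (le_trans (ler_normB _ _)) // mulrDl lerD.
have -> : series (fun n => u n - v n) N = series u N - series v N.
  by rewrite /series /= sumrB.
rewrite opprB addrACA (addrC _ (series v N)) mulrDl.
rewrite (_ : _ + _ = (gsum u - series u N) - (gsum v - series v N)); last by lra.
by rewrite (le_trans (ler_normB _ _)) // lerD // gsum_tail.
Qed.

Lemma is_derive_gsum (u u' : nat -> R -> R) (B r : R) : 0 < r ->
  (forall n (h : R), `|h| <= r -> is_derive (h : R) (1 : R) (u n) (u' n h)) ->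
  (forall n h, `|h| <= r -> `|u n h| <= B / 2 ^+ n) ->
  (forall n h, `|h| <= r -> `|u' n h| <= B / 2 ^+ n) ->
  is_derive (0 : R) (1 : R) (fun h => gsum (u ^~ h)) (gsum (u' ^~ 0)).
Proof.
move=> r0 ud uB u'B; apply/is_derive_epsP => e e0.
have r00 : `|0 : R| <= r by rewrite normr0 ltW.
have e3 : 0 < e / 3 by rewrite divr_gt0.
have [N hN] := geometric_small (2 * B) e3.
have Sd : is_derive (0 : R) (1 : R) (fun h => series (u ^~ h) N) (series (u' ^~ 0) N).
  rewrite /series /= big_mkord.
  rewrite (_ : (fun h => _) = \sum_(i < N) u i); last first.
    by apply/funext => h; rewrite big_mkord fct_sumE.
  by apply: is_derive_sum => i; exact: ud.
move/is_derive_epsP : Sd => /(_ _ e3) /= Sd.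
near=> h.
have hr : `|h| <= r by near: h; exists r => //= x; rewrite /= sub0r normrN => /ltW.
have Sdh : `|series (u ^~ h) N - series (u ^~ 0) N - h * series (u' ^~ 0) N| <= e / 3 * `|h|.
  have : `|series (u^~ (h *: (1:R) + 0)) N - series (u^~ 0) N - h * series (u'^~ 0) N| <=
    e / 3 * `|h| by near: h; exact: Sd.
  by rewrite addr0 [h *: _]mulr1.
have -> : h *: (1 : R) + 0 = h by rewrite addr0 [h *: _]mulr1.
(* The mean value bound puts a factor |h| into the tails, so the cut-off N can be fixed before h. *)
have du n : `|u n h - u n 0| <= B * `|h| / 2 ^+ n.
  by rewrite mulrAC; apply: (@MVT_le_sym _ (u n) (u' n) r) => // x xr; exact: u'B.
have T1 := gsum_tail N du.
rewrite (gsumB (B := B) (C := B)) in T1 => [|n|n]; [|exact: uB..].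
have T2 : `|gsum (u' ^~ 0) - series (u' ^~ 0) N| <= e / 3.
  by apply: le_trans hN; apply: gsum_tail => n; exact: u'B.
have T1' : `|gsum (u ^~ h) - gsum (u ^~ 0) - (series (u ^~ h) N - series (u ^~ 0) N)| <= e / 3 * `|h|.
  rewrite (_ : series (u ^~ h) N - _ = series (fun n => u n h - u n 0) N); last first.
    by rewrite /series /= sumrB.
  apply: (le_trans T1); rewrite mulrA mulrAC ler_wpM2r //.
have T2' : `|h * gsum (u' ^~ 0) - h * series (u' ^~ 0) N| <= e / 3 * `|h|.
  by rewrite -mulrBr normrM mulrC ler_wpM2r.
move: Sdh T1' T2'.
set a := gsum _; set b := gsum _; set c := series _ N; set d := series _ N.
set x := h * gsum _; set y := h * series _ _.
rewrite !ler_norml => /andP[? ?] /andP[? ?] /andP[? ?].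
by apply/andP; split; lra.
Unshelve. all: by end_near. Qed.

End GeometricSeries.

Section SumsOfFunctions.
Variables (R : realType) (V : normedModType R).
Implicit Types (u w : nat -> R -> V -> R).

(** The majorant condition of Weierstrass with the ratio fixed to 1/2. The constant is uniform near
    y and on bounded times, which gives locally uniform convergence. *)
Definition locally_geometric u := forall (T : R) (y : V), exists B : R,
  \forall y' \near y, forall n (s : R), `|s| <= T -> `|u n s y'| <= B / 2 ^+ n.

Definition fsum u : R -> V -> R := fun t y => gsum (fun n => u n t y).

Lemma jcont_fsum u : locally_geometric u -> (forall n, jcont (u n)) -> jcont (fsum u).
Proof.
move=> ug uc; apply/jcontP => t y e e0.
have [B hB] := ug (`|t| + 1) y.
have e3 : 0 < e / 4 by rewrite divr_gt0.
have [N hN] := geometric_small (2 * B) e3.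
have cS : jcont (fun t y => series (fun n => u n t y) N).
  by apply: jcont_sum.
move/jcontP : cS => /(_ t y _ e3)[[/= P Q] [nP nQ] PQ].
have tT : \forall t' \near t, `|t'| <= `|t| + 1.
  exists 1 => //= t' /ltW h; rewrite -(subrK t t') addrC (le_trans (ler_normD _ _)) //.
  by rewrite lerD2l distrC.
have hB0 := nbhs_singleton hB.
near=> t' y'.
have h1 : `|fsum u t' y' - series (fun n => u n t' y') N| <= e / 4.
  apply: le_trans hN; apply: gsum_tail => n.
  have H : forall n (s : R), `|s| <= `|t| + 1 -> `|u n s y'| <= B / 2 ^+ n by near: y'.
  by apply: H; near: t'.
have h2 : `|fsum u t y - series (fun n => u n t y) N| <= e / 4.
  by apply: le_trans hN; apply: gsum_tail => n; apply: hB0; rewrite lerDl.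
have h3 : `|series (fun n => u n t' y') N - series (fun n => u n t y) N| < e / 4.
  have Pt : P t' by near: t'.
  have Qy : Q y' by near: y'.
  exact: (PQ (t', y') (conj Pt Qy)).
move: h1 h2 h3; rewrite !ler_norml !ltr_norml => /andP[? ?] /andP[? ?] /andP[? ?].
by apply/andP; split; lra.
Unshelve. all: by end_near. Qed.

Lemma derive_fsum u u' v : locally_geometric u -> locally_geometric u' ->
  (forall n t y, is_derive y v (u n t) (u' n t y)) ->
  forall t y, is_derive y v (fsum u t) (fsum u' t y).
Proof.
move=> ug ug' ud t y; apply/is_derive_line.
have [B hB] := ug `|t| y; have [B' hB'] := ug' `|t| y.
have c : (fun h : R => h *: v + y) @ 0 --> y.
  rewrite -[X in _ --> X]add0r -(scale0r v); apply: cvgD; last exact: cvg_cst.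
  by apply: cvgZr_tmp; exact: cvg_id.
have {}hB : \forall h \near (0 : R), forall n (s : R), `|s| <= `|t| ->
  `|u n s (h *: v + y)| <= B / 2 ^+ n := c _ hB.
have {}hB' : \forall h \near (0 : R), forall n (s : R), `|s| <= `|t| ->
  `|u' n s (h *: v + y)| <= B' / 2 ^+ n := c _ hB'.
have [r /= r0 H] := filterI hB hB'.
have mx n (a b C : R) : a <= C -> `|b| <= a / 2 ^+ n -> `|b| <= C / 2 ^+ n.
  by move=> aC h; apply: (le_trans h); rewrite ler_wpM2r // invr_ge0 exprn_ge0.
have := @is_derive_gsum _ (fun n h => u n t (h *: v + y)) (fun n h => u' n t (h *: v + y))
  (Num.max B B') (r / 2).
rewrite scale0r add0r; apply; first by rewrite divr_gt0.
- by move=> n h _; exact: (is_derive_lineD _ _ _ _ _).1.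
- move=> n h hr; have [|h1 _] := H h; first by rewrite /= sub0r normrN; lra.
  by apply: mx (h1 n t (lexx _)); rewrite le_max lexx.
- move=> n h hr; have [|_ h1] := H h; first by rewrite /= sub0r normrN; lra.
  by apply: mx (h1 n t (lexx _)); rewrite le_max lexx orbT.
Qed.

Lemma derive_time_fsum u u' : locally_geometric u -> locally_geometric u' ->
  (forall n (t : R) y, is_derive (t : R) (1 : R) (u n ^~ y) (u' n t y)) ->
  forall (t : R) y, is_derive (t : R) (1 : R) (fsum u ^~ y) (fsum u' t y).
Proof.
move=> ug ug' ud t y; apply/is_derive_line.
(* One unit of room, since differentiating in time moves t. *)
have [B hB] := ug (`|t| + 1) y; have [B' hB'] := ug' (`|t| + 1) y.
have {}hB := nbhs_singleton hB; have {}hB' := nbhs_singleton hB'.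
have mx n (a b C : R) : a <= C -> `|b| <= a / 2 ^+ n -> `|b| <= C / 2 ^+ n.
  by move=> aC h; apply: (le_trans h); rewrite ler_wpM2r // invr_ge0 exprn_ge0.
have ht (h : R) : `|h| <= 1 -> `|h *: (1 : R) + t| <= `|t| + 1.
  by move=> h1; rewrite [h *: _]mulr1 addrC (le_trans (ler_normD _ _)) // lerD2l.
have := @is_derive_gsum _ (fun n (h : R) => u n (h *: (1 : R) + t) y)
  (fun n (h : R) => u' n (h *: (1 : R) + t) y) (Num.max B B') 1 ltr01.
rewrite scale0r add0r; apply.
- by move=> n h _; exact: (is_derive_lineD _ _ _ _ _).1.
- by move=> n h /ht hr; apply: mx (hB n _ hr); rewrite le_max lexx.
- by move=> n h /ht hr; apply: mx (hB' n _ hr); rewrite le_max lexx orbT.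
Qed.

End SumsOfFunctions.

(** * The Picard series of a linear system and its dependence on parameters *)

Section LinearODE.
Variables (R : realType) (V : normedModType R).

Section Picard.
Variables (I : finType) (A : I -> I -> R -> V -> R) (x0 : I -> R).
Hypothesis Ac : forall i j, jcont (A i j).

(* Picard terms of the row system x' = x A. *)
Fixpoint picard (n : nat) (j : I) : R -> V -> R :=
  if n is n'.+1 then primt (fun t y => \sum_i picard n' i t y * A i j t y)
  else fun _ _ => x0 j.

(** The time derivative of the Picard term: zero at n = 0, where the term is constant, and term n
    times A at n.+1. *)
Definition picard_rate (n : nat) (j : I) : R -> V -> R :=
  if n is n'.+1 then fun t y => \sum_i picard n' i t y * A i j t y
  else fun _ _ => 0.

Lemma jcont_picard n j : jcont (picard n j) /\ jcont (picard_rate n j).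
Proof.
elim: n j => [|n IH] j; first by split; exact: jcont_cst.
have cr : jcont (picard_rate n.+1 j).
  by apply: jcont_sum => i; apply: jcontM; [case: (IH i)|].
by split => //; exact: jcont_primt.
Qed.

Lemma is_derive_picard n j (t : R) y :
  is_derive (t : R) (1 : R) (picard n j ^~ y) (picard_rate n j t y).
Proof.
case: n => [|n]; first exact: is_derive_cst.
by apply: is_derive_primt; case: (jcont_picard n.+1 j).
Qed.

(** Each Picard step halves the norm weighted by exp(l |t|): A multiplies by at most K #|I| <= l /
    2, and integrating the exponential divides by l. The summand 1 keeps l positive. The series is
    thus geometric on every time interval, with no smallness condition on T or K. *)
Lemma picard_bound (T K B : R) y : 0 <= K -> 0 <= B ->
  (forall i j (s : R), `|s| <= T -> `|A i j s y| <= K) ->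
  (forall j, `|x0 j| <= B) ->
  let l := 2 * K *+ #|I| + 1 in
  forall n j (t : R), `|t| <= T ->
    `|picard n j t y| <= B / 2 ^+ n * expR (l * `|t|) /\
    `|picard_rate n.+1 j t y| <= B / 2 ^+ n.+1 * l * expR (l * `|t|).
Proof.
move=> K0 B0 AK xB l n.
have l0 : 0 < l by rewrite ltr_wpDl // mulrn_wge0 // mulr_ge0.
have rate m : (forall j (t : R), `|t| <= T -> `|picard m j t y| <= B / 2 ^+ m * expR (l * `|t|)) ->
    forall j (t : R), `|t| <= T -> `|picard_rate m.+1 j t y| <= B / 2 ^+ m.+1 * l * expR (l * `|t|).
  move=> H j t tT; apply: (le_trans (ler_norm_sum _ _ _)).
  apply: (@le_trans _ _ (\sum_(i : I) B / 2 ^+ m * expR (l * `|t|) * K)).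
    by apply: ler_sum => i _; rewrite normrM ler_pM // ?H ?AK.
  rewrite sumr_const -mulrnAr exprSr invfM.
  set a := B / 2 ^+ m; have a0 : 0 <= a by rewrite divr_ge0 // exprn_ge0.
  have -> : B * (2 ^- m / 2) = a / 2 by rewrite /a mulrA.
  rewrite -mulrA [expR _ * _]mulrC mulrA ler_wpM2r ?expR_ge0 //.
  rewrite -mulrA ler_wpM2l // /l -mulrnAr.
  have := mulrn_wge0 #|I| K0; set b := K *+ _; lra.
elim: n => [|n IH] j t tT.
  have H i (s : R) : `|s| <= T -> `|picard 0 i s y| <= B / 2 ^+ 0 * expR (l * `|s|).
    move=> _; rewrite expr0 divr1 (le_trans (xB i)) //= ler_peMr //.
    by rewrite -expR0 ler_expR mulr_ge0 // ltW.
  by split; [exact: H|exact: rate].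
have H i (s : R) : `|s| <= T -> `|picard n.+1 i s y| <= B / 2 ^+ n.+1 * expR (l * `|s|).
  apply: (@exp_comparison R (picard n.+1 i ^~ y) (picard_rate n.+1 i ^~ y)) => //.
  - by rewrite divr_ge0 // exprn_ge0.
  - by apply: primt0; case: (jcont_picard n.+1 i).
  - by move=> s'; exact: is_derive_picard.
  - by move=> s' s'T; case: (IH i s' s'T).
by split; [exact: H|exact: rate].
Qed.

Lemma picard_geometric : exists2 b : R -> V -> R, forall T y, 0 <= b T y &
  forall T y, \forall y' \near y, forall n j (s : R), `|s| <= T ->
    `|picard n j s y'| <= b T y / 2 ^+ n /\ `|picard_rate n j s y'| <= b T y / 2 ^+ n.
Proof.
suff H (p : R * V) : exists2 b, 0 <= b & \forall y' \near p.2, forall n j (s : R), `|s| <= p.1 ->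
    `|picard n j s y'| <= b / 2 ^+ n /\ `|picard_rate n j s y'| <= b / 2 ^+ n.
  exists (fun T y => projT1 (cid2 (H (T, y)))) => T y; by case: (cid2 (H (T, y))).
case: p => T y /=.
(* One bound for the finitely many entries: the sum of the bounds of each. *)
have [K K0 AK] : exists2 K, 0 <= K & \forall y' \near y, forall i j (s : R), `|s| <= T -> `|A i j s y'| <= K.
  have kb (ij : I * I) := cid2 (@jcont_bounded R V (A ij.1 ij.2) T y (@Ac ij.1 ij.2)).
  pose k ij := projT1 (kb ij).
  have k0 ij : 0 <= k ij by rewrite /k; case: (kb ij).
  have kP ij : \forall y' \near y, forall s : R, `|s| <= T -> `|A ij.1 ij.2 s y'| <= k ij.
    by rewrite /k; case: (kb ij).
  exists (\sum_ij k ij); first exact: sumr_ge0.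
  have : \forall y' \near y, forall ij, forall s : R, `|s| <= T -> `|A ij.1 ij.2 s y'| <= k ij.
    exact: filter_forall.
  apply: filterS => y' H i j s sT; apply: (le_trans (H (i, j) s sT)).
  by rewrite (bigD1 (i, j)) //= lerDl sumr_ge0.
pose B := \sum_j `|x0 j|.
have B0 : 0 <= B by exact: sumr_ge0.
have xB j : `|x0 j| <= B by rewrite /B (bigD1 j) //= lerDl sumr_ge0.
pose l := 2 * K *+ #|I| + 1.
have l1 : 1 <= l by rewrite lerDr mulrn_wge0 // mulr_ge0.
have l0 : 0 <= l by apply: le_trans l1.
(* On |s| <= T the weight is at most exp(l T). The factor l comes from the rates; as l >= 1 it is
   harmless for the terms. *)
exists (B * l * expR (l * T)); first by rewrite !mulr_ge0 ?expR_ge0.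
apply: filterS AK => y' AK n j s sT.
have T0 : 0 <= T by exact: le_trans sT.
have e n' (c : R) : 0 <= c -> B / 2 ^+ n' * c * expR (l * `|s|) <= B * c * expR (l * T) / 2 ^+ n'.
  move=> c0; rewrite [leRHS]mulrAC [B * c / _]mulrAC ler_wpM2l //.
    by rewrite !mulr_ge0 // invr_ge0 exprn_ge0.
  by rewrite ler_expR ler_wpM2l.
have [h1 _] := picard_bound K0 B0 AK xB n j sT; rewrite -/l in h1.
split.
  apply: (le_trans h1); rewrite -[B / _]mulr1; apply: (le_trans (e n 1 _)) => //.
  rewrite ler_wpM2r // ?invr_ge0 ?exprn_ge0 // ler_wpM2r ?expR_ge0 //.
  by rewrite ler_wpM2l.
case: n {h1} => [|n]; first by rewrite /picard_rate normr0 !mulr_ge0 ?expR_ge0 ?invr_ge0.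
have [_ h2] := picard_bound K0 B0 AK xB n j sT; rewrite -/l in h2.
by apply: (le_trans h2); exact: e.
Qed.

Definition picard_sol (j : I) : R -> V -> R := fsum (fun n => picard n j).

Lemma locally_geometric_picard j : locally_geometric (fun n => picard n j).
Proof.
have [b b0 H] := picard_geometric; move=> T y; exists (b T y).
by apply: filterS (H T y) => y' h n s sT; case: (h n j s sT).
Qed.

Lemma locally_geometric_picard_rate j : locally_geometric (fun n => picard_rate n j).
Proof.
have [b b0 H] := picard_geometric; move=> T y; exists (b T y).
by apply: filterS (H T y) => y' h n s sT; case: (h n j s sT).
Qed.

Lemma jcont_picard_sol j : jcont (picard_sol j).
Proof.
apply: jcont_fsum; first exact: locally_geometric_picard.
by move=> n; case: (jcont_picard n j).
Qed.

(** Only the zeroth term is nonzero at time 0. The error constant |x0 j| accounts for N = 0, where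
    the partial sum is empty. *)
Lemma picard_sol0 j y : picard_sol j 0 y = x0 j.
Proof.
apply/esym/(@gsum_uniq R _ (`|x0 j|) (`|x0 j|)) => [[|n]|[|N]].
- by rewrite expr0 divr1.
- rewrite /= primt0; last by case: (jcont_picard n.+1 j).
  by rewrite normr0 divr_ge0 // exprn_ge0.
- by rewrite /series /= big_geq // subr0 expr0 divr1.
- rewrite /series /= big_nat_recl //= big1 ?addr0 ?subrr ?normr0 ?divr_ge0 ?exprn_ge0 // => n _.
  by apply: primt0; case: (jcont_picard n.+1 j).
Qed.

Lemma is_derive_picard_sol j (t : R) y :
  is_derive (t : R) (1 : R) (picard_sol j ^~ y) (\sum_i picard_sol i t y * A i j t y).
Proof.
have -> : \sum_i picard_sol i t y * A i j t y = fsum (fun n => picard_rate n j) t y.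
  have [B hB] := locally_geometric_picard_rate j `|t| y.
  have [b b0 /(_ `|t| y) /nbhs_singleton H] := picard_geometric.
  pose K := \sum_i `|A i j t y|.
  (* The first N.+1 rates add up to the first N terms times A, so the error is K times a tail 2 b /
     2^N = 4 b / 2^(N+1). *)
  apply: (@gsum_uniq R _ B (4 * b `|t| y * K)) => [n|N].
    exact: (nbhs_singleton hB).
  have K0 : 0 <= K by exact: sumr_ge0.
  have b4 := b0 `|t| y; set b1 := b `|t| y in H b4 *.
  have tail M i : `|picard_sol i t y - series (fun n => picard n i t y) M| <= 2 * b1 / 2 ^+ M.
    by apply: gsum_tail => n; case: (H n i t (lexx _)).
  have bound (z : I -> R) c : (forall i, `|z i| <= c) -> `|\sum_i z i * A i j t y| <= c * K.
    move=> zc; apply: (le_trans (ler_norm_sum _ _ _)); rewrite /K mulr_sumr.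
    by apply: ler_sum => i _; rewrite normrM ler_wpM2r.
  case: N => [|N].
    rewrite /series /= big_geq // subr0 expr0 divr1.
    apply: (le_trans (bound _ (2 * b1) _)) => [i|]; last by rewrite ler_wpM2r //; lra.
    by have := tail 0 i; rewrite /series /= big_geq // subr0 expr0 divr1.
  have -> : series (fun n => picard_rate n j t y) N.+1 =
     \sum_i series (fun n => picard n i t y) N * A i j t y.
    rewrite /series /= big_nat_recl //= add0r exchange_big /=.
    by apply: eq_bigr => i _; rewrite mulr_suml.
  rewrite -sumrB; under eq_bigr do rewrite -mulrBl.
  apply: (le_trans (bound _ _ (tail N))); rewrite exprSr invfM.
  set a := (2 ^+ N)^-1; lra.
apply: derive_time_fsum; [exact: locally_geometric_picard|exact: locally_geometric_picard_rate|].
by move=> n t' y'; exact: is_derive_picard.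
Qed.

End Picard.

(** Derivatives are taken in the parameter only and are jointly continuous in time and parameter.
    Differentiation under the integral sign preserves this class, and smoothness of the transport is
    wanted only at time 1. *)
Fixpoint pCk (k : nat) (f : R -> V -> R) : Prop :=
  jcont f /\
  (if k is k'.+1 then
     forall v, (forall t y, derivable (f t) y v) /\ pCk k' (fun t y => 'D_v (f t) y)
   else True).

Lemma pCk_jcont k f : pCk k f -> jcont f.
Proof. by case: k => [|k] []. Qed.

Lemma pCkS k f : pCk k.+1 f -> pCk k f.
Proof.
elim: k f => [|k IH] f [cf df]; first by split.
by split=> // v; have [? /IH ?] := df v.
Qed.

Lemma pCk_cst k (c : R) : pCk k (fun _ _ => c).
Proof.
elim: k c => [|k IH] c; first by split=> //; exact: jcont_cst.
split=> [|v]; first exact: jcont_cst.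
split=> [t y|]; first exact: derivable_cst.
have -> : (fun _ : R => 'D_v (fun=> c)) = (fun _ _ => 0) :> (R -> V -> R); last exact: IH.
by apply/funext => t; apply/funext => y; exact: derive_cst.
Qed.

Lemma pCk_add k f g : pCk k f -> pCk k g -> pCk k (fun t y => f t y + g t y).
Proof.
elim: k f g => [|k IH] f g [cf df] [cg dg]; first by split=> //; exact: jcontD.
split=> [|v]; first exact: jcontD.
have [df1 df2] := df v; have [dg1 dg2] := dg v.
split=> [t y|]; first exact: derivableD.
rewrite (_ : (fun t y => _) = fun t y => 'D_v (f t) y + 'D_v (g t) y); first exact: IH.
by apply/funext => t; apply/funext => y; exact: deriveD.
Qed.

Lemma pCk_mul k f g : pCk k f -> pCk k g -> pCk k (fun t y => f t y * g t y).
Proof.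
elim: k f g => [|k IH] f g Cf Cg.
  by split=> //; apply: jcontM; [exact: pCk_jcont Cf|exact: pCk_jcont Cg].
have [f0 g0] := (pCkS Cf, pCkS Cg); case: Cf Cg => cf df [cg dg].
split=> [|v]; first exact: jcontM.
have [df1 df2] := df v; have [dg1 dg2] := dg v.
split=> [t y|]; first exact: derivableM.
rewrite (_ : (fun t y => _) = fun t y => f t y * 'D_v (g t) y + g t y * 'D_v (f t) y).
  by apply: pCk_add; exact: IH.
by apply/funext => t; apply/funext => y; exact: deriveM.
Qed.

Lemma pCk_sum k (I : Type) (r : seq I) (f : I -> R -> V -> R) :
  (forall i, pCk k (f i)) -> pCk k (fun t y => \sum_(i <- r) f i t y).
Proof.
move=> cf; elim: r => [|i r IH].
  rewrite (_ : (fun t y => _) = fun _ _ => 0); first exact: pCk_cst.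
  by apply/funext => t; apply/funext => y; rewrite big_nil.
rewrite (_ : (fun t y => _) = fun t y => f i t y + \sum_(i <- r) f i t y).
  exact: pCk_add.
by apply/funext => t; apply/funext => y; rewrite big_cons.
Qed.

(* The derivative of a solution in a parameter direction solves, together with
   the solution, the system with matrix [[A, D_v A], [0, A]]. *)
Definition variational (I : finType) (A : I -> I -> R -> V -> R) (v : V)
    (a b : I + I) : R -> V -> R :=
  match a, b with
  | inl i, inl j => A i j
  | inl i, inr j => fun t y => 'D_v (A i j t) y
  | inr i, inr j => A i j
  | inr i, inl j => fun _ _ => 0
  end.

Definition variational_init (I : finType) (x0 : I -> R) (a : I + I) : R :=
  if a is inl i then x0 i else 0.

Lemma variational_pCk (I : finType) (A : I -> I -> R -> V -> R) v k :
  (forall i j, pCk k.+1 (A i j)) -> forall a b, pCk k (variational A v a b).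
Proof.
move=> Ac [i|i] [j|j] /=; [exact: pCkS| |exact: pCk_cst|exact: pCkS].
by case: (Ac i j) => _ /(_ v)[].
Qed.

(** By induction: the product rule applied to the integrand of the next term yields the integrand of
    the [inr] component of the enlarged system, while the zero block leaves the [inl] components
    those of the original one. *)
Lemma derive_picard (I : finType) (A : I -> I -> R -> V -> R) x0 v :
  (forall i j, pCk 1 (A i j)) ->
  forall n j,
    picard (variational A v) (variational_init x0) n (inl j) = picard A x0 n j /\
    forall t y, is_derive y v (picard A x0 n j t)
      (picard (variational A v) (variational_init x0) n (inr j) t y).
Proof.
move=> Ac; have Ac0 i j := pCk_jcont (Ac i j).
have Bc a b := pCk_jcont (@variational_pCk I A v 0 Ac a b).
elim=> [|n IH] j; first by split=> // t y; exact: is_derive_cst.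
split=> /= [|t y].
  congr primt; apply/funext => t; apply/funext => y.
  rewrite big_sumType /= [X in _ + X]big1 ?addr0; last by move=> i _; rewrite mulr0.
  by apply: eq_bigr => i _; case: (IH i) => ->.
apply: derive_primt => [||{}t {}y].
- by apply: jcont_sum => i; apply: jcontM => //; case: (jcont_picard x0 Ac0 n i).
- by apply: jcont_sum => i; apply: jcontM => //; case: (jcont_picard (variational_init x0) Bc n i).
rewrite big_sumType /= -big_split /=.
rewrite (_ : (fun y => _) = \sum_i (fun y => picard A x0 n i t y * A i j t y)); last first.
  by apply/funext => z; rewrite fct_sumE.
have -> : \sum_i (picard (variational A v) (variational_init x0) n (inl i) t y * 'D_v (A i j t) y +
    picard (variational A v) (variational_init x0) n (inr i) t y * A i j t y) =
   \sum_(i < #|I|) (picard A x0 n (enum_val i) t y *: 'D_v (A (enum_val i) j t) y +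
     A (enum_val i) j t y *: picard (variational A v) (variational_init x0) n (inr (enum_val i)) t y).
  rewrite (reindex (enum_val (A := I))) /=; last exact: onW_bij (enum_val_bij I).
  by apply: eq_bigr => i _; case: (IH (enum_val i)) => -> _; rewrite [X in _ + X]mulrC.
have -> : \sum_i (fun y => picard A x0 n i t y * A i j t y) =
    \sum_(i < #|I|) (picard A x0 n (enum_val i) t * A (enum_val i) j t).
  by rewrite (reindex (enum_val (A := I))) //=; exact: onW_bij (enum_val_bij I).
apply: is_derive_sum => i; apply: is_deriveM; first by case: (IH (enum_val i)).
by apply: derivableP; case: (Ac (enum_val i) j) => _ /(_ v)[].
Qed.

(** The induction on k quantifies over the index type, since each derivative doubles the system;
    coefficients of class k.+1 give a variational system of class k. *)
Theorem picard_sol_pCk k (I : finType) (A : I -> I -> R -> V -> R) x0 :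
  (forall i j, pCk k (A i j)) -> forall j, pCk k (picard_sol A x0 j).
Proof.
elim: k I A x0 => [|k IH] I A x0 Ac j; have Ac0 i j := pCk_jcont (Ac i j).
  by split => //; exact: jcont_picard_sol.
split=> [|v]; first exact: jcont_picard_sol.
have Ac1 a b : pCk 1 (A a b).
  elim: (k) (Ac a b) => [//|m IHm] /pCkS; exact: IHm.
have Bc a b := pCk_jcont (@variational_pCk I A v k Ac a b).
have dE t y : is_derive y v (picard_sol A x0 j t)
    (picard_sol (variational A v) (variational_init x0) (inr j) t y).
  apply: derive_fsum; [exact: locally_geometric_picard|exact: locally_geometric_picard|].
  by move=> n {}t {}y; case: (derive_picard x0 v Ac1 n j).
split=> [t y|]; first by case: (dE t y).
rewrite (_ : (fun t y => _) = picard_sol (variational A v) (variational_init x0) (inr j)).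
  by apply: IH; exact: variational_pCk.
by apply/funext => t; apply/funext => y; case: (dE t y).
Qed.

End LinearODE.

(** * Smooth functions on Euclidean space *)

Section RowNorm.
Variables (R : realType) (n : nat).
Implicit Types (w : 'rV[R]_n) (r : R).

Lemma rV_norm_le w r : 0 <= r -> (forall i, `|w ord0 i| <= r) -> `|w| <= r.
Proof.
move=> r0 H; rewrite [leLHS]/Num.norm /= mx_normrE; apply: bigmax_le => // -[i j] _ /=.
by rewrite ord1.
Qed.

Lemma rV_norm_lt w r : 0 < r -> (forall i, `|w ord0 i| < r) -> `|w| < r.
Proof.
move=> r0 H; rewrite [ltLHS]/Num.norm /= mx_normrE; apply: bigmax_lt => // -[i j] _ /=.
by rewrite ord1.
Qed.

Lemma coord_le_norm w i : `|w ord0 i| <= `|w|.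
Proof.
rewrite [leRHS]/Num.norm /= mx_normrE.
by apply: (@le_trans _ _ (`|w (ord0, i).1 (ord0, i).2|)) => //; exact: le_bigmax.
Qed.

(** The vertices of the coordinate staircase from 0 to w. *)
Definition rtake (j : nat) w : 'rV[R]_n := \row_i (if (i < j)%N then w ord0 i else 0).

Lemma rtake0 w : rtake 0 w = 0.
Proof. by apply/rowP => i; rewrite !mxE. Qed.

Lemma rtake_all w : rtake n w = w.
Proof. by apply/rowP => i; rewrite !mxE ltn_ord. Qed.

Lemma rtakeS w (j : 'I_n) : rtake j.+1 w = w ord0 j *: delta_mx ord0 j + rtake j w.
Proof.
apply/rowP => i; rewrite !mxE eqxx /= ltnS leq_eqVlt (inj_eq val_inj).
have [->|ij] := eqVneq i j; first by rewrite ltnn mulr1 addr0.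
by rewrite mulr0 add0r.
Qed.

End RowNorm.

Section ChainRule.
Variables (R : realType).

Lemma rV_continuous (T : topologicalType) m (phi : T -> 'rV[R]_m) (y : T) :
  (forall j, {for y, continuous (fun y => phi y ord0 j)}) -> {for y, continuous phi}.
Proof.
move=> H; apply/cvgrPdist_le => r r0.
have A j : \forall h \near y, `|phi y ord0 j - phi h ord0 j| <= r.
  by have /cvgrPdist_le := H j; apply.
apply: filterS (filter_forall _ A) => h B; apply: rV_norm_le; first exact: ltW.
by move=> j; rewrite !mxE.
Qed.

Definition pderive n (f : 'rV[R]_n -> R) (j : 'I_n) (y : 'rV[R]_n) : R :=
  'D_(delta_mx ord0 j) f y.

(* First-order expansion at p, telescoping along the coordinate directions. *)
Lemma C1_expansion n (W : set 'rV[R]_n) (g : 'rV[R]_n -> R) p (e : R) :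
  open W -> Ck 1 W g -> W p -> 0 < e ->
  \forall w \near (0 : 'rV[R]_n),
    `|g (w + p) - g p - \sum_j w ord0 j * pderive g j p| <= e * \sum_j `|w ord0 j|.
Proof.
move=> oW [gc gd] Wp e0.
have near_ok : \forall q \near p, W q /\ forall j, `|pderive g j q - pderive g j p| <= e.
  have nW : \forall q \near p, W q by exact: open_nbhs_nbhs.
  have nD : \forall q \near p, forall j, `|pderive g j q - pderive g j p| <= e.
    have A j : \forall q \near p, `|pderive g j q - pderive g j p| <= e.
      have [_ /= [/(_ _ Wp) /cvgrPdist_le /(_ e e0) + _]] := gd (delta_mx ord0 j).
      by apply: filterS => q; rewrite distrC.
    by apply: filterS (filter_forall _ A).
  by near=> q; split; near: q.
have [r /= r0 rP] := (nbhs_ballP _ _).1 near_ok.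
apply/nbhs_ballP; exists r => // w; rewrite -ball_normE /= sub0r normrN => wr.
(* In the supremum norm no point of the staircase is longer than w, so its translate by p stays in
   the ball. *)
have inW (j : nat) (x : R) (i : 'I_n) : i = j :> nat -> `|x| <= `|w ord0 i| ->
    ball p r (x *: delta_mx ord0 i + (rtake j w + p)).
  move=> ij xw; rewrite -ball_normE /= addrA distrC addrK.
  apply: le_lt_trans wr; apply: rV_norm_le => // k; rewrite !mxE eqxx /=.
  have [->|ki] := eqVneq k i.
    by rewrite mulr1 ij ltnn addr0 (le_trans xw) // coord_le_norm.
  rewrite mulr0 add0r; case: ifP => _; first exact: coord_le_norm.
  by rewrite normr0.
have step (j : 'I_n) : `|g (rtake j.+1 w + p) - g (rtake j w + p) - w ord0 j * pderive g j p|
    <= e * `|w ord0 j|.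
  rewrite rtakeS -[_ *: _ + _ + p]addrA.
  apply: (@MVT_le0 R (fun x => g (x *: delta_mx ord0 j + (rtake j w + p)) - g (rtake j w + p)
      - x * pderive g j p)
    (fun x => pderive g j (x *: delta_mx ord0 j + (rtake j w + p)) - pderive g j p) `|w ord0 j|) => //.
  - by rewrite scale0r add0r subrr mul0r subrr.
  - move=> x xw; apply: is_derive_sub_affine; apply: (is_derive_lineD _ _ _ _ _).1.
    apply: derivableP; have [d _] := gd (delta_mx ord0 j); apply: d.
    by case: (rP _ (inW j x j erefl xw)).
  - by move=> x xw; case: (rP _ (inW j x j erefl xw)).
have -> : g (w + p) - g p = \sum_(j < n) (g (rtake j.+1 w + p) - g (rtake j w + p)).
  rewrite -(big_mkord xpredT (fun j => g (rtake j.+1 w + p) - g (rtake j w + p))).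
  by rewrite telescope_sumr // rtake_all rtake0 add0r.
rewrite -sumrB mulr_sumr; apply: (le_trans (ler_norm_sum _ _ _)); exact: ler_sum.
Unshelve. all: by end_near. Qed.

Lemma chain_rule_curve n (W : set 'rV[R]_n) (g : 'rV[R]_n -> R) (c : R -> 'rV[R]_n)
    (d : 'rV[R]_n) : open W -> Ck 1 W g -> W (c 0) ->
  (forall j, is_derive (0 : R) (1 : R) (fun h => c h ord0 j) (d ord0 j)) ->
  is_derive (0 : R) (1 : R) (fun h => g (c h)) (\sum_j d ord0 j * pderive g j (c 0)).
Proof.
move=> oW Cg Wc cd; apply/is_derive_epsP => e e0.
(* S bounds the coordinate increments of c per unit of |h|, its summands 1 absorbing the error of
   the linear approximation of c; P weighs that error by the partial derivatives of g. Each of the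
   two contributes e / 2. *)
pose S := \sum_j (`|d ord0 j| + 1); pose P := \sum_j `|pderive g j (c 0)|.
have S0 : 0 <= S by apply: sumr_ge0 => j _; exact: addr_ge0.
have P0 : 0 <= P by exact: sumr_ge0.
have cc : (fun h => c h - c 0) @ (0 : R) --> (0 : 'rV[R]_n).
  rewrite -(subrr (c 0)); apply: cvgB; last exact: cvg_cst.
  by apply: rV_continuous => j; exact: is_derive1_continuous (cd j).
have e1 : 0 < e / 2 / (S + 1) by rewrite !divr_gt0 // ltr_wpDl.
have e2 : 0 < e / 2 / (P + 1) by rewrite !divr_gt0 // ltr_wpDl.
have E := cc _ (C1_expansion oW Cg Wc e1).
have lin (r : R) : 0 < r -> \forall h \near (0 : R), forall j,
    `|c h ord0 j - c 0 ord0 j - h * d ord0 j| <= r * `|h|.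
  move=> r0.
  have A j : \forall h \near (0 : R), `|c h ord0 j - c 0 ord0 j - h * d ord0 j| <= r * `|h|.
    have /is_derive_epsP /(_ r r0) := cd j.
    by apply: filterS => h; rewrite addr0 [h *: _]mulr1.
  by apply: filterS (filter_forall _ A).
have L1 := lin _ ltr01; have L2 := lin _ e2.
near=> h.
have -> : h *: (1 : R) + 0 = h by rewrite addr0 [h *: _]mulr1.
have h1 : `|g (c h - c 0 + c 0) - g (c 0) - \sum_j (c h - c 0) ord0 j * pderive g j (c 0)|
   <= e / 2 / (S + 1) * \sum_j `|(c h - c 0) ord0 j| by near: h.
rewrite subrK in h1.
have h2 : \sum_j `|(c h - c 0) ord0 j| <= S * `|h|.
  rewrite /S mulr_suml; apply: ler_sum => j _; rewrite !mxE mulrDl mul1r.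
  rewrite -(subrK (h * d ord0 j) (c h ord0 j - c 0 ord0 j)).
  rewrite (le_trans (ler_normD _ _)) // [leRHS]addrC lerD //.
    by rewrite -[leRHS]mul1r; move: j; near: h.
  by rewrite normrM mulrC.
have h3 : `|\sum_j (c h - c 0) ord0 j * pderive g j (c 0) -
     h * \sum_j d ord0 j * pderive g j (c 0)| <= e / 2 / (P + 1) * `|h| * P.
  rewrite mulr_sumr -sumrB (le_trans (ler_norm_sum _ _ _)) // /P mulr_sumr.
  apply: ler_sum => j _; rewrite mulrA -mulrBl normrM ler_wpM2r // !mxE.
  by move: j; near: h.
rewrite -(subrKA (\sum_j (c h - c 0) ord0 j * pderive g j (c 0))).
rewrite (le_trans (ler_normD _ _)) // [e in leRHS](splitr e) mulrDl lerD //.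
  apply: (le_trans h1); apply: le_trans (ler_wpM2l (ltW e1) h2) _.
  rewrite mulrA ler_wpM2r // mulrAC ler_pdivrMr ?ltr_wpDl //.
  by rewrite ler_wpM2l ?lerDl // ltW // divr_gt0.
apply: (le_trans h3); rewrite mulrAC ler_wpM2r // mulrAC ler_pdivrMr ?ltr_wpDl //.
by rewrite ler_wpM2l ?lerDl // ltW // divr_gt0.
Unshelve. all: by end_near. Qed.

Lemma Ck_C1 n k (U : set 'rV[R]_n) f : Ck k.+1 U f -> Ck 1 U f.
Proof. by elim: k => [//|k IH] /CkS; exact: IH. Qed.

Lemma derive_linear n (U : set 'rV[R]_n) (f : 'rV[R]_n -> R) y v : open U -> Ck 1 U f -> U y ->
  is_derive y v f (\sum_j v ord0 j * pderive f j y).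
Proof.
move=> oU Cf Uy; apply/is_derive_line.
have := @chain_rule_curve n U f (fun h => h *: v + y) v oU Cf.
rewrite scale0r add0r; apply => // j.
apply/is_derive_epsP => e e0; near=> h.
rewrite !mxE addr0 [h *: _]mulr1 mul0r add0r addrK subrr normr0.
by rewrite mulr_ge0 // ltW.
Unshelve. all: by end_near. Qed.

Lemma Ck_opp n k (U : set 'rV[R]_n) f : open U -> Ck k U f -> Ck k U (fun y => - f y).
Proof.
move=> oU Cf; apply: (Ck_ext oU _ (Ck_mul oU (Ck_cst k U (-1)) Cf)) => y _.
by rewrite mulN1r.
Qed.

Lemma Ck_sum n k (U : set 'rV[R]_n) (I : Type) (r : seq I) (f : I -> 'rV[R]_n -> R) : open U ->
  (forall i, Ck k U (f i)) -> Ck k U (fun y => \sum_(i <- r) f i y).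
Proof.
move=> oU Cf; elim: r => [|i r IH].
  by apply: (Ck_ext oU _ (Ck_cst k U 0)) => y _; rewrite big_nil.
by apply: (Ck_ext oU _ (Ck_add oU (Cf i) IH)) => y _; rewrite big_cons.
Qed.

Lemma Ck_prod n k (U : set 'rV[R]_n) (I : Type) (r : seq I) (f : I -> 'rV[R]_n -> R) : open U ->
  (forall i, Ck k U (f i)) -> Ck k U (fun y => \prod_(i <- r) f i y).
Proof.
move=> oU Cf; elim: r => [|i r IH].
  by apply: (Ck_ext oU _ (Ck_cst k U 1)) => y _; rewrite big_nil.
by apply: (Ck_ext oU _ (Ck_mul oU (Cf i) IH)) => y _; rewrite big_cons.
Qed.

Lemma Ck_inv n k (U : set 'rV[R]_n) f : open U -> (forall y, U y -> f y != 0) ->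
  Ck k U f -> Ck k U (fun y => (f y)^-1).
Proof.
move=> oU f0; elim: k => [|k IH] Cf.
  by split=> // y Uy; exact: (cvgV (f0 y Uy) (Ck_cont Cf Uy)).
have Ci := IH (CkS Cf); have [cf df] := Cf.
split=> [y Uy|v]; first by exact: (cvgV (f0 y Uy) (cf y Uy)).
have [d1 d2] := df v.
split=> [y Uy|]; first by apply: derivableV; [exact: f0|exact: d1].
apply: (Ck_ext oU _ (Ck_mul oU (Ck_opp oU (Ck_mul oU Ci Ci)) d2)) => y Uy.
rewrite [RHS]deriveV; [|exact: f0|exact: d1].
by rewrite [_ *: _]mulNr expr2 invfM mulNr.
Qed.

Lemma coord_Ck n k (U : set 'rV[R]_n) j : open U -> Ck k U (fun y => y ord0 j).
Proof.
move=> oU; case: k => [|k]; first by split => // y _; exact: coord_continuous.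
have dE (y v : 'rV[R]_n) : is_derive y v (fun y : 'rV[R]_n => y ord0 j) (v ord0 j).
  apply/is_derive_epsP => e e0; near=> h.
  by rewrite !mxE addrK subrr normr0 mulr_ge0 // ltW.
split=> [y _|v]; first exact: coord_continuous.
split=> [y _|]; first by case: (dE y v).
apply: (Ck_ext oU _ (Ck_cst k U (v ord0 j))) => y _.
by case: (dE y v) => _ ->.
Unshelve. all: by end_near. Qed.

(** By the chain rule a derivative of the composite is a sum of products of a derivative of phi with
    a partial derivative of g composed with the same phi, to which the induction hypothesis
    applies. *)
Lemma Ck_comp n m k (U : set 'rV[R]_n) (W : set 'rV[R]_m) (phi : 'rV[R]_n -> 'rV[R]_m) g :
  open U -> open W -> (forall y, U y -> W (phi y)) ->
  (forall j, Ck k U (fun y => phi y ord0 j)) -> Ck k W g -> Ck k U (fun y => g (phi y)).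
Proof.
move=> oU oW UW; elim: k g => [|k IH] g Cphi Cg.
  split=> // y Uy; apply: (@continuous_comp _ _ _ phi g); last exact: (Ck_cont Cg (UW _ Uy)).
  by apply: rV_continuous => j; exact: Ck_cont (Cphi j) _ Uy.
have cgp := IH g (fun j => CkS (Cphi j)) (CkS Cg).
have dE y v : U y -> is_derive y v (fun y => g (phi y))
    (\sum_j 'D_v (fun y => phi y ord0 j) y * pderive g j (phi y)).
  move=> Uy; apply/is_derive_line.
  have := @chain_rule_curve m W g (fun h => phi (h *: v + y))
    (\row_j 'D_v (fun y => phi y ord0 j) y) oW (Ck_C1 Cg).
  rewrite scale0r add0r => /(_ (UW _ Uy)) H.
  rewrite (eq_bigr (fun j => (\row_j0 'D_v (fun z => phi z ord0 j0) y) ord0 j * pderive g j (phi y))).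
    apply: H => j; rewrite mxE.
    apply: (@is_derive_line R _ (fun z => phi z ord0 j) y v _).1.
    by apply: derivableP; case: (Cphi j) => _ /(_ v)[+ _]; apply.
  by move=> j _; rewrite mxE.
split=> [y Uy|v]; first exact: (Ck_cont cgp Uy).
split=> [y Uy|]; first by case: (dE y v Uy).
apply: (Ck_ext oU (f := fun y => \sum_j 'D_v (fun y => phi y ord0 j) y * pderive g j (phi y))).
  by move=> y Uy; case: (dE y v Uy).
apply: Ck_sum => // j; apply: Ck_mul => //; first by case: (Cphi j) => _ /(_ v)[].
apply: IH; first by move=> i; exact: CkS.
by case: Cg => _ /(_ (delta_mx ord0 j))[].
Qed.

End ChainRule.

(** * Bump functions on Euclidean space *)

Section FlatFunction.
Variable R : realType.

(** The powers of 1/t are carried along because the derivatives of exp(-1/t) are linear combinations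
    of these functions; smoothness is then an induction on the order, for all m at once. *)
Definition flat (m : nat) (t : R) : R := if 0 < t then t^-1 ^+ m * expR (- t^-1) else 0.

Lemma flat_gt0 m t : 0 < t -> 0 < flat m t.
Proof. by move=> t0; rewrite /flat t0 mulr_gt0 ?expR_gt0 // exprn_gt0 // invr_gt0. Qed.

Lemma flat_eq0 m t : t <= 0 -> flat m t = 0.
Proof. by move=> t0; rewrite /flat ltNge t0. Qed.

Lemma flat_ge0 m t : 0 <= flat m t.
Proof. by have [/flat_eq0 ->|/(flat_gt0 m)/ltW] := leP t 0. Qed.

(** With s = 1/t and x = s / (m+1), the bound is the (m+1)-th power of x <= exp x. *)
Lemma flat_le m t : flat m t <= m.+1%:R ^+ m.+1 * `|t|.
Proof.
have [t0|t0] := leP t 0; first by rewrite flat_eq0 // mulr_ge0 // exprn_ge0.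
rewrite /flat t0 (gtr0_norm t0) expRN; set s := t^-1.
have s0 : 0 < s by rewrite invr_gt0.
have -> : t = s^-1 by rewrite invrK.
rewrite ler_pdivrMr ?expR_gt0 // mulrAC ler_pdivlMr // -exprSr.
set x := s / m.+1%:R; have sx : s = m.+1%:R * x by rewrite mulrC divfK // pnatr_eq0.
rewrite sx expRM_natl exprMn ler_wpM2l ?exprn_ge0 //.
rewrite ler_pXn2r ?nnegrE ?expR_ge0 ?divr_ge0 ?(ltW s0) //.
by apply: le_trans (expR_ge1Dx _); rewrite lerDr.
Qed.

Lemma is_derive_flat m (t : R) :
  is_derive (t : R) (1 : R) (flat m) (flat m.+2 t - m%:R * flat m.+1 t).
Proof.
have [t0|t0|t0] := ltgtP t 0.
- rewrite !flat_eq0 ?(ltW t0) // mulr0 subr0.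
  apply: (@near_eq_is_derive _ _ _ (cst 0)).
  near=> s; rewrite flat_eq0 // ltW //; near: s; exact: lt_nbhsl.
- apply: (@near_eq_is_derive R R R (fun t : R => t^-1 ^+ m * expR (- t^-1))).
    near=> s; have s0 : 0 < s by near: s; exact: lt_nbhsr.
    by rewrite /flat s0.
  have tn0 : t != 0 by rewrite gt_eqF.
  have dV : is_derive (t : R) (1 : R) (fun t : R => t^-1) (- t^-1 ^+ 2).
    apply: DeriveDef; first exact: derivableV.
    by rewrite deriveV // derive_id exprVn [_ *: _]mulr1.
  have dE : is_derive (t : R) (1 : R) (fun t : R => expR (- t^-1)) (expR (- t^-1) * t^-1 ^+ 2).
    have dN : is_derive (t : R) (1 : R) (fun t : R => - t^-1) (t^-1 ^+ 2).
      by rewrite -[t^-1 ^+ 2]opprK; apply: is_deriveN.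
    exact: (@is_derive1_comp R expR (fun t : R => - t^-1) t).
  have dX := is_deriveX m dV.
  have dM := is_deriveM dX dE.
  rewrite /flat t0; move: dM; set a := expR _; set b := t^-1.
  rewrite (_ : [eta GRing.inv] ^+ m = fun t : R => t^-1 ^+ m) ?exprfctE //.
  congr is_derive; rewrite -[_ *: (a * _)]/(_ * _) -[a *: _]/(a * _) -[_ *: - _]/(_ * - _).
  by rewrite -/b; clearbody a b; case: (m) => [|k] /=; rewrite ?exprS ?expr0; ring.
- rewrite t0 !flat_eq0 // mulr0 subr0; apply/is_derive_epsP => e e0.
  near=> h; rewrite addr0 [h *: _]mulr1 (flat_eq0 m (lexx 0)) mulr0 !subr0.
  rewrite (ger0_norm (flat_ge0 _ _)).
  (* Extracting one factor h and bounding the rest by [flat_le] gives a quadratic bound at 0, hence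
     derivative 0. *)
  have -> : flat m h = flat m.+1 h * h.
    rewrite /flat; case: ifP => [h0|_]; last by rewrite mul0r.
    have hn0 : h != 0 by rewrite gt_eqF.
    by rewrite exprS; move: (h^-1 ^+ m) (expR _) => x y; field.
  have [h0|h0] := leP h 0; first by rewrite flat_eq0 // mul0r mulr_ge0 // ltW.
  rewrite (gtr0_norm h0) ler_wpM2r ?(ltW h0) // (le_trans (flat_le _ _)) //.
  rewrite mulrC -ler_pdivlMr ?exprn_gt0 //.
  near: h; exists (e / m.+2%:R ^+ m.+2); first by rewrite /= divr_gt0 // exprn_gt0.
  by move=> x; rewrite /= sub0r normrN => /ltW.
Unshelve. all: by end_near. Qed.

Lemma is_derive_comp1 (V : normedModType R) (f : V -> R) (g : R -> R) y v d d' :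
  is_derive y v f d -> is_derive (f y : R) (1 : R) g d' ->
  is_derive y v (fun y => g (f y)) (d' * d).
Proof.
move=> /is_derive_line fd gd; apply/is_derive_line.
apply: (@is_derive1_comp R g (fun h => f (h *: v + y)) 0) => //.
by rewrite scale0r add0r.
Qed.

Lemma Ck_flat n k (U : set 'rV[R]_n) f m : open U -> Ck k U f ->
  Ck k U (fun y => flat m (f y)).
Proof.
move=> oU; elim: k m => [|k IH] m Cf.
  split=> // y Uy; apply: (@continuous_comp _ _ _ f (flat m)); first exact: Ck_cont Cf _ Uy.
  exact: is_derive1_continuous (is_derive_flat m _).
have [cf df] := Cf.
have dE y v : U y -> is_derive y v (fun y => flat m (f y))
    ((flat m.+2 (f y) + - m%:R * flat m.+1 (f y)) * 'D_v f y).
  move=> Uy; rewrite mulNr; apply: is_derive_comp1 (is_derive_flat m _).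
  by apply: derivableP; case: (df v) => d _; exact: d.
split=> [y Uy|v].
  apply: (@continuous_comp _ _ _ f (flat m)); first exact: Ck_cont Cf _ Uy.
  exact: is_derive1_continuous (is_derive_flat m _).
split=> [y Uy|]; first by case: (dE y v Uy).
apply: (Ck_ext oU (f := fun y => (flat m.+2 (f y) + - m%:R * flat m.+1 (f y)) * 'D_v f y)).
  by move=> y Uy; case: (dE y v Uy).
apply: Ck_mul => //; last by case: (df v).
apply: Ck_add => //; first by apply: IH; exact: CkS.
by apply: Ck_mul => //; [exact: Ck_cst|apply: IH; exact: CkS].
Qed.

End FlatFunction.

Section Bump.
Variables (R : realType) (n : nat).

(** The cut-off is a function of q, the squared Euclidean distance to p divided by r^2, which is
    smooth, unlike the supremum norm of the statement: b is 1 for q <= 1 and 0 for q >= 4. A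
    distance below r / (n+1) forces q <= n / (n+1), a distance of at least 2 r forces q >= 4, and 2
    r < r3 keeps the support in O. *)
Lemma bump_ex (p : 'rV[R]_n) (O : set 'rV[R]_n) : open O -> O p ->
  exists (b : 'rV[R]_n -> R) (r1 r2 : R), [/\ Coo setT b, 0 < r1,
    forall y, `|y - p| < r1 -> b y = 1,
    forall y, `|y - p| <= r2 -> O y &
    forall y, r2 <= `|y - p| -> b y = 0].
Proof.
move=> oO Op; have [/= r3 r30 rO] := (nbhs_ballP _ _).1 (open_nbhs_nbhs (conj oO Op)).
pose r := r3 / 3.
have r0 : 0 < r by rewrite divr_gt0.
pose q (y : 'rV[R]_n) := \sum_j ((y ord0 j - p ord0 j) / r) * ((y ord0 j - p ord0 j) / r).
pose b y := flat 0 (4 - q y) / (flat 0 (4 - q y) + flat 0 (q y - 1)).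
have den y : 0 < flat 0 (4 - q y) + flat 0 (q y - 1).
  have [h|h] := ltP (q y) 4.
    by rewrite ltr_pwDl ?flat_ge0 // flat_gt0 // subr_gt0.
  by rewrite ltr_wpDl ?flat_ge0 // flat_gt0 // subr_gt0 (lt_le_trans _ h) // ltr1n.
have qs k : Ck k setT q.
  apply: Ck_sum => [|j]; first exact: openT.
  have c : Ck k setT (fun y : 'rV[R]_n => (y ord0 j - p ord0 j) / r).
    apply: Ck_mul (Ck_cst _ _ _); first exact: openT.
    apply: Ck_add (Ck_cst _ _ _); first exact: openT.
    by apply: coord_Ck; exact: openT.
  by apply: Ck_mul => //; exact: openT.
have oT : open (setT : set 'rV[R]_n) by exact: openT.
exists b, (r / n.+1%:R), (2 * r); split => //.
- move=> k; have c1 : Ck k setT (fun y => flat 0 (4 - q y)).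
    by apply: Ck_flat => //; apply: Ck_add => //; [exact: Ck_cst|exact: Ck_opp].
  apply: Ck_mul => //; apply: Ck_inv => //; first by move=> y _; rewrite gt_eqF.
  apply: Ck_add => //; apply: Ck_flat => //; apply: Ck_add => //; exact: Ck_cst.
- by rewrite divr_gt0.
- move=> y yp; have q1 : q y <= 1.
    apply: (@le_trans _ _ (\sum_(j < n) n.+1%:R^-1)).
      apply: ler_sum => j _; rewrite -expr2 -real_normK ?num_real //.
      have h : `|(y ord0 j - p ord0 j) / r| <= n.+1%:R^-1.
        rewrite normrM normfV (gtr0_norm r0) ler_pdivrMr // mulrC; apply: le_trans (ltW yp).
        by have := coord_le_norm (y - p) j; rewrite !mxE.
      have h1 : n.+1%:R^-1 <= 1 :> R by rewrite invf_le1 // ler1n.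
      by rewrite expr2 -[leRHS]mulr1 ler_pM // (le_trans h).
    by rewrite sumr_const card_ord -[X in X <= _]mulr_natl ler_pdivrMr // mul1r ler_nat.
  rewrite /b [flat 0 (q y - 1)]flat_eq0 ?subr_le0 // addr0 divff //.
  by rewrite gt_eqF // flat_gt0 // subr_gt0 (le_lt_trans q1) // ltr1n.
- move=> y yp; apply: rO; rewrite -ball_normE /= distrC (le_lt_trans yp) // /r; lra.
- move=> y yp; suff q4 : 4 <= q y by rewrite /b flat_eq0 ?mul0r // subr_le0.
  have [j hj] : exists j, 2 * r <= `|y ord0 j - p ord0 j|.
    apply: contrapT => H; have : `|y - p| < 2 * r.
      apply: rV_norm_lt => [|j]; first by rewrite mulr_gt0.
      by rewrite !mxE ltNge; apply/negP => hj; apply: H; exists j.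
    by rewrite ltNge yp.
  rewrite /q (bigD1 j) //= ler_wpDr //.
    by apply: sumr_ge0 => i _; rewrite -expr2 sqr_ge0.
  rewrite -expr2 -real_normK ?num_real // normrM normfV (gtr0_norm r0).
  have : 2 <= `|y ord0 j - p ord0 j| / r by rewrite ler_pdivlMr.
  by set z := _ / r; move=> z2; nra.
Qed.

Lemma Ck_cutoff k (O V : set 'rV[R]_n) b g : open O -> open V -> O `|` V = setT ->
  Ck k O b -> (forall y, V y -> b y = 0) -> Ck k O g -> Ck k setT (fun y => b y * g y).
Proof.
move=> oO oV OV Cb bV Cg; apply: (@Ck_bigcup _ _ _ [set W | W = O \/ W = V]).
  move=> y _; have : (O `|` V) y by rewrite OV.
  by case=> ?; [exists O => //; left|exists V => //; right].
move=> _ [->|->]; first exact: Ck_mul.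
by apply: (Ck_ext oV _ (Ck_cst k V 0)) => y /bV ->; rewrite mul0r.
Qed.

End Bump.

Section ParameterSmoothness.
Variables (R : realType) (n : nat).

Lemma pCk_time k : pCk k (fun (t : R) (_ : 'rV[R]_n) => t).
Proof.
have cc : jcont (fun (t : R) (_ : 'rV[R]_n) => t) by move=> z; exact: cvg_fst.
case: k => [|k]; split=> // v; split=> [t y|]; first exact: derivable_cst.
have -> : (fun (t : R) (y : 'rV[R]_n) => 'D_v (fun=> t) y) = fun _ _ => 0.
  by apply/funext => t; apply/funext => y; exact: derive_cst.
exact: pCk_cst.
Qed.

Lemma pCk_coord k j : pCk k (fun (_ : R) (y : 'rV[R]_n) => y ord0 j).
Proof.
have cc : jcont (fun (_ : R) (y : 'rV[R]_n) => y ord0 j).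
  move=> z; apply: (@continuous_comp _ _ _ snd (fun y : 'rV[R]_n => y ord0 j)).
    exact: cvg_snd.
  exact: coord_continuous.
have := @coord_Ck R n k.+1 setT j openT => -[_ dc].
case: k dc => [|k] dc; split=> // v; split=> [t y|]; first by case: (dc v) => d _; exact: d.
have dE (y : 'rV[R]_n) : is_derive y v (fun y : 'rV[R]_n => y ord0 j) (v ord0 j).
  apply/is_derive_epsP => e e0; near=> h.
  by rewrite !mxE addrK subrr normr0 mulr_ge0 // ltW.
have -> : (fun (t : R) (y : 'rV[R]_n) => 'D_v (fun y : 'rV[R]_n => y ord0 j) y) = fun _ _ => v ord0 j.
  by apply/funext => t; apply/funext => y; case: (dE y).
exact: pCk_cst.
Unshelve. all: by end_near. Qed.

(** Differentiating in y brings out a factor t and leaves a function of the same form, so the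
    induction closes with [pCk_time]. *)
Lemma pCk_ray k (p : 'rV[R]_n) f : Ck k setT f -> pCk k (fun t y => f (t *: y + p)).
Proof.
elim: k f => [|k IH] f Cf.
  split=> //; apply: (@jcont_comp R 'rV[R]_n f (fun t y => t *: y + p)).
    move=> z; apply: cvgD; last exact: cvg_cst.
    by apply: cvgZ; [exact: cvg_fst|exact: cvg_snd].
  by move=> y; exact: (Ck_cont Cf).
have [cf df] := Cf.
have cc : jcont (fun t y => f (t *: y + p)).
  apply: (@jcont_comp R 'rV[R]_n f (fun t y => t *: y + p)).
    move=> z; apply: cvgD; last exact: cvg_cst.
    by apply: cvgZ; [exact: cvg_fst|exact: cvg_snd].
  by move=> y; exact: cf.
have dE v t y : is_derive y v (fun y => f (t *: y + p)) (t * 'D_v f (t *: y + p)).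
  apply/is_derive_line.
  have dv : is_derive (0 : R) (1 : R) (fun h => f (h *: v + (t *: y + p))) ('D_v f (t *: y + p)).
    apply: (is_derive_line _ _ _ _).1; apply: derivableP.
    by case: (df v) => d _; exact: d.
  have dt : is_derive (0 : R) (1 : R) (fun h : R => t * h) t.
    by rewrite -[X in is_derive _ _ _ X]mulr1; apply: is_deriveZ.
  have := @is_derive1_comp R (fun h => f (h *: v + (t *: y + p))) (fun h : R => t * h) 0 _ _ _ dt.
  rewrite mulr0 mulrC => /(_ _ dv); congr is_derive.
  by apply/funext => h /=; rewrite scalerDr scalerA addrA.
split=> // v; split=> [t y|]; first by case: (dE v t y).
have -> : (fun t y => 'D_v (fun y => f (t *: y + p)) y) = (fun t y => t * 'D_v f (t *: y + p)).
  by apply/funext => t; apply/funext => y; case: (dE v t y).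
apply: pCk_mul; first exact: pCk_time.
exact: (IH _ (proj2 (df v))).
Qed.

Lemma pCk_Ck k (f : R -> 'rV[R]_n -> R) t : pCk k f -> Ck k setT (f t).
Proof.
have cy g : jcont g -> forall y, {for y, continuous (g t)}.
  move=> /jcontP cg y; apply/cvgrPdist_lt => e e0.
  have [[/= P Q] [nP nQ] PQ] := cg t y e e0.
  apply: filterS nQ => y' Qy'; rewrite distrC.
  exact: (PQ (t, y') (conj (nbhs_singleton nP) Qy')).
elim: k f => [|k IH] f [cf df]; first by split=> // y _; exact: cy.
split=> [y _|v]; first exact: cy.
by have [d1 d2] := df v; split=> [y _|]; [exact: d1|exact: IH d2].
Qed.

End ParameterSmoothness.

(** * Smooth functions and sections on a manifold *)

Section LinearMaps.
Variables (K : pzRingType) (V W : lmodType K) (f : V -> W).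
Hypothesis flin : forall a u v, f (a *: u + v) = a *: f u + f v.

(** A general ring of scalars, because these rules serve both for fibrewise maps over R and for
    operators on sections over the smooth functions. *)
Lemma lin0 : f 0 = 0.
Proof. by have := flin (-1) 0 0; rewrite scaler0 addr0 scaleN1r addNr. Qed.

Lemma linZ a u : f (a *: u) = a *: f u.
Proof. by rewrite -[a *: u]addr0 flin lin0 addr0. Qed.

Lemma linD u v : f (u + v) = f u + f v.
Proof. by have := flin 1 u v; rewrite !scale1r. Qed.

Lemma linN u : f (- u) = - f u.
Proof. by rewrite -scaleN1r linZ scaleN1r. Qed.

Lemma linB u v : f (u - v) = f u - f v.
Proof. by rewrite linD linN. Qed.

Lemma lin_sum (I : Type) (r : seq I) (u : I -> V) :
  f (\sum_(i <- r) u i) = \sum_(i <- r) f (u i).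
Proof.
by elim: r => [|i r IH]; rewrite ?big_nil ?lin0 // !big_cons linD IH.
Qed.

End LinearMaps.

Section SmoothAlgebra.
Variables (R : realType) (M : manifold R).
Implicit Types (U W : set M) (f g : M -> R).

Lemma smooth_on_sum U (I : Type) (r : seq I) (f : I -> M -> R) : open U ->
  (forall i, smooth_on U (f i)) -> smooth_on U (fun x => \sum_(i <- r) f i x).
Proof.
by move=> oU sf c ac k; apply: Ck_sum => [|i]; [exact: open_cimgI|exact: sf].
Qed.

Lemma smooth_on_prod U (I : Type) (r : seq I) (f : I -> M -> R) : open U ->
  (forall i, smooth_on U (f i)) -> smooth_on U (fun x => \prod_(i <- r) f i x).
Proof.
by move=> oU sf c ac k; apply: Ck_prod => [|i]; [exact: open_cimgI|exact: sf].
Qed.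

Lemma smooth_on_inv U f : open U -> (forall x, U x -> f x != 0) ->
  smooth_on U f -> smooth_on U (fun x => (f x)^-1).
Proof.
move=> oU f0 sf c ac k; apply: Ck_inv (sf c ac k); first exact: open_cimgI.
by move=> y [_ Uy]; exact: f0.
Qed.

Lemma smooth_on_continuous U f x : smooth_on U f -> open U -> U x -> {for x, continuous f}.
Proof.
move=> sf oU Ux; have [c ac cx] := atlas_cover x.
have cfy : {for cmap c x, continuous (f \o cinv c)}.
  by apply: (Ck_cont (sf c ac 0)); split; [exact: cmap_img|rewrite /= cmapK].
have := @continuous_comp _ _ _ (cmap c) (f \o cinv c) x (cmap_cont cx) cfy.
rewrite /prop_for /continuous_at /= cmapK // => H.
apply: cvg_trans H; apply: near_eq_cvg.
by apply: filterS (open_nbhs_nbhs (conj (cdom_open c) cx)) => z cz /=; rewrite cmapK.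
Qed.

Lemma smooth_on_cutoff U V f g : open U -> open V -> U `|` V = setT ->
  smooth_on U f -> (forall x, V x -> f x = 0) -> smooth_on U g ->
  smooth_on setT (fun x => f x * g x).
Proof.
move=> oU oV UV sf f0 sg; apply: (@smooth_on_bigcup _ _ [set W | W = U \/ W = V]).
  move=> x _; have : (U `|` V) x by rewrite UV.
  by case=> ?; [exists U => //; left|exists V => //; right].
move=> _ [->|->]; first exact: smooth_on_mul.
by apply: (smooth_on_ext oV _ (smooth_on_cst V 0)) => x /f0 ->; rewrite mul0r.
Qed.

End SmoothAlgebra.

Lemma continuous_dist (R : realType) (V : normedModType R) (p : V) :
  continuous (fun y => `|y - p|).
Proof. by move=> y; apply: cvg_norm; apply: cvgB; [exact: cvg_id|exact: cvg_cst]. Qed.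

(** * Bump functions and coordinate fields on a manifold *)

Section Charts.
Variables (R : realType) (M : manifold R).
Implicit Types (U W : set M) (c : chart R M (mdim M)).

Lemma open_cdomI c (O : set 'rV[R]_(mdim M)) : open O -> open (cdom c `&` cmap c @^-1` O).
Proof.
move=> oO; rewrite openE => x [cx Ox].
apply: filterI; first exact: open_nbhs_nbhs (conj (cdom_open c) cx).
exact: (cmap_cont cx (open_nbhs_nbhs (conj oO Ox))).
Qed.

Lemma smooth_on_chart c (O : set 'rV[R]_(mdim M)) g : @atlas R M c -> open O ->
  O `<=` cimg c -> Coo O g -> smooth_on (cdom c `&` cmap c @^-1` O) (fun x => g (cmap c x)).
Proof.
move=> ac oO OI Cg c' ac' k; apply: (Ck_comp (W := O)) => //.
- by apply: open_cimgI; exact: open_cdomI.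
- by move=> y [_ []].
- by move=> j; apply: Ck_sub (atlas_smooth ac' ac j k) => y [? []].
Qed.

(** V is the complement of the compact image of the closed ball supporting the bump, open because M
    is Hausdorff; the extension by zero is smooth since the chart domain and V cover M. The open set
    V is part of the conclusion because the cut-off lemmas glue over the cover by U and V. *)
Lemma bump_manifold U x : open U -> U x -> exists (f : smfun M) (W V : set M),
  [/\ open W /\ W x, open V, U `|` V = setT, forall z, W z -> f z = 1 &
   forall z, V z -> f z = 0].
Proof.
move=> oU Ux; have [c ac cx] := atlas_cover x.
have oO := open_cimgI (c := c) oU; set O := _ `&` _ in oO.
have Ox : O (cmap c x) by split; [exact: cmap_img|rewrite /= cmapK].
have [b [r1 [r2 [bs r10 b1 bO b0]]]] := bump_ex oO Ox.
set p := cmap c x in Ox b1 bO b0.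
pose B := [set y : 'rV[R]_(mdim M) | `|y - p| <= r2].
have cB : compact B.
  apply: bounded_closed_compact.
    exists (`|p| + r2); split; first exact: num_real.
    move=> m /ltW hm y By; apply: le_trans hm; rewrite -(subrK p y) addrC.
    by rewrite (le_trans (ler_normD _ _)) // lerD2l.
  apply: (@closed_comp _ _ (fun y : 'rV[R]_(mdim M) => `|y - p|) [set t | t <= r2]); last exact: closed_le.
  by move=> y _; exact: continuous_dist.
have cK : compact (cinv c @` B).
  apply: continuous_compact => //; apply: continuous_in_subspaceT => y.
  by rewrite inE => By; apply: cinv_cont; case: (bO y By).
have clK := compact_closed (@m_hausdorff R M) cK.
pose V := ~` (cinv c @` B).
pose f z := if pselect (cdom c z) then b (cmap c z) else 0.
have fV z : V z -> f z = 0.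
  move=> Vz; rewrite /f; case: pselect => // cz; apply: b0; rewrite leNgt.
  by apply/negP => /ltW h; apply: Vz; exists (cmap c z) => //; exact: cmapK.
have oV : open V by exact: closed_openC.
have sf : smooth_on setT f.
  apply: (@smooth_on_bigcup _ _ [set W | W = cdom c \/ W = V]).
    move=> z _; have [cz|ncz] := pselect (cdom c z); first by exists (cdom c) => //; left.
    exists V; first by right.
    by move=> [y By yz]; apply: ncz; rewrite -yz; apply: cinv_dom; case: (bO y By).
  move=> _ [->|->]; last first.
    by apply: (smooth_on_ext oV _ (smooth_on_cst V 0)) => z /fV ->.
  have := @smooth_on_chart c (cimg c) b ac (cimg_open c) (fun _ h => h).
  rewrite (_ : _ `&` _ = cdom c); last first.
    by apply/seteqP; split=> [z []|z cz] //; split => //; exact: cmap_img.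
  move=> H; apply: (smooth_on_ext (cdom_open c) _ (H _)).
    by move=> z cz; rewrite /f; case: pselect.
  by move=> k; apply: Ck_sub (bs k).
exists (SmFun sf), (cdom c `&` cmap c @^-1` [set y | `|y - p| < r1]), V; split => //.
- split; last by split => //=; rewrite subrr normr0.
  apply: open_cdomI; rewrite (_ : mkset _ = ball p r1).
    exact: ball_open.
  by apply/seteqP; split => y; rewrite -ball_normE /= distrC.
- apply/seteqP; split => // z _; have [Vz|] := pselect (V z); first by right.
  by move=> /contrapT [y By <-]; left; case: (bO y By).
- by move=> z [cz zr] /=; rewrite /f; case: pselect => // ?; exact: b1.
Qed.

Lemma smooth_coord c (f : smfun M) k : @atlas R M c -> Ck k (cimg c) (f \o cinv c).
Proof. by move=> ac; apply: Ck_sub (sfP f ac k) => y cy; split. Qed.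

Variables (c : chart R M (mdim M)) (chi : smfun M) (V : set M).
Hypotheses (ac : @atlas R M c) (oV : open V) (cV : cdom c `|` V = setT).
Hypothesis chiV : forall x, V x -> chi x = 0.

Lemma coord_derive (f : smfun M) v y : cimg c y ->
  is_derive y v (f \o cinv c) ('D_v (f \o cinv c) y).
Proof.
move=> cy; apply: derivableP; case: (smooth_coord f 1 ac) => _ /(_ v)[d _]; exact: d.
Qed.

(* The coordinate field d/dv of the chart, cut off by chi. *)
Definition coord_field_at (v : 'rV[R]_(mdim M)) (x : M) : tangent x.
Proof.
refine (@Tangent R M x (fun f => chi x * 'D_v (f \o cinv c) (cmap c x)) _ _ _).
- move=> f g; have [cx|Vx] : (cdom c `|` V) x by rewrite cV.
    have d := is_deriveD (coord_derive f v (cmap_img cx)) (coord_derive g v (cmap_img cx)).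
    by rewrite -mulrDr; congr (_ * _); case: d.
  by rewrite chiV // !mul0r addr0.
- move=> r f; have [cx|Vx] : (cdom c `|` V) x by rewrite cV.
    have d := is_deriveZ r (coord_derive f v (cmap_img cx)).
    by rewrite mulrCA; congr (_ * _); case: d.
  by rewrite chiV // !mul0r mulr0.
- move=> f g; have [cx|Vx] : (cdom c `|` V) x by rewrite cV.
    have d := is_deriveM (coord_derive f v (cmap_img cx)) (coord_derive g v (cmap_img cx)).
    rewrite !(mulrCA _ (chi x)) -mulrDr; congr (_ * _); case: d => _ ->.
    by rewrite /= cmapK.
  by rewrite chiV // !mul0r !mulr0 addr0.
Defined.

Lemma coord_field_smooth v : @smooth_sec R M (TM M) (coord_field_at v).
Proof.
move=> f; apply: (smooth_on_cutoff (U := cdom c) (V := V)) => //.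
- exact: cdom_open.
- by apply: smooth_on_sub (sfP chi).
have := @smooth_on_chart c (cimg c) ('D_v (f \o cinv c)) ac (cimg_open c) (fun _ h => h).
rewrite (_ : _ `&` _ = cdom c); last first.
  by apply/seteqP; split=> [z []|z cz] //; split => //; exact: cmap_img.
by apply => k; case: (smooth_coord f k.+1 ac) => _ /(_ v)[].
Qed.

Definition coord_field v : sect (TM M) := Sect (coord_field_smooth v).

End Charts.

(** * Frames, local sections and tensoriality *)

Section Trivializations.
Variables (R : realType) (M : manifold R) (F : M -> lmodType R) (r : nat).
Implicit Types (t : triv F r).

Definition frame t (j : 'I_r) (x : M) : F x := tvec t x (delta_mx ord0 j).

Lemma tvec_frame t x v : tdom t x -> tvec t x v = \sum_j v ord0 j *: frame t j x.
Proof.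
move=> tx; rewrite {1}(row_sum_delta v) (lin_sum (tvec_lin tx)).
by apply: eq_bigr => j _; exact: linZ (tvec_lin tx) _ _.
Qed.

Lemma frame_coord t x (a : F x) : tdom t x ->
  a = \sum_j tcoord t a ord0 j *: frame t j x.
Proof. by move=> tx; rewrite -tvec_frame // tcoordK. Qed.

Lemma tcoord_frame t x j : tdom t x -> tcoord t (frame t j x) = delta_mx ord0 j.
Proof. by move=> tx; rewrite tvecK. Qed.

Lemma tcoord_sum t x (I : Type) (s : seq I) (a : I -> R) (u : I -> F x) : tdom t x ->
  tcoord t (\sum_(i <- s) a i *: u i) = \sum_(i <- s) a i *: tcoord t (u i).
Proof.
move=> tx; rewrite (lin_sum (tcoord_lin tx)).
by apply: eq_bigr => j _; exact: linZ (tcoord_lin tx) _ _.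
Qed.

Lemma tcoord_inj t x : tdom t x -> injective (tcoord t (x := x)).
Proof. by move=> tx; exact: can_inj (tcoordK tx). Qed.

End Trivializations.

Section LocalSections.
Variables (R : realType) (M : manifold R) (E : vbundle M).
Implicit Types (U W V : set M) (s : forall x, vfib E x) (t : triv (vfib E) (vrank E)).

Definition vb_smooth_on U s := forall t, vtriv t -> forall i,
  smooth_on (tdom t `&` U) (fun x => tcoord t (s x) ord0 i).

Lemma vb_smooth_onT s : vb_smooth_on setT s <-> vb_smooth s.
Proof.
by split=> H t vt i; have := H t vt i; rewrite setIT.
Qed.

Lemma vb_smooth_on_sub U W s : W `<=` U -> vb_smooth_on U s -> vb_smooth_on W s.
Proof.
by move=> WU H t vt i; apply: smooth_on_sub (H t vt i) => x [? /WU].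
Qed.

Lemma vb_smooth_on_ext U s s' : open U -> (forall x, U x -> s x = s' x) ->
  vb_smooth_on U s -> vb_smooth_on U s'.
Proof.
move=> oU ss H t vt i; apply: smooth_on_ext (H t vt i).
  by apply: openI => //; exact: tdom_open.
by move=> x [_ Ux]; rewrite ss.
Qed.

Lemma vb_smooth_on_bigcup (P : set (set M)) U s :
  (forall x, U x -> exists2 W, P W & W x) ->
  (forall W, P W -> vb_smooth_on W s) -> vb_smooth_on U s.
Proof.
move=> UP H t vt i.
apply: (@smooth_on_bigcup _ _ [set Z | exists2 W, P W & Z = tdom t `&` W]).
  by move=> x [tx /UP[W PW Wx]]; exists (tdom t `&` W) => //; exists W.
by move=> _ [W PW ->]; exact: H.
Qed.

Lemma frame_smooth t j : vtriv t -> vb_smooth_on (tdom t) (frame t j).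
Proof.
move=> vt t' vt' i; rewrite setIC; exact: vtriv_smooth vt vt' (delta_mx ord0 j) i.
Qed.

Lemma vb_smooth_onD U s s' : open U -> vb_smooth_on U s -> vb_smooth_on U s' ->
  vb_smooth_on U (fun x => s x + s' x).
Proof.
move=> oU ss ss' t vt i.
have oU' : open (tdom t `&` U) by apply: openI => //; exact: tdom_open.
apply: (smooth_on_ext oU' _ (smooth_on_add oU' (ss t vt i) (ss' t vt i))) => x [tx _].
by rewrite (linD (tcoord_lin tx)) mxE.
Qed.

Lemma vb_smooth_onZ U (f : M -> R) s : open U -> smooth_on U f -> vb_smooth_on U s ->
  vb_smooth_on U (fun x => f x *: s x).
Proof.
move=> oU sf ss t vt i.
have oU' : open (tdom t `&` U) by apply: openI => //; exact: tdom_open.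
have sf' : smooth_on (tdom t `&` U) f by apply: smooth_on_sub sf => x [].
apply: (smooth_on_ext oU' _ (smooth_on_mul oU' sf' (ss t vt i))) => x [tx _].
by rewrite (linZ (tcoord_lin tx)) mxE.
Qed.

Lemma vb_smooth_on0 U : open U -> vb_smooth_on U (fun x => 0).
Proof.
by move=> oU; apply: vb_smooth_on_sub (proj2 (vb_smooth_onT _) (vb_smooth0 (E := E))).
Qed.

Lemma vb_smooth_on_sum U (I : Type) (r : seq I) (s : I -> forall x, vfib E x) : open U ->
  (forall i, vb_smooth_on U (s i)) -> vb_smooth_on U (fun x => \sum_(i <- r) s i x).
Proof.
move=> oU H; elim: r => [|i r IH].
  by apply: (vb_smooth_on_ext oU _ (vb_smooth_on0 oU)) => x _; rewrite big_nil.
by apply: (vb_smooth_on_ext oU _ (vb_smooth_onD oU (H i) IH)) => x _; rewrite big_cons.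
Qed.

Lemma vb_smooth_cutoff U V (f : smfun M) s : open U -> open V -> U `|` V = setT ->
  (forall x, V x -> f x = 0) -> vb_smooth_on U s -> vb_smooth (fun x => f x *: s x).
Proof.
move=> oU oV UV f0 ss; apply/vb_smooth_onT.
apply: (@vb_smooth_on_bigcup [set W | W = U \/ W = V]).
  move=> x _; have : (U `|` V) x by rewrite UV.
  by case=> ?; [exists U => //; left|exists V => //; right].
move=> _ [->|->]; first by apply: vb_smooth_onZ => //; exact: smooth_on_sub (sfP f).
by apply: (vb_smooth_on_ext oV _ (vb_smooth_on0 oV)) => x /f0 ->; rewrite scale0r.
Qed.

Lemma sect_ex x (u : vfib E x) : exists s : sect E, s x = u.
Proof.
have [t vt tx] := vtriv_cover E x.
have [f [W [V [[oW Wx] oV UV f1 f0]]]] := bump_manifold (tdom_open t) tx.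
have sm : vb_smooth_on (tdom t) (fun z => \sum_j tcoord t u ord0 j *: frame t j z).
  apply: vb_smooth_on_sum => [|j]; first exact: tdom_open.
  apply: vb_smooth_onZ; [exact: tdom_open|exact: smooth_on_cst|exact: frame_smooth].
exists (@Sect R M E _ (vb_smooth_cutoff (tdom_open t) oV UV f0 sm)) => /=.
by rewrite f1 // scale1r -frame_coord.
Qed.

(** Turns a vector into an argument for operators on sections; the choice is immaterial wherever the
    operator is tensorial. *)
Definition ext x (u : vfib E x) : sect E := projT1 (cid (sect_ex u)).

Lemma extE x (u : vfib E x) : ext u x = u.
Proof. by rewrite /ext; case: cid. Qed.

(* A section vanishing at x is, up to the factor f^2 with f(x) = 1, a combination
   of global sections with coefficients vanishing at x. *)
Lemma tensorial_eq0 (x : M) (W : lmodType R) (F : sect E -> W) :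
  (forall s s' : sect E, F (s + s') = F s + F s') ->
  (forall (f : smfun M) (s : sect E), F (f *: s) = f x *: F s) ->
  forall s : sect E, s x = 0 -> F s = 0.
Proof.
move=> FD FZ s s0; have [t vt tx] := vtriv_cover E x.
have [f [W1 [V [[oW Wx] oV UV f1 f0]]]] := bump_manifold (tdom_open t) tx.
have sc j : smooth_on setT (fun z => f z * tcoord t (s z) ord0 j).
  apply: (smooth_on_cutoff (tdom_open t) oV UV) => //; last exact: (sectP s t vt j).
  by apply: smooth_on_sub (sfP f).
have sf j := vb_smooth_cutoff (tdom_open t) oV UV f0 (frame_smooth j vt).
pose c j : smfun M := SmFun (sc j); pose e j : sect E := @Sect R M E _ (sf j).
have F0 : F 0 = 0 by have := FZ 0 0; rewrite scaler0 scale0r.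
have sE : f *: (f *: s) = \sum_j c j *: e j.
  apply: sect_ext => z.
  have -> : (\sum_j c j *: e j) z = \sum_j (c j *: e j) z.
    by apply: (big_morph (fun s : sect E => s z)).
  have [tz|Vz] : (tdom t `|` V) z by rewrite UV.
    rewrite [in LHS]sectZE [in LHS]sectZE {1}(frame_coord (s z) tz) !scaler_sumr.
    apply: eq_bigr => j _; rewrite sectZE /= !scalerA; congr (_ *: _).
    exact: mulrAC.
  rewrite sectZE f0 // scale0r big1 // => j _.
  by rewrite sectZE /= f0 // mul0r scale0r.
have : F (f *: (f *: s)) = F s by rewrite !FZ f1 // !scale1r.
rewrite sE => <-.
have -> : F (\sum_j c j *: e j) = \sum_j F (c j *: e j) by apply: (big_morph F).
by rewrite big1 // => j _; rewrite FZ /= s0 (lin0 (tcoord_lin tx)) mxE mulr0 scale0r.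
Qed.

Lemma tensorial_eq (x : M) (W : lmodType R) (F : sect E -> W) :
  (forall s s' : sect E, F (s + s') = F s + F s') ->
  (forall (f : smfun M) (s : sect E), F (f *: s) = f x *: F s) ->
  forall s s' : sect E, s x = s' x -> F s = F s'.
Proof.
move=> FD FZ s s' ss.
have FN u : F (- u) = - F u.
  have -> : - u = smcst (-1) *: u by rewrite -scaleN1r; congr (_ *: _); apply: smfun_ext => z /=; rewrite mulr1.
  by rewrite FZ scaleN1r.
apply/eqP; rewrite -subr_eq0 -FN -FD; apply/eqP; apply: (tensorial_eq0 FD FZ).
by rewrite sectBE ss subrr.
Qed.

End LocalSections.

Section LocalBundleMaps.
Variables (R : realType) (M : manifold R) (E F : vbundle M) (phi : bmap E F).

(** Smoothness of a bundle map refers to global sections; near each point the local section agrees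
    with one cut off by a bump function. *)
Lemma bmap_smooth_on U (s : forall x, vfib E x) : open U -> vb_smooth_on U s ->
  vb_smooth_on U (fun x => phi x (s x)).
Proof.
move=> oU ss.
apply: (@vb_smooth_on_bigcup _ _ _ [set W | open W /\ vb_smooth_on W (fun x => phi x (s x))]).
  move=> x Ux; have [f [W [V [[oW Wx] oV UV f1 f0]]]] := bump_manifold oU Ux.
  exists W => //; split => //.
  have sm : vb_smooth (fun x => f x *: s x) := vb_smooth_cutoff oU oV UV f0 ss.
  have := bfun_smooth phi (@Sect R M E _ sm) => /(proj2 (vb_smooth_onT _)) /= H.
  apply: (vb_smooth_on_ext oW _ (vb_smooth_on_sub _ H)) => // z Wz.
  by rewrite f1 // scale1r.
by move=> W [].
Qed.

End LocalBundleMaps.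

(** * The Lie algebroid of coupling data *)

(* A reflexive decision procedure for equalities in abelian groups. *)
Inductive zterm := ZVar of nat | ZZero | ZAdd of zterm & zterm | ZOpp of zterm.

Fixpoint zeval (V : zmodType) (e : seq V) (a : zterm) : V :=
  match a with
  | ZVar n => e`_n
  | ZZero => 0
  | ZAdd b c => zeval e b + zeval e c
  | ZOpp b => - zeval e b
  end.

Fixpoint zcoef (a : zterm) (i : nat) : int :=
  match a with
  | ZVar n => if i == n then 1 else 0
  | ZZero => 0
  | ZAdd b c => zcoef b i + zcoef c i
  | ZOpp b => - zcoef b i
  end.

Lemma zevalE (V : zmodType) (e : seq V) a :
  zeval e a = \sum_(i < size e) e`_i *~ zcoef a i.
Proof.
elim: a => [n||b IHb c IHc|b IHb] /=.
- have [ne|en] := ltnP n (size e).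
    rewrite (bigD1 (Ordinal ne)) //= eqxx mulr1z big1 ?addr0 // => i ni.
    by rewrite ifN ?mulr0z.
  rewrite nth_default // big1 // => i _.
  by rewrite ifN ?mulr0z // neq_ltn (leq_trans (ltn_ord i)).
- by rewrite big1 // => i _; rewrite mulr0z.
- by rewrite IHb IHc -big_split; apply: eq_bigr => i _; rewrite mulrzDr.
- by rewrite IHb -sumrN; apply: eq_bigr => i _; rewrite mulrNz.
Qed.

Lemma zeval_eq (V : zmodType) (e : seq V) a b :
  all (fun i => zcoef a i == zcoef b i) (iota 0 (size e)) -> zeval e a = zeval e b.
Proof.
move=> /allP H; rewrite !zevalE; apply: eq_bigr => i _.
by rewrite (eqP (H i _)) // mem_iota /=.
Qed.

Ltac zindex x e :=
  match e with
  | x :: _ => constr:(O)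
  | _ :: ?e' => let n := zindex x e' in constr:(S n)
  end.

Ltac zinsert x e :=
  match e with
  | nil => constr:(x :: e)
  | x :: _ => e
  | ?y :: ?e' => let e2 := zinsert x e' in constr:(y :: e2)
  end.

Ltac zatoms a e :=
  lazymatch a with
  | @Algebra.add _ ?b ?c => let e' := zatoms b e in zatoms c e'
  | @Algebra.opp _ ?b => zatoms b e
  | @Algebra.zero _ => e
  | _ => zinsert a e
  end.

Ltac zreify a e :=
  lazymatch a with
  | @Algebra.add _ ?b ?c => let b' := zreify b e in let c' := zreify c e in constr:(ZAdd b' c')
  | @Algebra.opp _ ?b => let b' := zreify b e in constr:(ZOpp b')
  | @Algebra.zero _ => constr:(ZZero)
  | _ => let n := zindex a e in constr:(ZVar n)
  end.

Ltac zfirst a :=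
  lazymatch a with
  | @Algebra.add _ ?b ?c => let x := match goal with _ => zfirst b | _ => zfirst c end in x
  | @Algebra.opp _ ?b => zfirst b
  | @Algebra.zero _ => fail
  | _ => let u := constr:(ltac:(first [is_var a; fail 1 | exact I]) : True) in a
  end.

(* [set] identifies atoms up to the unfolding of canonical instances. *)
Ltac zabstract :=
  repeat match goal with
  | |- @eq ?T ?a ?b =>
    let x := match goal with _ => zfirst a | _ => zfirst b end in
    let z := fresh "z" in set z := x; clearbody z
  end.

Ltac zmod :=
  zabstract;
  match goal with
  | |- @eq ?T ?a ?b =>
    let e0 := zatoms a (@nil T) in
    let e := zatoms b e0 in
    let a' := zreify a e in
    let b' := zreify b e in
    refine (@zeval_eq _ e a' b' _); vm_compute; reflexivity
  end.

(** Feeds a known equation a = b to the goal, after which an identity of abelian groups remains for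
    [zmod]. *)
Lemma eq_addl (V : zmodType) (a b x y : V) : a = b -> x + a = y + b -> x = y.
Proof. by move=> -> /addIr. Qed.

(** * Rules of calculus for sections, connections and brackets *)

Section SectionCalculus.
Variables (R : realType) (M : manifold R).

Lemma smcst1 : smcst 1 = 1 :> smfun M. Proof. by []. Qed.
Section BundleMap.
Variables (E F : Defs.family M) (phi : bmap E F).
Lemma bapp_lin (f : smfun M) s t : bapp phi (f *: s + t) = f *: bapp phi s + bapp phi t.
Proof. by apply: sect_ext => x; exact: bfun_lin. Qed.
Definition bapp0 := lin0 bapp_lin.
Definition bappD := linD bapp_lin.
Definition bappZ := linZ bapp_lin.
Definition bappN := linN bapp_lin.
Definition bappB := linB bapp_lin.
End BundleMap.

Section BilinearMap.
Variables (E F G : Defs.family M) (U : bimap E F G).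
Lemma biapp_linl v (f : smfun M) s t :
  biapp U (f *: s + t) v = f *: biapp U s v + biapp U t v.
Proof. by apply: sect_ext => x; exact: bifun_linl. Qed.
Lemma biapp_linr u (f : smfun M) s t :
  biapp U u (f *: s + t) = f *: biapp U u s + biapp U u t.
Proof. by apply: sect_ext => x; exact: bifun_linr. Qed.
Definition biapp0l v := lin0 (biapp_linl v).
Definition biappDl v := linD (biapp_linl v).
Definition biappZl v := linZ (biapp_linl v).
Definition biapp0r u := lin0 (biapp_linr u).
Definition biappDr u := linD (biapp_linr u).
Definition biappZr u := linZ (biapp_linr u).
Definition biappNr u := linN (biapp_linr u).
End BilinearMap.

Section Connection.
Variables (E : Defs.family M) (D : connection E).
Lemma nabla_linc X r s t : nabla D X (smcst r *: s + t) = smcst r *: nabla D X s + nabla D X t.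
Proof. by apply: sect_ext => x; exact: conn_lin. Qed.
Lemma nabla_leibniz X (f : smfun M) s : nabla D X (f *: s) = f *: nabla D X s + vfapp X f *: s.
Proof. by apply: sect_ext => x; exact: conn_leibniz. Qed.
Lemma nablaD X s t : nabla D X (s + t) = nabla D X s + nabla D X t.
Proof. by have := nabla_linc X 1 s t; rewrite smcst1 !scale1r. Qed.
Lemma nabla0 X : nabla D X 0 = 0.
Proof. by have := nablaD X 0 0; rewrite addr0 -{1}[nabla D X 0]addr0 => /addrI. Qed.
Lemma nablaN X s : nabla D X (- s) = - nabla D X s.
Proof. by apply/eqP; rewrite -addr_eq0 -nablaD addNr nabla0. Qed.
Lemma nabla_linl s (f : smfun M) X Y : nabla D (f *: X + Y) s = f *: nabla D X s + nabla D Y s.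
Proof. by apply: sect_ext => x; exact: bfun_lin. Qed.
Lemma nabla0l s : nabla D 0 s = 0.
Proof. exact: lin0 (nabla_linl s). Qed.
Lemma nablaZl s (f : smfun M) X : nabla D (f *: X) s = f *: nabla D X s.
Proof. exact: (linZ (nabla_linl s)). Qed.
End Connection.

(** The Leibniz rule for 1 = 1 * 1 forces X(1) = 0. *)
Lemma vfapp_cst X r : vfapp (M := M) X (smcst r) = 0.
Proof.
apply: smfun_ext => x /=; have := tvalZ (X x : tangent x) r (smcst 1).
have := tvalM (X x : tangent x) (smcst 1) (smcst 1).
rewrite !smcst1 !mulr1 /= !mul1r => /esym.
by rewrite -[X in _ = X -> _]addr0 => /addrI ->; rewrite mulr0.
Qed.

Lemma vfbr0l X : vfbr 0 X = 0 :> sect (TM M).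
Proof.
apply: sect_ext => x; apply: tangent_ext => f /=.
have -> : vfapp (0 : sect (TM M)) f = smcst 0 by apply: smfun_ext.
by have := vfapp_cst X 0 => /(congr1 (fun h : smfun M => h x)) /= ->; rewrite subr0.
Qed.

Lemma vfbr_skew (X Y : sect (TM M)) : vfbr X Y = - vfbr Y X.
Proof.
apply: sect_ext => x; apply: tangent_ext => f /=.
by rewrite mulN1r opprB.
Qed.

Section Algebroid.
Variables (A : vbundle M) (br : sect A -> sect A -> sect A) (rho : bmap A (TM M)).
Hypothesis LA : is_lie_algebroid br rho.

Lemma brDl a b c : br (a + b) c = br a c + br b c.
Proof. by have := lad_lin LA 1 a b c; rewrite smcst1 !scale1r. Qed.
Lemma br0l c : br 0 c = 0.
Proof. by have := brDl 0 0 c; rewrite addr0 -{1}[br 0 c]addr0 => /addrI. Qed.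
Lemma brNl a c : br (- a) c = - br a c.
Proof. by apply/eqP; rewrite -addr_eq0 -brDl addNr br0l. Qed.
Lemma brDr a b c : br c (a + b) = br c a + br c b.
Proof. by rewrite (lad_skew LA c) brDl opprD -!(lad_skew LA c). Qed.
Lemma br0r c : br c 0 = 0.
Proof. by rewrite (lad_skew LA c) br0l oppr0. Qed.
Lemma brNr a c : br c (- a) = - br c a.
Proof. by rewrite (lad_skew LA c) brNl -(lad_skew LA c). Qed.
Lemma brBr a b c : br c (a - b) = br c a - br c b.
Proof. by rewrite brDr brNr. Qed.
Lemma brZl (f : smfun M) a b : br (f *: a) b = f *: br a b - vfapp (bapp rho b) f *: a.
Proof. by rewrite (lad_skew LA _ b) (lad_leibniz LA) opprD -scalerN -(lad_skew LA). Qed.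
End Algebroid.

End SectionCalculus.

Section DirectSumSections.
Variables (R : realType) (M : manifold R) (B k : vbundle M).
Implicit Types (s t : sect (dsum B k)).

Lemma dpair_eta s : s = Defs.dpair (bapp (dpr1 B k) s) (bapp (dpr2 B k) s).
Proof. by apply: sect_ext => x /=; case: (s x). Qed.

Lemma dpr1_dpair b (xi : sect k) : bapp (dpr1 B k) (Defs.dpair b xi) = b.
Proof. exact: sect_ext. Qed.

Lemma dpr2_dpair (b : sect B) xi : bapp (dpr2 B k) (Defs.dpair b xi) = xi.
Proof. exact: sect_ext. Qed.

Lemma dpairD b b' (xi xi' : sect k) : Defs.dpair (E := B) b xi + Defs.dpair b' xi' = Defs.dpair (b + b') (xi + xi').
Proof. exact: sect_ext. Qed.

Lemma dpairZ f b (xi : sect k) : f *: Defs.dpair (E := B) b xi = Defs.dpair (f *: b) (f *: xi).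
Proof. exact: sect_ext. Qed.

Lemma dpairN b (xi : sect k) : - Defs.dpair (E := B) b xi = Defs.dpair (- b) (- xi).
Proof. by rewrite -scaleN1r dpairZ !scaleN1r. Qed.

Lemma dpair0 : Defs.dpair (E := B) 0 (0 : sect k) = 0.
Proof. exact: sect_ext. Qed.

Lemma dinr_dpair (xi : sect k) : bapp (dinr B k) xi = Defs.dpair 0 xi.
Proof. exact: sect_ext. Qed.

End DirectSumSections.

Section Coupling.
Variables (R : realType) (M : manifold R) (B k : vbundle M).
Variables (brB : sect B -> sect B -> sect B) (rhoB : bmap B (TM M)).
Variables (brk : bimap k k k) (D : connection k) (U : bimap B (TM M) k).
Hypotheses (LB : is_lie_algebroid brB rhoB) (Lk : is_lie_algebra_bundle brk).
Hypothesis CD : is_coupling_data brB rhoB brk D U.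

Let S1 := coupling_S1 CD.
Let S2 := coupling_S2 CD.
Let S3 := coupling_S3 CD.
Let r := bapp rhoB.

Lemma bibr_skew xi eta : biapp brk xi eta = - biapp brk eta xi.
Proof.
apply/eqP; rewrite -addr_eq0; apply/eqP; apply: sect_ext => x.
rewrite sectDE /=; have L := lab_fib Lk x.
have := la_alt L (xi x + eta x).
rewrite (linD (fun a u v => la_linl L a u v (xi x + eta x))).
rewrite !(linD (fun a u v => la_linr L a _ u v)) !(la_alt L).
by rewrite add0r addr0.
Qed.

Lemma bibr_jacobi xi eta zeta :
  biapp brk xi (biapp brk eta zeta) + biapp brk eta (biapp brk zeta xi)
  + biapp brk zeta (biapp brk xi eta) = 0.
Proof. by apply: sect_ext => x; exact: (la_jacobi (lab_fib Lk x)). Qed.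

(* Antisymmetrizing (S3) makes the symmetric part S of U(a, rho b) parallel; as
   S is tensorial, X(f) S = 0 for all X and f, which forces S = 0 wherever rho
   does not vanish. *)
Lemma coupling_skew al be : biapp U al (r be) = - biapp U be (r al).
Proof.
pose S a b := biapp U a (r b) + biapp U b (r a).
have par a b X : nabla D X (S a b) = 0.
  rewrite /S nablaD.
  have e1 := S3 a b X; have e2 := S3 b a X.
  have e3 : biapp U (brB a b) X + biapp U (brB b a) X = 0.
    by rewrite -biappDl (lad_skew LB a b) addNr biapp0l.
  rewrite -e1 -e2 in e3; rewrite -e3 -/r; zmod.
have tens f a b : S (f *: a) b = f *: S a b.
  by rewrite /S biappZl /r bappZ biappZr scalerDr.
have kill f a b X : vfapp X f *: S a b = 0.
  by have := par (f *: a) b X; rewrite tens nabla_leibniz par scaler0 add0r.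
apply/eqP; rewrite -addr_eq0; apply/eqP; rewrite -/(S al be); apply: sect_ext => x.
have nz a : r a x <> 0 -> exists f, (r a x : tangent x) f != 0.
  move=> h; apply: contrapT => H; apply: h; apply: tangent_ext => f /=.
  by apply: contrapT => hf; apply: H; exists f; apply/eqP.
have van a : r a x <> 0 -> S al be x = 0.
  move=> /nz[f f0]; have := congr1 (fun s : sect k => s x) (kill f al be (r a)).
  rewrite /= => /eqP; rewrite scaler_eq0 (negbTE f0) /= => /eqP e.
  exact: e.
(* Where both anchors vanish, each summand of S is zero by linearity of U in its second slot. *)
have [a0|] := pselect (r al x = 0); last exact: van.
have [b0|] := pselect (r be x = 0); last exact: van.
rewrite /S sectDE /= -/(r al x) -/(r be x).
have e (a b : sect B) : r b x = 0 -> U x (a x) (rhoB x (b x)) = 0.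
  by rewrite /r /= => ->; apply: (lin0 (fun c u v => bifun_linr U c (a x) u v)).
by rewrite !e // addr0.
Qed.

Let A := dsum B k.
Let brA := coupling_br brB rhoB brk D U.
Let rhoA := coupling_anchor k rhoB.
Let inc := dinr B k.

Lemma coupling_anchorE s : bapp rhoA s = r (bapp (dpr1 B k) s).
Proof. exact: sect_ext. Qed.

Lemma coupling_brE a xi b eta : brA (Defs.dpair a xi) (Defs.dpair b eta) =
  Defs.dpair (brB a b) (biapp U a (r b) + nabla D (r a) eta - nabla D (r b) xi + biapp brk xi eta).
Proof. by rewrite /brA /coupling_br !dpr1_dpair !dpr2_dpair. Qed.

(** In the k-component of the Jacobi sum, (S1) expands the derivatives of brackets and (S2) trades
    the brackets with U for commutators of covariant derivatives, which cancel. What is left is (S3)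
    at X = rho d, made cyclic by [coupling_skew], and the Jacobi identity of k. *)
Lemma coupling_lie_algebroid : @is_lie_algebroid R M A brA rhoA.
Proof.
split.
- move=> c a1 a2 a3; rewrite (dpair_eta a1) (dpair_eta a2) (dpair_eta a3).
  move: (bapp (dpr1 _ _) a1) (bapp (dpr2 _ _) a1) (bapp (dpr1 _ _) a2) (bapp (dpr2 _ _) a2)
    (bapp (dpr1 _ _) a3) (bapp (dpr2 _ _) a3) => a x b y d z {a1 a2 a3}.
  rewrite dpairZ dpairD !coupling_brE dpairZ dpairD (lad_lin LB).
  congr Defs.dpair.
  rewrite /r !biapp_linl bapp_lin !nabla_linl !nabla_linc !scalerDr !scalerN; zmod.
- move=> a1 a2; rewrite (dpair_eta a1) (dpair_eta a2).
  move: (bapp (dpr1 _ _) a1) (bapp (dpr2 _ _) a1) (bapp (dpr1 _ _) a2) (bapp (dpr2 _ _) a2)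
    => a x b y {a1 a2}.
  rewrite !coupling_brE dpairN -(lad_skew LB); congr Defs.dpair.
  rewrite (coupling_skew b a) (bibr_skew y x); zmod.
- move=> a1 a2 a3; rewrite (dpair_eta a1) (dpair_eta a2) (dpair_eta a3).
  move: (bapp (dpr1 _ _) a1) (bapp (dpr2 _ _) a1) (bapp (dpr1 _ _) a2) (bapp (dpr2 _ _) a2)
    (bapp (dpr1 _ _) a3) (bapp (dpr2 _ _) a3) => a x b y d z {a1 a2 a3}.
  rewrite !coupling_brE !dpairD (lad_jacobi LB) -dpair0; congr Defs.dpair.
  rewrite !(nablaD, nablaN, biappDr, biappNr) !S1.
  have anc p q : r (brB p q) = vfbr (r p) (r q) := lad_anchor LB p q.
  rewrite !anc.
  have s2 al X xi : biapp brk (biapp U al X) xi = nabla D (r al) (nabla D X xi)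
    - nabla D X (nabla D (r al) xi) - nabla D (vfbr (r al) X) xi by rewrite S2.
  rewrite !(fun p q s => bibr_skew (nabla D p q) s) (bibr_skew x (biapp U _ _)).
  rewrite (bibr_skew y (biapp U _ _)) (bibr_skew z (biapp U _ _)) !s2.
  have h := S3 a b (r d).
  rewrite -/r (coupling_skew (brB a b) d) anc (coupling_skew a d) in h.
  rewrite nablaN (vfbr_skew (r a) (r d)) biappNr in h.
  apply: (eq_addl (esym h)); apply: (eq_addl (esym (bibr_jacobi x y z))).
  by zmod.
- move=> a1 f a2; rewrite (dpair_eta a1) (dpair_eta a2).
  move: (bapp (dpr1 _ _) a1) (bapp (dpr2 _ _) a1) (bapp (dpr1 _ _) a2) (bapp (dpr2 _ _) a2)
    => a x b y {a1 a2}.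
  rewrite dpairZ !coupling_brE !dpairZ dpairD (lad_leibniz LB).
  rewrite coupling_anchorE dpr1_dpair; congr Defs.dpair.
  rewrite /r !bappZ !biappZr nabla_leibniz nablaZl !scalerDr !scalerN; zmod.
- move=> a1 a2; rewrite !coupling_anchorE -(lad_anchor LB); congr bapp.
  exact: dpr1_dpair.
Qed.

Lemma coupling_bundle_of_ideals : is_bundle_of_ideals brA rhoA inc.
Proof.
split.
- by move=> x u v [].
- by move=> x u; exact: lin0 (bfun_lin rhoB (x := x)).
- move=> a xi; rewrite (dpair_eta a) dinr_dpair coupling_brE (br0r LB).
  by eexists; rewrite dinr_dpair.
Qed.

Lemma coupling_LE a xi X : bapp (coupling_L D U (Defs.dpair a xi)) X = nabla D X xi - biapp U a X.
Proof.
by apply: sect_ext => x; rewrite sectBE /= dpr2_dpair.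
Qed.

Lemma coupling_IM : is_IM_connection brA rhoA inc (coupling_L D U) (dpr2 B k).
Proof.
split=> //.
- move=> c a b x v /=.
  have -> : bapp (dpr2 B k) (smcst c *: a + b) = smcst c *: bapp (dpr2 B k) a + bapp (dpr2 B k) b.
    exact: bapp_lin.
  rewrite conn_lin (bifun_linl U c) opprD scalerBr. zmod.
- move=> f a x v /=.
  rewrite bappZ conn_leibniz.
  rewrite (linZ (fun c u u' => bifun_linl U c u u' v)) scalerBr; zmod.
- move=> a1 a2 X; rewrite (dpair_eta a1) (dpair_eta a2).
  move: (bapp (dpr1 _ _) a1) (bapp (dpr2 _ _) a1) (bapp (dpr1 _ _) a2) (bapp (dpr2 _ _) a2)
    => a x b y {a1 a2}.
  rewrite !coupling_anchorE !dpr1_dpair coupling_brE !coupling_LE !dinr_dpair !coupling_brE.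
  rewrite !dpairN !dpairD !dpairN !dpairD !(br0r LB); congr Defs.dpair; first by zmod.
  (* (S2) oriented so that second derivatives have the anchor direction outermost, a normal form in
     which the terms can cancel. *)
  have s2 al Y xi : nabla D Y (nabla D (r al) xi) = nabla D (r al) (nabla D Y xi)
     - nabla D (vfbr (r al) Y) xi - biapp brk (biapp U al Y) xi.
    by rewrite -S2 -/r; zmod.
  rewrite -(S3 a b X) -/r !(nablaD, nablaN) S1 !(biappDr, biappNr) !s2 /r bapp0 !biapp0r !nabla0l.
  rewrite !(fun p q s => bibr_skew (nabla D p q) s).
  rewrite (bibr_skew (biapp U _ _) x) (bibr_skew (biapp U _ _) y); zmod.
- move=> a1 a2; rewrite (dpair_eta a1) (dpair_eta a2).
  move: (bapp (dpr1 _ _) a1) (bapp (dpr2 _ _) a1) (bapp (dpr1 _ _) a2) (bapp (dpr2 _ _) a2)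
    => a x b y {a1 a2}.
  rewrite !coupling_anchorE !dpr1_dpair !coupling_LE !dinr_dpair !dpr2_dpair !coupling_brE.
  rewrite !dpr1_dpair !dpairN !dpairD !(br0r LB); congr Defs.dpair; first by zmod.
  rewrite /r bapp0 !biapp0r !nabla0l; zmod.
Qed.

End Coupling.

Lemma coupling_construction (R : realType) (M : manifold R) (B k : vbundle M)
    (brB : sect B -> sect B -> sect B) (rhoB : bmap B (TM M))
    (brk : bimap k k k) (D : connection k) (U : bimap B (TM M) k) :
  is_lie_algebroid brB rhoB -> is_lie_algebra_bundle brk ->
  is_coupling_data brB rhoB brk D U ->
  [/\ @is_lie_algebroid R M (dsum B k) (coupling_br brB rhoB brk D U) (coupling_anchor k rhoB),
      is_bundle_of_ideals (coupling_br brB rhoB brk D U) (coupling_anchor k rhoB) (dinr B k),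
      partially_split (coupling_br brB rhoB brk D U) (coupling_anchor k rhoB) (dinr B k) &
      is_IM_connection (coupling_br brB rhoB brk D U) (coupling_anchor k rhoB) (dinr B k)
        (coupling_L D U) (dpr2 B k)].
Proof.
move=> LB Lk CD; split.
- exact: coupling_lie_algebroid.
- exact: coupling_bundle_of_ideals.
- by exists (coupling_L D U), (dpr2 B k); exact: coupling_IM.
- exact: coupling_IM.
Qed.

(** * The kernel of a split projection as a vector bundle *)

Section SmoothMatrices.
Variables (R : realType) (M : manifold R).
Implicit Types U : set M.

Definition msmooth_on U (m n : nat) (F : M -> 'M[R]_(m, n)) :=
  forall i j, smooth_on U (fun x => F x i j).

Lemma msmooth_sub U W (m n : nat) (F : M -> 'M[R]_(m, n)) : W `<=` U ->
  msmooth_on U F -> msmooth_on W F.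
Proof. by move=> WU sF i j; exact: smooth_on_sub (sF i j). Qed.

Lemma msmooth_cst U (m n : nat) (A : 'M[R]_(m, n)) : msmooth_on U (fun=> A).
Proof. by move=> i j; exact: smooth_on_cst. Qed.

Lemma msmooth_mul U (m n p : nat) (F : M -> 'M[R]_(m, n)) (G : M -> 'M[R]_(n, p)) : open U ->
  msmooth_on U F -> msmooth_on U G -> msmooth_on U (fun x => F x *m G x).
Proof.
move=> oU sF sG i j.
apply: (smooth_on_ext (f := fun x => \sum_l F x i l * G x l j)) => //.
  by move=> x _; rewrite mxE.
by apply: smooth_on_sum => // l; exact: smooth_on_mul.
Qed.

Lemma msmooth_det U (n : nat) (F : M -> 'M[R]_n) : open U ->
  msmooth_on U F -> smooth_on U (fun x => \det (F x)).
Proof.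
move=> oU sF; apply: smooth_on_sum => // s; apply: smooth_on_mul => //.
  exact: smooth_on_cst.
by apply: smooth_on_prod => // i; exact: sF.
Qed.

(** Cramer's formula: the entries of the adjugate are signed minors, polynomial in the entries of
    F. *)
Lemma msmooth_inv U (n : nat) (F : M -> 'M[R]_n) : open U ->
  (forall x, U x -> F x \in unitmx) ->
  msmooth_on U F -> msmooth_on U (fun x => invmx (F x)).
Proof.
move=> oU uF sF i j.
apply: (smooth_on_ext (f := fun x => (\det (F x))^-1 * (\adj (F x)) i j)) => //.
  by move=> x Ux; rewrite /invmx uF // [in RHS]mxE.
apply: smooth_on_mul => //.
  apply: smooth_on_inv => //; last exact: msmooth_det.
  by move=> x /uF; rewrite unitmxE unitfE.
apply: (smooth_on_ext (f := fun x => (-1) ^+ (j + i) * \det (row' j (col' i (F x))))) => //.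
  by move=> x _; rewrite mxE.
apply: smooth_on_mul => //; first exact: smooth_on_cst.
apply: msmooth_det => // a b.
apply: (smooth_on_ext (f := fun x => F x (lift j a) (lift i b))) => //.
by move=> x _; rewrite !mxE.
Qed.

End SmoothMatrices.

Section KernelBundle.
Variables (R : realType) (M : manifold R) (A k : vbundle M).
Variables (inc : bmap k A) (l : bmap A k).
Hypothesis lK : forall x u, l x (inc x u) = u.

Local Notation n := (vrank A).
Local Notation m := (vrank k).
Local Notation r := (vrank A - vrank k)%N.

(** The idempotent with image ker l and kernel k, from whose matrix the trivializations of ker l are
    built. *)
Definition kproj : bmap A A.
Proof.
refine (@BMap R M A A (fun x a => a - inc x (l x a)) _ _).
- move=> x a u v; rewrite !bfun_lin scalerBr; zmod.
- move=> s; have := sectP (s - bapp inc (bapp l s)).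
  congr smooth_sec; apply: functional_extensionality_dep => x; exact: sectBE.
Defined.

Lemma l_kproj x a : l x (kproj x a) = 0.
Proof. by rewrite /= (linB (bfun_lin l (x := x))) lK subrr. Qed.

Lemma kproj_inc x u : kproj x (inc x u) = 0.
Proof. by rewrite /= lK subrr. Qed.

Lemma kproj_id x a : l x a = 0 -> kproj x a = a.
Proof. by move=> /= ->; rewrite (lin0 (bfun_lin inc (x := x))) subr0. Qed.

Section Fibre.
Variable x : M.

Record kerfib := KerFib { kerval :> vfib A x; kervalP : l x kerval = 0 }.

Lemma kerval_inj (u v : kerfib) : kerval u = kerval v -> u = v.
Proof.
case: u v => [u uP] [v vP] /= uv; subst v; congr KerFib; exact: Prop_irrelevance.
Qed.

Definition ker0 := KerFib (lin0 (bfun_lin l (x := x))).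

Lemma kerD_subproof (u v : kerfib) : l x (kerval u + kerval v) = 0.
Proof. by rewrite (linD (bfun_lin l (x := x))) !kervalP addr0. Qed.
Definition kerD u v := KerFib (kerD_subproof u v).

Lemma kerZ_subproof a (u : kerfib) : l x (a *: kerval u) = 0.
Proof. by rewrite (linZ (bfun_lin l (x := x))) kervalP scaler0. Qed.
Definition kerZ a u := KerFib (kerZ_subproof a u).

HB.instance Definition _ := gen_eqMixin kerfib.
HB.instance Definition _ := gen_choiceMixin kerfib.

Lemma kerDA : associative kerD.
Proof. by move=> u v w; apply: kerval_inj; exact: addrA. Qed.
Lemma kerDC : commutative kerD.
Proof. by move=> u v; apply: kerval_inj; exact: addrC. Qed.
Lemma kerD0 : left_id ker0 kerD.
Proof. by move=> u; apply: kerval_inj; exact: add0r. Qed.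
Lemma kerDN : left_inverse ker0 (kerZ (-1)) kerD.
Proof. by move=> u; apply: kerval_inj => /=; rewrite scaleN1r addNr. Qed.
HB.instance Definition _ :=
  GRing.isZmodule.Build kerfib kerDA kerDC kerD0 kerDN.

Lemma kerZA a b v : kerZ a (kerZ b v) = kerZ (a * b) v.
Proof. by apply: kerval_inj; exact: scalerA. Qed.
Lemma kerZ1 : left_id 1 kerZ.
Proof. by move=> v; apply: kerval_inj; exact: scale1r. Qed.
Lemma kerZDr : right_distributive kerZ +%R.
Proof. by move=> a v w; apply: kerval_inj; exact: scalerDr. Qed.
Lemma kerZDl v : {morph kerZ^~ v : a b / a + b >-> a + b}.
Proof. by move=> a b; apply: kerval_inj; exact: scalerDl. Qed.
HB.instance Definition _ :=
  GRing.Zmodule_isLmodule.Build R kerfib kerZA kerZ1 kerZDr kerZDl.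

Definition kerproj (a : vfib A x) : kerfib := KerFib (l_kproj a).

Lemma kerproj_lin a (u v : vfib A x) : kerproj (a *: u + v) = a *: kerproj u + kerproj v.
Proof. by apply: kerval_inj; exact: (bfun_lin kproj). Qed.

Lemma kerprojK (b : kerfib) : kerproj (kerval b) = b.
Proof. by apply: kerval_inj; exact: kproj_id (kervalP b). Qed.

End Fibre.

Section LocalMatrix.
Variable t : triv (vfib A) n.

Definition projmx (x : M) : 'M[R]_n :=
  \matrix_(i, j) tcoord t (kproj x (frame t i x)) ord0 j.

Lemma tcoord_kproj x a : tdom t x -> tcoord t (kproj x a) = tcoord t a *m projmx x.
Proof.
move=> tx; rewrite {1}(frame_coord a tx) (lin_sum (bfun_lin kproj (x := x))).
under eq_bigr do rewrite (linZ (bfun_lin kproj (x := x))).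
rewrite tcoord_sum //; apply/rowP => j; rewrite summxE mxE.
by apply: eq_bigr => i _; rewrite !mxE.
Qed.

Lemma projmx_smooth : vtriv t -> msmooth_on (tdom t) projmx.
Proof.
move=> vt i j.
have := bmap_smooth_on kproj (tdom_open t) (frame_smooth i vt) vt j.
rewrite setIid; apply: smooth_on_ext; first exact: tdom_open.
by move=> x _; rewrite mxE.
Qed.

(** L and N are the matrices of l and inc, acting on row vectors. N is row free because inc has the
    left inverse l. *)
Lemma projmx_factor x : tdom t x -> exists (L : 'M[R]_(n, m)) (N : 'M[R]_(m, n)),
  [/\ 1%:M - projmx x = L *m N, N *m projmx x = 0 & row_free N].
Proof.
move=> tx; have [u vu ux] := vtriv_cover k x.
pose N : 'M[R]_(m, n) := \matrix_(i, j) tcoord t (inc x (frame u i x)) ord0 j.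
have NE w : w *m N = tcoord t (inc x (tvec u x w)).
  rewrite (tvec_frame w ux) (lin_sum (bfun_lin inc (x := x))).
  under eq_bigr do rewrite (linZ (bfun_lin inc (x := x))).
  rewrite tcoord_sum //; apply/rowP => j; rewrite summxE mxE.
  by apply: eq_bigr => i _; rewrite !mxE.
pose L : 'M[R]_(n, m) := \matrix_(i, j) tcoord u (l x (frame t i x)) ord0 j.
exists L, N; split.
- apply/row_matrixP => i; rewrite row_mul.
  have -> : row i L = tcoord u (l x (frame t i x)) by apply/rowP => j; rewrite !mxE.
  rewrite NE tcoordK // linearB /= row1.
  have -> : row i (projmx x) = tcoord t (kproj x (frame t i x)) by apply/rowP => j; rewrite !mxE.
  by rewrite /= (linB (tcoord_lin tx)) tcoord_frame // subKr.
- apply/row_matrixP => i; rewrite row_mul row0 rowE NE -tcoord_kproj // kproj_inc.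
  exact: (lin0 (tcoord_lin tx)).
- rewrite -kermx_eq0; apply/eqP/row_matrixP => i; rewrite row0.
  have : row i (kermx N) *m N = 0 by rewrite -row_mul mulmx_ker row0.
  rewrite NE; set w := row i _ => e.
  have {}e : inc x (tvec u x w) = 0.
    by apply: (tcoord_inj tx); rewrite e (lin0 (tcoord_lin tx)).
  have {}e : tvec u x w = 0 by rewrite -[LHS]lK e (lin0 (bfun_lin l (x := x))).
  by rewrite -(tvecK ux w) e (lin0 (tcoord_lin ux)).
Qed.

(** The rank is at most n - m since the m independent rows of N are killed by the projection, and at
    least n - m since 1 is the sum of the projection and L *m N, which has rank at most m. *)
Lemma projmx_rank x : tdom t x -> \rank (projmx x) = r.
Proof.
move=> tx; have [L [N [LN NP fN]]] := projmx_factor tx.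
apply/eqP; rewrite eqn_leq; apply/andP; split.
  have : (N <= kermx (projmx x))%MS by apply/sub_kermxP.
  move=> /mxrankS; rewrite mxrank_ker (eqP (fN : \rank N == m)) => h.
  have hn := rank_leq_row (projmx x); move: h; rewrite (leq_subRL _ hn) => h.
  (* [h] also yields m <= n, so the truncated difference r is the true one. *)
  by rewrite leq_subRL 1?addnC // (leq_trans (leq_addl _ _) h).
rewrite leq_subLR -[X in (X <= _)%N](mxrank1 R n) -(subrK (projmx x) 1%:M) LN.
apply: (leq_trans (mxrank_add _ _)); rewrite leq_add2r.
exact: leq_trans (mxrankM_maxr _ _) (rank_leq_row _).
Qed.

Section Triv.
Variables (W : 'M[R]_(r, n)) (C : 'M[R]_(n, r)).

(** W picks r combinations of the frame, C picks r coordinates of their projections. Where this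
    square matrix W P C is invertible, the projections form a frame of ker l, in which a vector with
    coordinates a in A has coordinates a C (W P C)^-1. *)
Definition kermat x : 'M[R]_r := W *m projmx x *m C.
Definition kerdom : set M := tdom t `&` [set x | kermat x \in unitmx].

Hypothesis vt : vtriv t.

Lemma kermat_smooth : msmooth_on (tdom t) kermat.
Proof.
have oT := tdom_open t.
apply: msmooth_mul => //; last exact: msmooth_cst.
by apply: msmooth_mul => //; [exact: msmooth_cst|exact: projmx_smooth].
Qed.

Lemma kerdom_open : open kerdom.
Proof.
rewrite openE => x [tx ux].
have cd := smooth_on_continuous (msmooth_det (tdom_open t) kermat_smooth) (tdom_open t) tx.
have d0 : \det (kermat x) != 0 by rewrite -unitfE -unitmxE.
apply: filterI; first exact: open_nbhs_nbhs (conj (tdom_open t) tx).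
have o : open [set z : R | z != 0].
  rewrite (_ : mkset _ = ~` [set 0]); first exact/closed_openC/closed_eq.
  by apply/seteqP; split => z /= /eqP.
have H : \forall z \near x, \det (kermat z) != 0 := cd _ (open_nbhs_nbhs (conj o d0)).
by apply: filterS H => z; rewrite /= unitmxE unitfE.
Qed.

Lemma kertriv_subproofK x (b : kerfib x) : kerdom x ->
  tcoord t (kerval b) *m C *m invmx (kermat x) *m (W *m projmx x) = tcoord t (kerval b).
Proof.
move=> [tx ux]; set a := tcoord t _.
have aP : a *m projmx x = a by rewrite /a -tcoord_kproj // (kproj_id (kervalP b)).
(* W P has the full rank r of P because W P C is invertible, so its rows span the whole image of P
   and a is of the form z W P. *)
have sub : (projmx x <= W *m projmx x)%MS.
  have le : (W *m projmx x <= projmx x)%MS by exact: submxMl.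
  have : \rank (W *m projmx x) = \rank (projmx x).
    apply/eqP; rewrite eqn_leq mxrankS //= projmx_rank //.
    have := mxrankM_maxl (W *m projmx x) C; rewrite -/(kermat x) mxrank_unit //.
  by move=> /eqP; rewrite (mxrank_leqif_sup le).
have /submxP[z az] : (a <= W *m projmx x)%MS.
  by apply: submx_trans sub; rewrite -aP; exact: submxMl.
by rewrite {1}az -[z *m _ *m C]mulmxA -/(kermat x) mulmxK.
Qed.

Definition kertriv : triv (fun x => kerfib x : lmodType R) r.
Proof.
refine (@Triv R M (fun x => kerfib x : lmodType R) r kerdom
  (fun x w => kerproj (tvec t x (w *m W)))
  (fun x b => tcoord t (kerval b) *m C *m invmx (kermat x)) kerdom_open _ _ _).
- by move=> x [tx _] a u v; rewrite mulmxDl -scalemxAl tvec_lin // kerproj_lin.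
- move=> x [tx ux] w; rewrite [kerval _]/= -/(kproj x _).
  rewrite tcoord_kproj // tvecK //.
  have -> : w *m W *m projmx x *m C = w *m kermat x by rewrite /kermat !mulmxA.
  by rewrite mulmxK.
- move=> x kx b; apply: kerval_inj; case: (kx) => tx ux.
  apply: (tcoord_inj tx); rewrite -[kerval _]/(kproj x _) tcoord_kproj // tvecK //.
  by rewrite -mulmxA kertriv_subproofK.
Defined.

End Triv.

Lemma kertriv_cover x : tdom t x -> exists W C, kerdom W C x.
Proof.
move=> tx; have rk := projmx_rank tx.
(* From the rank normal form P = E pid_mx F at the point x: these choices of W and C make W P C the
   identity there. *)
exists (pid_mx r *m invmx (col_ebase (projmx x))), (invmx (row_ebase (projmx x)) *m pid_mx r).
split=> //; rewrite /= /kermat -{2}(mulmx_ebase (projmx x)) !mulmxA.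
rewrite mulmxKV ?col_ebase_unit // mulmxK ?row_ebase_unit // rk.
have h : minn n r = r by apply/minn_idPr; exact: leq_subr.
rewrite !mul_pid_mx !minnn h minnn h pid_mx_1.
exact: unitmx1.
Qed.

End LocalMatrix.

Lemma kerproj_frame_smooth (t : triv (vfib A) n) w : vtriv t ->
  vb_smooth_on (tdom t) (fun x => kproj x (tvec t x w)).
Proof.
move=> vt; apply: bmap_smooth_on; first exact: tdom_open.
move=> t' vt' i; rewrite setIC; exact: vtriv_smooth vt vt' w i.
Qed.

Definition kerbundle : vbundle M.
Proof.
refine (@VBundle R M (fun x => kerfib x : lmodType R) r
  [set tau | exists t W C (vt : vtriv t), tau = kertriv W C vt] _ _).
- move=> x; have [t vt tx] := vtriv_cover A x; have [W [C kx]] := kertriv_cover tx.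
  by exists (kertriv W C vt) => //; exists t, W, C, vt.
- move=> _ _ [t [W [C [vt ->]]]] [t' [W' [C' [vt' ->]]]] w i.
  have oU : open (kerdom t W C `&` kerdom t' W' C').
    by apply: openI; exact: kerdom_open.
  suff H : msmooth_on (kerdom t W C `&` kerdom t' W' C') (fun x =>
      tcoord t' (kproj x (tvec t x (w *m W))) *m C' *m invmx (kermat t' W' C' x)).
    exact: H.
  apply: msmooth_mul => //; last first.
    apply: msmooth_inv => //; first by move=> x [_ []].
    by apply: msmooth_sub (kermat_smooth W' C' vt') => x [_ []].
  apply: msmooth_mul => //; last exact: msmooth_cst.
  move=> a b; rewrite ord1.
  by apply: smooth_on_sub (kerproj_frame_smooth (w *m W) vt vt' b) => x [[? _] [? _]].
Defined.

(** A section of the kernel is a combination of projected frame vectors with its own coordinates as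
    coefficients; conversely these coordinates are those in A times smooth matrices. Inclusion and
    projection are thereby smooth bundle maps. *)
Lemma kerbundle_smoothP (s : forall x, vfib kerbundle x) :
  vb_smooth s <-> @vb_smooth R M A (fun x => kerval (s x)).
Proof.
split=> ss.
  apply/vb_smooth_onT; apply: (@vb_smooth_on_bigcup R M A
    [set Z | exists t W C (vt : vtriv t), Z = kerdom t W C]).
    move=> x _; have [t vt tx] := vtriv_cover A x; have [W [C kx]] := kertriv_cover tx.
    by exists (kerdom t W C) => //; exists t, W, C, vt.
  move=> _ [t [W [C [vt ->]]]].
  have oU : open (kerdom t W C) by exact: kerdom_open.
  have vk : vtriv (v := kerbundle) (kertriv W C vt) by exists t, W, C, vt.
  have sc := ss _ vk.
  apply: (vb_smooth_on_ext oU (s := fun x => \sum_i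
     tcoord (kertriv W C vt) (s x) ord0 i *: kproj x (tvec t x (delta_mx ord0 i *m W)))).
    move=> x kx; set c := tcoord (kertriv W C vt) (s x).
    have e : kproj x (tvec t x (c *m W)) = kerval (s x) :=
      congr1 (@kerval x) (tcoordK (t := kertriv W C vt) kx (s x)).
    rewrite -[RHS]e [in RHS](row_sum_delta c) mulmx_suml.
    case: (kx) => tx _.
    rewrite (lin_sum (tvec_lin tx)) (lin_sum (bfun_lin kproj (x := x))).
    apply: eq_bigr => i _; rewrite -scalemxAl (linZ (tvec_lin tx)).
    by rewrite (linZ (bfun_lin kproj (x := x))).
  apply: vb_smooth_on_sum => // i; apply: vb_smooth_onZ => //.
  by apply: vb_smooth_on_sub (kerproj_frame_smooth _ vt) => x [].
move=> _ [t [W [C [vt ->]]]] i.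
have oU : open (kerdom t W C) by exact: kerdom_open.
suff H : msmooth_on (kerdom t W C) (fun x =>
    tcoord t (kerval (s x)) *m C *m invmx (kermat t W C x)) by exact: H.
apply: msmooth_mul => //; last first.
  apply: msmooth_inv => //; first by move=> x [].
  by apply: msmooth_sub (kermat_smooth W C vt) => x [].
apply: msmooth_mul => //; last exact: msmooth_cst.
by move=> a b; rewrite ord1; apply: smooth_on_sub (ss t vt b) => x [].
Qed.

Definition ker_incl : bmap kerbundle A :=
  @BMap R M kerbundle A (fun x (u : vfib kerbundle x) => kerval u)
    (fun x a u v => erefl) (fun s => proj1 (kerbundle_smoothP s) (sectP s)).

Definition ker_proj : bmap A kerbundle.
Proof.
refine (@BMap R M A kerbundle (fun x a => kerproj a) (fun x a u v => kerproj_lin a u v) _).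
move=> s; apply/kerbundle_smoothP; exact: (bfun_smooth kproj s).
Defined.

End KernelBundle.

(** All that is used of ker l from here on: an inclusion j and the projection p along k. *)
Lemma kernel_bundle (R : realType) (M : manifold R) (A k : vbundle M)
    (inc : bmap k A) (l : bmap A k) : (forall x u, l x (inc x u) = u) ->
  exists (B : vbundle M) (j : bmap B A) (p : bmap A B),
    (forall x b, p x (j x b) = b) /\ (forall x a, j x (p x a) = a - inc x (l x a)).
Proof.
move=> lK; exists (kerbundle lK), (ker_incl lK), (ker_proj lK); split => // x b.
exact: kerprojK.
Qed.

(** * Parallel transport *)

Section MatrixDerivative.
Variable R : realType.

Lemma is_derive_mul (f g : R -> R) (s a b : R) :
  is_derive (s : R) (1 : R) f a -> is_derive (s : R) (1 : R) g b ->
  is_derive (s : R) (1 : R) (fun s => f s * g s) (a * g s + f s * b).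
Proof.
move=> fa gb; have := is_deriveM fa gb.
by rewrite addrC -[g s *: a]/(g s * a) (mulrC (g s)).
Qed.

Lemma is_derive_bsum (I : Type) (r : seq I) (f : I -> R -> R) (d : I -> R) (s : R) :
  (forall i, is_derive (s : R) (1 : R) (f i) (d i)) ->
  is_derive (s : R) (1 : R) (fun s => \sum_(i <- r) f i s) (\sum_(i <- r) d i).
Proof.
move=> fd; elim: r => [|i r IH].
  rewrite big_nil; rewrite (_ : (fun s => _) = cst 0); first exact: is_derive_cst.
  by apply/funext => h; rewrite big_nil.
rewrite big_cons (_ : (fun s => _) = fun s => f i s + \sum_(i <- r) f i s).
  exact: is_deriveD.
by apply/funext => h; rewrite big_cons.
Qed.

Definition mderive (m n : nat) (F : R -> 'M[R]_(m, n)) (s : R) (D : 'M[R]_(m, n)) :=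
  forall i j, is_derive (s : R) (1 : R) (fun s => F s i j) (D i j).

Lemma mderive_cst (m n : nat) (A : 'M[R]_(m, n)) s : mderive (fun=> A) s 0.
Proof. by move=> i j; rewrite mxE; exact: is_derive_cst. Qed.

Lemma mderive_mul (m n p : nat) (F : R -> 'M[R]_(m, n)) (G : R -> 'M[R]_(n, p)) s D E :
  mderive F s D -> mderive G s E -> mderive (fun s => F s *m G s) s (D *m G s + F s *m E).
Proof.
move=> Fd Gd i j; rewrite !mxE -big_split /=.
rewrite (_ : (fun s => _) = fun s => \sum_l F s i l * G s l j).
  by apply: is_derive_bsum => l; exact: is_derive_mul.
by apply/funext => h; rewrite mxE.
Qed.

Lemma mderive_sumZ (m n : nat) (I : Type) (r : seq I) (f : I -> R -> R) (d : I -> R)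
    (F : I -> R -> 'M[R]_(m, n)) (D : I -> 'M[R]_(m, n)) s :
  (forall i, is_derive (s : R) (1 : R) (f i) (d i)) -> (forall i, mderive (F i) s (D i)) ->
  mderive (fun s => \sum_(i <- r) f i s *: F i s) s
    (\sum_(i <- r) (d i *: F i s + f i s *: D i)).
Proof.
move=> fd Fd a b; rewrite summxE.
under eq_bigr do rewrite !mxE.
rewrite (_ : (fun s => _) = fun s => \sum_(i <- r) f i s * F i s a b).
  by apply: is_derive_bsum => i; apply: is_derive_mul; exact: Fd.
by apply/funext => h; rewrite summxE; apply: eq_bigr => i _; rewrite mxE.
Qed.

Lemma mderive0_const (m n : nat) (F : R -> 'M[R]_(m, n)) (a b : R) : a <= b ->
  (forall s, a <= s <= b -> mderive F s 0) -> F b = F a.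
Proof.
move=> ab Fd; apply/matrixP => i j.
apply: (@is_derive0_const R (fun s => F s i j)) => // s sab.
by have := Fd s sab i j; rewrite mxE.
Qed.

End MatrixDerivative.

Section Transport.
Variables (R : realType) (n r : nat).
Variables (p : 'rV[R]_n) (om : 'I_n -> 'rV[R]_n -> 'M[R]_r).
Hypothesis om_smooth : forall i a b, Coo setT (fun y => om i y a b).

(* Parallel transport along the ray s |-> s z + p for the connection d + om. *)
Definition raymx (s : R) (z : 'rV[R]_n) : 'M[R]_r := - \sum_i z ord0 i *: om i (s *: z + p).

Lemma raymx_pCk k a b : pCk k (fun s z => raymx s z a b).
Proof.
rewrite (_ : (fun s z => _) = fun s (z : 'rV[R]_n) => (-1) * \sum_i z ord0 i * om i (s *: z + p) a b).
  apply: pCk_mul; first exact: pCk_cst.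
  apply: pCk_sum => i; apply: pCk_mul; first exact: pCk_coord.
  exact: pCk_ray (om_smooth i a b k).
apply/funext => s; apply/funext => z; rewrite !mxE summxE mulN1r.
by congr (- _); apply: eq_bigr => i _; rewrite mxE.
Qed.

Definition transport (s : R) (z : 'rV[R]_n) : 'M[R]_r :=
  \matrix_(a, j) picard_sol (fun i j s z => raymx s z i j) (fun i => (a == i)%:R) j s z.

(** Solves X' = - raymx X column by column, hence the transposed indices. The product of [transport]
    with it is then constant, which gives a smooth inverse without inverting a matrix. *)
Definition transportV (s : R) (z : 'rV[R]_n) : 'M[R]_r :=
  \matrix_(j, b) picard_sol (fun i j s z => - raymx s z j i) (fun i => (i == b)%:R) j s z.

Lemma raymxN_pCk k a b : pCk k (fun s z => - raymx s z b a).
Proof.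
rewrite (_ : (fun s z => _) = fun s (z : 'rV[R]_n) => (-1) * raymx s z b a).
  by apply: pCk_mul; [exact: pCk_cst|exact: raymx_pCk].
by apply/funext => s; apply/funext => z; rewrite mulN1r.
Qed.

Lemma transport0 z : transport 0 z = 1%:M.
Proof.
apply/matrixP => a j; rewrite !mxE picard_sol0 // => i b.
exact: pCk_jcont (raymx_pCk 0 i b).
Qed.

Lemma transportV0 z : transportV 0 z = 1%:M.
Proof.
apply/matrixP => a j; rewrite !mxE picard_sol0 // => i b.
exact: pCk_jcont (raymxN_pCk 0 i b).
Qed.

Lemma mderive_transport s z : mderive (transport ^~ z) s (transport s z *m raymx s z).
Proof.
move=> a j; rewrite mxE; under eq_bigr do rewrite mxE.
rewrite (_ : (fun s => _) = picard_sol (fun i j s z => raymx s z i j) (fun i => (a == i)%:R) j ^~ z).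
  by apply: is_derive_picard_sol => i b; exact: pCk_jcont (raymx_pCk 0 i b).
by apply/funext => h; rewrite mxE.
Qed.

Lemma mderive_transportV s z : mderive (transportV ^~ z) s (- (raymx s z *m transportV s z)).
Proof.
move=> j b; rewrite mxE mxE -sumrN.
rewrite (_ : (fun s => _) = picard_sol (fun i j s z => - raymx s z j i) (fun i => (i == b)%:R) j ^~ z); last first.
  by apply/funext => h; rewrite mxE.
have H i a : jcont (fun s z => - raymx s z a i) := pCk_jcont (raymxN_pCk 0 i a).
have := is_derive_picard_sol (fun i => (i == b)%:R) H j s z; congr is_derive.
by apply: eq_bigr => i _; rewrite [transportV _ _ _ _]mxE mulrN mulrC.
Qed.

Lemma transportK z : transport 1 z *m transportV 1 z = 1%:M.
Proof.
have e : transport 0 z *m transportV 0 z = 1%:M by rewrite transport0 transportV0 mulmx1.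
rewrite -[RHS]e; apply: (@mderive0_const _ _ _ (fun s => transport s z *m transportV s z)) => // s _.
have := mderive_mul (mderive_transport s z) (mderive_transportV s z).
by rewrite -[X in X + _]mulmxA mulmxN subrr.
Qed.

Lemma transportVK z : transportV 1 z *m transport 1 z = 1%:M.
Proof. exact: mulmx1C (transportK z). Qed.

Lemma transport_smooth a b : Coo setT (fun z => transport 1 z a b).
Proof.
move=> k; rewrite (_ : (fun z => _) =
  picard_sol (fun i j s z => raymx s z i j) (fun i => (a == i)%:R) b 1).
  by apply: pCk_Ck; apply: picard_sol_pCk => i j; exact: raymx_pCk.
by apply/funext => h; rewrite mxE.
Qed.

Lemma transportV_smooth a b : Coo setT (fun z => transportV 1 z a b).
Proof.
move=> k; rewrite (_ : (fun z => _) =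
  picard_sol (fun i j s z => - raymx s z j i) (fun i => (i == b)%:R) a 1).
  by apply: pCk_Ck; apply: picard_sol_pCk => i j; exact: raymxN_pCk.
by apply/funext => h; rewrite mxE.
Qed.

(* A bilinear bracket that is parallel for d + om is preserved by transport:
   [u T, v T] T^-1 is constant along the ray. Row a of [be b y] is the bracket of
   the a-th and b-th basis vectors. *)
Variables (be : 'I_r -> 'rV[R]_n -> 'M[R]_r) (rad : R) (O : set 'rV[R]_n).
Hypotheses (oO : open O) (Orad : forall y, `|y - p| < rad -> O y).
Hypothesis be_smooth : forall b a d, Ck 1 O (fun y => be b y a d).
Hypothesis be_parallel : forall i b y, `|y - p| < rad ->
  \matrix_(a, d) pderive (fun y => be b y a d) i y =
  om i y *m be b y - be b y *m om i y + \sum_b' om i y b b' *: be b' y.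

Definition rowbracket (y : 'rV[R]_n) (u v : 'rV[R]_r) : 'rV[R]_r :=
  u *m \sum_b v ord0 b *: be b y.

Lemma transport_bracket z u v : `|z| < rad ->
  rowbracket (z + p) (u *m transport 1 z) (v *m transport 1 z) = rowbracket p u v *m transport 1 z.
Proof.
move=> zr.
(* The matrix of the bracket with the transported v in the second slot. *)
pose N s := \sum_b (v *m transport s z) ord0 b *: be b (s *: z + p).
pose F s := u *m transport s z *m N s *m transportV s z.
have F01 : F 1 = F 0.
  apply: mderive0_const => // s /andP[s0 s1].
  have yr : `|s *: z + p - p| < rad.
    by rewrite addrK normrZ (ger0_norm s0) (le_lt_trans _ zr) // ler_piMl.
  have Oy := Orad yr.
  set A := raymx s z.
  have dG : mderive (fun s => u *m transport s z) s (u *m transport s z *m A).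
    have := mderive_mul (mderive_cst u s) (mderive_transport s z).
    by rewrite mul0mx add0r mulmxA.
  have dg b : is_derive (s : R) (1 : R) (fun s => (v *m transport s z) ord0 b)
      ((v *m transport s z *m A) ord0 b).
    have := mderive_mul (mderive_cst v s) (mderive_transport s z) ord0 b.
    by rewrite mul0mx add0r mulmxA.
  (* The derivative along the ray is the sum of [be_parallel] over the coordinates i with weights
     z_i, and the same sum of the om i is - A. *)
  have dbe b : mderive (fun s => be b (s *: z + p)) s
      (be b (s *: z + p) *m A - A *m be b (s *: z + p) - \sum_b' A b b' *: be b' (s *: z + p)).
    move=> a d; apply: (@is_derive_lineD R _ (fun y => be b y a d) p z s _).1.
    have := derive_linear z oO (be_smooth b a d) Oy; congr is_derive.
    set y := s *: z + p.
    transitivity ((\sum_i z ord0 i *: \matrix_(a, d) pderive (fun y => be b y a d) i y) a d).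
      by rewrite summxE; apply: eq_bigr => i _; rewrite !mxE.
    congr (fun_of_matrix _ a d).
    under eq_bigr do rewrite (be_parallel _ _ yr) scalerDr scalerBr scalemxAl scalemxAr.
    rewrite big_split sumrB /= -mulmx_suml -mulmx_sumr -/y.
    have AE : \sum_i z ord0 i *: om i y = - A by rewrite /A /raymx opprK.
    rewrite AE mulNmx mulmxN opprK.
    suff -> : \sum_i z ord0 i *: (\sum_b' om i y b b' *: be b' y) =
      - \sum_b' A b b' *: be b' y by zmod.
    under eq_bigr do rewrite scaler_sumr.
    rewrite exchange_big /= -sumrN; apply: eq_bigr => b' _.
    under eq_bigr do rewrite scalerA.
    rewrite -scaler_suml -scaleNr; congr (_ *: _).
    have := congr1 (fun X : 'M[R]_r => X b b') AE; rewrite mxE => <-.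
    by rewrite summxE; apply: eq_bigr => i _; rewrite mxE.
  (* The derivative of the transported v cancels the third term of [be_parallel], leaving a
     commutator. *)
  have dN : mderive N s (N s *m A - A *m N s).
    have := mderive_sumZ (index_enum _) dg dbe; congr mderive.
    set y := s *: z + p; set w := v *m transport s z.
    rewrite big_split /=.
    under [X in _ + X]eq_bigr do rewrite !scalerBr scalemxAl scalemxAr.
    rewrite sumrB sumrB -mulmx_suml -mulmx_sumr -/(N s).
    have -> : \sum_b w ord0 b *: (\sum_b' A b b' *: be b' y) = \sum_b (w *m A) ord0 b *: be b y.
      under eq_bigr do rewrite scaler_sumr.
      rewrite exchange_big; apply: eq_bigr => b' _.
      under eq_bigr do rewrite scalerA.
      by rewrite -scaler_suml mxE.
    by rewrite addrC subrK.
  (* The first two factors of F contribute u T N A, which the derivative of the inverse transport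
     cancels. *)
  have := mderive_mul (mderive_mul dG dN) (mderive_transportV s z); congr mderive.
  have -> : u *m transport s z *m A *m N s + u *m transport s z *m (N s *m A - A *m N s) =
      u *m transport s z *m N s *m A by rewrite mulmxBr !mulmxA; zmod.
  have cancel (P : 'rV[R]_r) (Q1 Q2 : 'M[R]_r) : P *m Q1 *m Q2 + P *m - (Q1 *m Q2) = 0.
    by rewrite mulmxN mulmxA subrr.
  exact: cancel.
have e0 : F 0 = rowbracket p u v.
  rewrite /F transport0 transportV0 !mulmx1 /rowbracket /N transport0 mulmx1.
  by rewrite scale0r add0r.
have e1 : F 1 = rowbracket (z + p) (u *m transport 1 z) (v *m transport 1 z) *m transportV 1 z.
  by rewrite /F /N /rowbracket scale1r.
by rewrite -e0 -F01 e1 -mulmxA transportVK mulmx1.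
Qed.

End Transport.

Lemma bimap_smooth_on (R : realType) (M : manifold R) (E F G : vbundle M) (phi : bimap E F G)
    (U : set M) (s : forall x, vfib E x) (s' : forall x, vfib F x) : open U ->
  vb_smooth_on U s -> vb_smooth_on U s' -> vb_smooth_on U (fun x => phi x (s x) (s' x)).
Proof.
move=> oU ss ss'.
apply: (@vb_smooth_on_bigcup _ _ _
  [set W | open W /\ vb_smooth_on W (fun x => phi x (s x) (s' x))]).
  move=> x Ux; have [f [W [V [[oW Wx] oV UV f1 f0]]]] := bump_manifold oU Ux.
  exists W => //; split => //.
  pose g := @Sect R M E _ (vb_smooth_cutoff oU oV UV f0 ss).
  pose g' := @Sect R M F _ (vb_smooth_cutoff oU oV UV f0 ss').
  have := bifun_smooth phi g g' => /(proj2 (vb_smooth_onT _)) /= H.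
  apply: (vb_smooth_on_ext oW _ (vb_smooth_on_sub _ H)) => // z Wz.
  by rewrite f1 // !scale1r.
by move=> W [].
Qed.

(** * The bracket of k in a local frame *)

Section ParallelBracket.
Variables (R : realType) (M : manifold R) (k : vbundle M).
Variables (brk : bimap k k k) (D : connection k).
Hypothesis S1 : forall X xi eta, nabla D X (biapp brk xi eta) =
  biapp brk (nabla D X xi) eta + biapp brk xi (nabla D X eta).

Local Notation n := (mdim M).
Local Notation r := (vrank k).

Variables (c : chart R M n) (t : triv (vfib k) r) (chi : smfun M) (W V : set M).
Hypotheses (ac : @atlas R M c) (vt : vtriv t) (oV : open V).
Hypotheses (cV : cdom c `|` V = setT) (tV : tdom t `|` V = setT).
Hypotheses (chiV : forall x, V x -> chi x = 0) (chiW : forall x, W x -> chi x = 1).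

Let Wt x : W x -> tdom t x.
Proof.
move=> Wx; have : (tdom t `|` V) x by rewrite tV.
case=> // /chiV e; have := chiW Wx; rewrite e => /eqP.
by rewrite eq_sym oner_eq0.
Qed.

Let Wc x : W x -> cdom c x.
Proof.
move=> Wx; have : (cdom c `|` V) x by rewrite cV.
case=> // /chiV e; have := chiW Wx; rewrite e => /eqP.
by rewrite eq_sym oner_eq0.
Qed.

Definition cutframe (a : 'I_r) : sect k :=
  @Sect R M k _ (vb_smooth_cutoff (tdom_open t) oV tV chiV (frame_smooth a vt)).

Lemma cutframeE a x : W x -> cutframe a x = frame t a x.
Proof. by move=> Wx; rewrite /= chiW // scale1r. Qed.

(** A single factor chi: the bracket of two cut-off frame sections carries chi^2, one factor of
    which goes to the structure function and one to the frame, so [bracket_cutframe] holds on all of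
    M. *)
Lemma struct_smooth a b d :
  smooth_on setT (fun x => chi x * tcoord t (brk x (frame t a x) (frame t b x)) ord0 d).
Proof.
apply: (smooth_on_cutoff (tdom_open t) oV tV) => //.
  by apply: smooth_on_sub (sfP chi).
have := bimap_smooth_on brk (tdom_open t) (frame_smooth a vt) (frame_smooth b vt) vt d.
by rewrite setIid.
Qed.

Definition struct a b d : smfun M := SmFun (struct_smooth a b d).

Lemma bracket_cutframe a b : biapp brk (cutframe a) (cutframe b) =
  \sum_d struct a b d *: cutframe d.
Proof.
apply: sect_ext => x.
have -> : (\sum_d struct a b d *: cutframe d) x = \sum_d (struct a b d *: cutframe d) x.
  by apply: (big_morph (fun s : sect k => s x)).
have [tx|Vx] : (tdom t `|` V) x by rewrite tV.
  rewrite /= (linZ (fun e u v => bifun_linl brk e u v _)) (linZ (fun e u v => bifun_linr brk e _ u v)).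
  rewrite {1}(frame_coord (brk x (frame t a x) (frame t b x)) tx) !scaler_sumr.
  apply: eq_bigr => d _; rewrite -[RHS]/((_ * _) *: (_ *: _)) !scalerA; congr (_ *: _).
  by rewrite mulrAC.
rewrite big1 => [|d _]; last by rewrite sectZE /= chiV // scale0r scaler0.
by rewrite /= chiV // scale0r (lin0 (fun e u v => bifun_linl brk e u v _)).
Qed.

Lemma nabla_sum X (I : Type) (s : seq I) (f : I -> sect k) :
  nabla D X (\sum_(i <- s) f i) = \sum_(i <- s) nabla D X (f i).
Proof. by apply: (big_morph (nabla D X)); [exact: nablaD|exact: nabla0]. Qed.

Definition conn_coef v x : 'M[R]_r :=
  \matrix_(a, d) tcoord t (nabla D (coord_field ac oV cV chiV v) (cutframe a) x) ord0 d.

Lemma conn_coef_smooth v : msmooth_on (tdom t) (conn_coef v).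
Proof.
move=> a d.
have := sectP (nabla D (coord_field ac oV cV chiV v) (cutframe a)) t vt d.
by apply: smooth_on_ext; [exact: tdom_open|move=> x _; rewrite mxE].
Qed.

Definition structmx b x : 'M[R]_r := \matrix_(a, d) struct a b d x.

Lemma bracket_structmx x u v : W x ->
  tcoord t (brk x (tvec t x u) (tvec t x v)) = u *m \sum_b v ord0 b *: structmx b x.
Proof.
move=> Wx; have tx := Wt Wx.
rewrite (tvec_frame u tx) (tvec_frame v tx) (lin_sum (fun e u v => bifun_linl brk e u v _)).
rewrite (lin_sum (tcoord_lin tx)); apply/rowP => d; rewrite summxE mxE.
apply: eq_bigr => a _.
rewrite (linZ (fun e u v => bifun_linl brk e u v _)) (linZ (tcoord_lin tx)) mxE; congr (_ * _).
rewrite (lin_sum (fun e u v => bifun_linr brk e _ u v)) (lin_sum (tcoord_lin tx)) !summxE.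
apply: eq_bigr => b _.
rewrite (linZ (fun e u v => bifun_linr brk e _ u v)) (linZ (tcoord_lin tx)) !mxE /=.
by rewrite chiW // mul1r.
Qed.

(* (S1) for the cut-off frame and coordinate fields, in matrix form. *)
Lemma structmx_parallel v b x : W x ->
  \matrix_(a, d) 'D_v (struct a b d \o cinv c) (cmap c x) =
  conn_coef v x *m structmx b x - structmx b x *m conn_coef v x
  + \sum_b' conn_coef v x b b' *: structmx b' x.
Proof.
move=> Wx; have tx := Wt Wx; set X := coord_field ac oV cV chiV v.
have coef a : nabla D X (cutframe a) x = \sum_d conn_coef v x a d *: frame t d x.
  by rewrite {1}(frame_coord (nabla D X (cutframe a) x) tx); apply: eq_bigr => d _; rewrite mxE.
apply/row_matrixP => a.
have := congr1 (fun s : sect k => tcoord t (s x)) (S1 X (cutframe a) (cutframe b)).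
rewrite bracket_cutframe nabla_sum sectDE (linD (tcoord_lin tx)).
have -> : (\sum_d nabla D X (struct a b d *: cutframe d)) x =
   \sum_d (nabla D X (struct a b d *: cutframe d)) x.
  by apply: (big_morph (fun s : sect k => s x)).
under eq_bigr do rewrite nabla_leibniz sectDE !sectZE cutframeE //.
rewrite big_split /= (linD (tcoord_lin tx)).
have -> : tcoord t (\sum_d struct a b d x *: D (cutframe d) x (X x)) =
    row a (structmx b x *m conn_coef v x).
  rewrite tcoord_sum // row_mul; apply/rowP => d; rewrite summxE mxE.
  by apply: eq_bigr => d' _; rewrite !mxE.
have -> : tcoord t (\sum_d (X x : tangent x) (struct a b d) *: frame t d x) =
    row a (\matrix_(a, d) 'D_v (struct a b d \o cinv c) (cmap c x)).
  rewrite tcoord_sum //; apply/rowP => d; rewrite summxE (bigD1 d) //= big1 ?addr0 => [|d' dd'].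
    by rewrite tcoord_frame // !mxE !eqxx mulr1 chiW // mul1r.
  by rewrite tcoord_frame // !mxE eqxx /= eq_sym (negbTE dd') mulr0.
have -> : tcoord t (biapp brk (nabla D X (cutframe a)) (cutframe b) x) =
    row a (conn_coef v x *m structmx b x).
  rewrite /= -[D _ _ _]/(nabla D X (cutframe a) x) coef chiW // scale1r.
  rewrite (lin_sum (fun e u v => bifun_linl brk e u v _)) (lin_sum (tcoord_lin tx)).
  rewrite row_mul; apply/rowP => d; rewrite summxE mxE; apply: eq_bigr => a' _.
  rewrite (linZ (fun e u v => bifun_linl brk e u v _)) (linZ (tcoord_lin tx)) !mxE /=.
  by rewrite chiW // mul1r.
have -> : tcoord t (biapp brk (cutframe a) (nabla D X (cutframe b)) x) =
    row a (\sum_b' conn_coef v x b b' *: structmx b' x).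
  rewrite /= -[D _ _ _]/(nabla D X (cutframe b) x) coef chiW // scale1r.
  rewrite (lin_sum (fun e u v => bifun_linr brk e _ u v)) (lin_sum (tcoord_lin tx)).
  apply/rowP => d; rewrite summxE mxE summxE; apply: eq_bigr => b' _.
  rewrite (linZ (fun e u v => bifun_linr brk e _ u v)) (linZ (tcoord_lin tx)) !mxE /=.
  by rewrite chiW // mul1r.
move=> e; rewrite linearD linearB /=; move: e.
move=> /(congr1 (fun z => z - row a (structmx b x *m conn_coef v x))).
by rewrite addrC addrA addNr add0r => ->; zmod.
Qed.

End ParallelBracket.

Theorem parallel_lie_algebra_bundle (R : realType) (M : manifold R) (k : vbundle M)
    (brk : bimap k k k) (D : connection k) :
  (forall x, is_lie_algebra (brk x)) ->
  (forall X xi eta, nabla D X (biapp brk xi eta) =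
     biapp brk (nabla D X xi) eta + biapp brk xi (nabla D X eta)) ->
  is_lie_algebra_bundle brk.
Proof.
move=> Lk S1; split=> // x0.
set n := mdim M; set r := vrank k.
have [c ac cx0] := atlas_cover x0; have [t vt tx0] := vtriv_cover k x0.
have oU : open (cdom c `&` tdom t) by apply: openI; [exact: cdom_open|exact: tdom_open].
have [chi [W [V [[oW Wx0] oV UV chiW chiV]]]] := bump_manifold oU (conj cx0 tx0).
have cV : cdom c `|` V = setT.
  apply/seteqP; split=> // z _; have [[? _]|?] : ((cdom c `&` tdom t) `|` V) z by rewrite UV.
    by left.
  by right.
have tV : tdom t `|` V = setT.
  apply/seteqP; split=> // z _; have [[_ ?]|?] : ((cdom c `&` tdom t) `|` V) z by rewrite UV.
    by left.
  by right.
have Wt z : W z -> cdom c z /\ tdom t z.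
  move=> Wz; have : ((cdom c `&` tdom t) `|` V) z by rewrite UV.
  case=> // /chiV e; have := chiW z Wz; rewrite e => /eqP.
  by rewrite eq_sym oner_eq0.
pose p := cmap c x0.
pose O := cimg c `&` cinv c @^-1` W.
have oO : open O := open_cimgI (c := c) oW.
have Op : O p by split; [exact: cmap_img|rewrite /= cmapK].
have [b [r1 [r2 [bs r10 b1 bO b0]]]] := bump_ex oO Op.
have r1O y : `|y - p| < r1 -> O y.
  move=> h; apply: bO; rewrite leNgt; apply/negP => /ltW /b0; rewrite b1 // => /eqP.
  by rewrite oner_eq0.
pose G (i : 'I_n) y := conn_coef D ac vt oV cV tV chiV (delta_mx ord0 i) (cinv c y).
(* Cutting off with b makes the coefficients smooth on the whole space, as transport requires; they
   are unchanged for |y - p| < r1. *)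
pose om (i : 'I_n) y : 'M[R]_r := b y *: G i y.
have om_smooth i a d : Coo setT (fun y => om i y a d).
  move=> m; rewrite (_ : (fun y => _) = fun y => b y * G i y a d); last first.
    by apply/funext => y; rewrite mxE.
  apply: (@Ck_cutoff R n m O [set y | r2 < `|y - p|]) => //.
  - apply: (@open_comp _ _ (fun y : 'rV[R]_n => `|y - p|) [set s | r2 < s]); last exact: open_gt.
    by move=> y _; exact: continuous_dist.
  - apply/seteqP; split=> // y _; have [h|h] := leP `|y - p| r2; last by right.
    by left; exact: bO.
  - exact: Ck_sub (bs m).
  - by move=> y /ltW; exact: b0.
  have := conn_coef_smooth D ac vt oV cV tV chiV (delta_mx ord0 i) a d ac m.
  by apply: Ck_sub => y [cy Wy]; split => //; case: (Wt _ Wy).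
pose be (bb : 'I_r) y : 'M[R]_r := structmx brk vt oV tV chiV bb (cinv c y).
have be_smooth bb a d : Ck 1 O (fun y => be bb y a d).
  apply: (Ck_ext oO (f := struct brk vt oV tV chiV a bb d \o cinv c)).
    by move=> y _; rewrite mxE.
  by apply: Ck_sub (smooth_coord _ 1 ac) => y [].
have be_parallel i bb y : `|y - p| < r1 -> \matrix_(a, d) pderive (fun y => be bb y a d) i y =
    om i y *m be bb y - be bb y *m om i y + \sum_b' om i y bb b' *: be b' y.
  move=> yr; have [cy Wy] := r1O y yr.
  have := structmx_parallel S1 ac vt oV cV tV chiV chiW (delta_mx ord0 i) bb Wy.
  rewrite cinvK // => e; rewrite /om b1 // scale1r -[RHS]e.
  apply/matrixP => a d; rewrite !mxE; congr derive.
  by apply/funext => z; rewrite mxE.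
have key z u v := transport_bracket om_smooth oO r1O be_smooth be_parallel (z := z) u v.
(* Transport along the segment from p to the image of x. Multiplying by T replaces the frame of t by
   one parallel along rays, whose structure constants are constant near x0 by [key]. *)
pose T x := transport p om 1 (cmap c x - p).
pose TV x := transportV p om 1 (cmap c x - p).
have shift (g : 'rV[R]_n -> R) : Coo setT g -> smooth_on (cdom c) (fun x => g (cmap c x - p)).
  move=> gs; have := @smooth_on_chart R M c (cimg c) (fun y => g (y - p)) ac (cimg_open c) (fun _ h => h).
  rewrite (_ : _ `&` _ = cdom c); last first.
    by apply/seteqP; split=> [z []|z cz] //; split => //; exact: cmap_img.
  apply => m; apply: (@Ck_comp R n n m (cimg c) setT (fun y => y - p) g) => //.
  - exact: cimg_open.
  - exact: openT.
  - move=> j; have oI := cimg_open c.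
    apply: (Ck_ext oI (f := fun y : 'rV[R]_n => y ord0 j + - p ord0 j)).
      by move=> y _; rewrite !mxE.
    by apply: Ck_add => //; [exact: coord_Ck|exact: Ck_cst].
have Ts : msmooth_on (cdom c) T.
  by move=> a d; apply: (shift (fun z => transport p om 1 z a d)); exact: transport_smooth.
have TVs : msmooth_on (cdom c) TV.
  by move=> a d; apply: (shift (fun z => transportV p om 1 z a d)); exact: transportV_smooth.
have TTV x : T x *m TV x = 1%:M by exact: transportK.
have TVT x : TV x *m T x = 1%:M by exact: transportVK.
pose Nb := cdom c `&` cmap c @^-1` [set y | `|y - p| < r1].
have oNb : open Nb.
  apply: open_cdomI; apply: (@open_comp _ _ (fun y : 'rV[R]_n => `|y - p|) [set s | s < r1]).
    by move=> y _; exact: continuous_dist.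
  exact: open_lt.
have NbW x : Nb x -> W x.
  by move=> [cx xr]; case: (r1O _ xr) => _; rewrite /= cmapK.
have Nbt x : Nb x -> tdom t x by move=> /NbW /Wt[].
have tau_lin x : Nb x -> forall a (u v : 'rV[R]_r),
    tvec t x ((a *: u + v) *m T x) = a *: tvec t x (u *m T x) + tvec t x (v *m T x).
  by move=> /Nbt tx a u v; rewrite mulmxDl -scalemxAl tvec_lin.
have tauK x : Nb x -> cancel (fun v => tvec t x (v *m T x)) (fun a => tcoord t a *m TV x).
  by move=> /Nbt tx u; rewrite tvecK // -mulmxA TTV mulmx1.
have tauVK x : Nb x -> cancel (fun a => tcoord t a *m TV x) (fun v => tvec t x (v *m T x)).
  by move=> /Nbt tx u; rewrite -mulmxA TVT mulmx1 tcoordK.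
pose tau := Triv oNb tau_lin tauK tauVK.
(* The model Lie algebra is the fibre at x0 read in the frame of t. *)
exists tau, (fun u v => tcoord t (brk x0 (tvec t x0 u) (tvec t x0 v))); split.
- by split => //=; rewrite /p subrr normr0.
- move=> t' vt'; split=> v i.
    have oI : open (Nb `&` tdom t') by apply: openI => //; exact: tdom_open.
    apply: (smooth_on_ext (f := fun x => \sum_j (v *m T x) ord0 j * tcoord t' (frame t j x) ord0 i)) => //.
      move=> x [/Nbt tx t'x] /=; rewrite (tvec_frame _ tx) tcoord_sum // summxE.
      by apply: eq_bigr => j _; rewrite [RHS]mxE.
    apply: smooth_on_sum => // j; apply: smooth_on_mul => //.
      apply: smooth_on_sub (_ : smooth_on (cdom c) (fun x => (v *m T x) ord0 j)); first by move=> x [[]].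
      by apply: (msmooth_mul (cdom_open c) _ Ts); exact: msmooth_cst.
    by apply: smooth_on_sub (vtriv_smooth vt vt' (delta_mx ord0 j) i) => x [/Nbt].
  have oI : open (tdom t' `&` Nb) by apply: openI => //; exact: tdom_open.
  suff H : msmooth_on (tdom t' `&` Nb) (fun x => tcoord t (tvec t' x v) *m TV x) by exact: H.
  apply: msmooth_mul => //.
    move=> a d; rewrite ord1.
    by apply: smooth_on_sub (vtriv_smooth vt' vt v d) => x [? /Nbt].
  by apply: msmooth_sub TVs => x [_ []].
- have L := Lk x0; split.
  + by move=> a u u' v; rewrite (tvec_lin tx0) (la_linl L) (tcoord_lin tx0).
  + by move=> a u v v'; rewrite (tvec_lin tx0) (la_linr L) (tcoord_lin tx0).
  + by move=> u; rewrite (la_alt L) (lin0 (tcoord_lin tx0)).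
  + move=> u v w; rewrite !(tcoordK tx0) -!(linD (tcoord_lin tx0)) (la_jacobi L).
    exact: lin0 (tcoord_lin tx0).
- move=> y Ny u v /=; have ty := Nbt y Ny; have [cy yr] := Ny.
  apply: (tcoord_inj ty); rewrite tvecK //.
  have H x u' v' : W x -> tcoord t (brk x (tvec t x u') (tvec t x v')) =
      u' *m \sum_bb v' ord0 bb *: structmx brk vt oV tV chiV bb x.
    by move=> Wx; exact: (bracket_structmx brk vt oV tV chiV chiW).
  rewrite (H _ _ _ Wx0) (H _ _ _ (NbW y Ny)).
  have := key (cmap c y - p) u v yr; rewrite subrK /rowbracket /be /p !cmapK //.
Qed.

(** * Coupling data of a partially split bundle of ideals *)

Section Splitting.
Variables (R : realType) (M : manifold R) (A B k : vbundle M).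
Variables (br : sect A -> sect A -> sect A) (rho : bmap A (TM M)) (inc : bmap k A).
Variables (L : sect A -> form1 k) (l : bmap A k) (j : bmap B A) (p : bmap A B).
Hypotheses (LA : is_lie_algebroid br rho) (KI : is_bundle_of_ideals br rho inc).
Hypothesis IM : is_IM_connection br rho inc L l.
Hypotheses (jK : forall x b, p x (j x b) = b) (pK : forall x a, j x (p x a) = a - inc x (l x a)).

Local Notation J := (bapp j).
Local Notation I := (bapp inc).
Local Notation P := (bapp p).
Local Notation lam := (bapp l).

Lemma split_p_inc x u : p x (inc x u) = 0.
Proof. by rewrite -[LHS]jK pK (imc_l_inc IM) subrr; exact: lin0 (bfun_lin p (x := x)). Qed.

Lemma split_l_j x b : l x (j x b) = 0.
Proof.
apply: (boi_inj KI); rewrite (lin0 (bfun_lin inc (x := x))).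
by have := pK (j x b); rewrite jK => /eqP; rewrite eq_sym subr_eq addrC -subr_eq subrr => /eqP.
Qed.

Lemma split_lK xi : lam (I xi) = xi.
Proof. by apply: sect_ext => x; exact: imc_l_inc IM _ _. Qed.
Lemma split_inc_inj : injective I.
Proof. by move=> xi eta /(congr1 lam); rewrite !split_lK. Qed.
Lemma split_rho_inc xi : bapp rho (I xi) = 0.
Proof. by apply: sect_ext => x; exact: boi_ker KI _ _. Qed.
Lemma split_bapp_p_inc xi : P (I xi) = 0.
Proof. by apply: sect_ext => x; exact: split_p_inc. Qed.
Lemma split_bapp_l_j b : lam (J b) = 0.
Proof. by apply: sect_ext => x; exact: split_l_j. Qed.
Lemma split_jK b : P (J b) = b.
Proof. by apply: sect_ext => x; exact: jK. Qed.
Lemma split_pK a : J (P a) = a - I (lam a).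
Proof. by apply: sect_ext => x; rewrite sectBE; exact: pK. Qed.
Lemma split_decomp a : a = J (P a) + I (lam a).
Proof. by rewrite split_pK subrK. Qed.
Lemma split_br_ideal a xi : br a (I xi) = I (lam (br a (I xi))).
Proof. by have [z ->] := boi_ideal KI a xi; rewrite split_lK. Qed.

Lemma split_LD a b X : bapp (L (a + b)) X = bapp (L a) X + bapp (L b) X.
Proof.
apply: sect_ext => x; have := imc_L_lin IM 1 a b (X x).
by rewrite smcst1 !scale1r.
Qed.

Definition split_conn : connection k.
Proof.
refine (@Connection R M k (fun xi => L (I xi)) _ _).
- by move=> r s t x v; rewrite bapp_lin (imc_L_lin IM).
- by move=> f s x v; rewrite bappZ (imc_L_leibniz IM) [l x _](imc_l_inc IM).
Defined.

(** The anchor vanishes on k, so the Leibniz rule has no derivative term and the bracket is linear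
    over functions in both arguments. *)
Lemma split_br_tensorial x (s s' t t' : sect k) : s x = s' x -> t x = t' x ->
  lam (br (I s) (I t)) x = lam (br (I s') (I t')) x.
Proof.
move=> ss tt; transitivity (lam (br (I s') (I t)) x).
  apply: (@tensorial_eq _ _ _ x _ (fun s => lam (br (I s) (I t)) x)) ss => [u u'|f u].
    by rewrite bappD (brDl LA) bappD.
  by rewrite bappZ (brZl LA) split_rho_inc bappB bappZ (_ : vfapp 0 f = 0) ?scale0r ?bapp0 ?subr0 //;
    apply: smfun_ext.
apply: (@tensorial_eq _ _ _ x _ (fun t => lam (br (I s') (I t)) x)) tt => [u u'|f u].
  by rewrite bappD (brDr LA) bappD.
by rewrite bappZ (lad_leibniz LA) split_rho_inc bappD bappZ (_ : vfapp 0 f = 0) ?scale0r ?bapp0 ?addr0 //;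
  apply: smfun_ext.
Qed.

(** Evaluated on chosen extensions; [split_br_tensorial] makes the value independent of them, which
    yields bilinearity and smoothness. *)
Definition split_brk : bimap k k k.
Proof.
refine (@BiMap R M k k k (fun x u v => lam (br (I (ext u)) (I (ext v))) x) _ _ _).
- move=> x a u u' v.
  have -> : lam (br (I (ext (a *: u + u'))) (I (ext v))) x =
      lam (br (I (smcst a *: ext u + ext u')) (I (ext v))) x.
    by apply: split_br_tensorial; rewrite // sectDE sectZE !extE.
  by rewrite bapp_lin (lad_lin LA) bapp_lin.
- move=> x a u v v'.
  have -> : lam (br (I (ext u)) (I (ext (a *: v + v')))) x =
      lam (br (I (ext u)) (I (smcst a *: ext v + ext v'))) x.
    by apply: split_br_tensorial; rewrite // sectDE sectZE !extE.
  rewrite bapp_lin (lad_skew LA) (lad_lin LA) opprD -scalerN -!(lad_skew LA (I (ext u))).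
  by rewrite bapp_lin.
- move=> s t; have := sectP (lam (br (I s) (I t))); congr smooth_sec.
  by apply: functional_extensionality_dep => x; apply: split_br_tensorial; rewrite extE.
Defined.

(** The Leibniz term, df times l(j s), vanishes because j maps into ker l. *)
Lemma split_L_tensorial x (s s' : sect B) (v : TM M x) : s x = s' x ->
  L (J s) x v = L (J s') x v.
Proof.
apply: (@tensorial_eq _ _ _ x _ (fun s => L (J s) x v)) => [u u'|f u].
  by have := imc_L_lin IM 1 (J u) (J u') v; rewrite bappD smcst1 !scale1r.
by rewrite bappZ (imc_L_leibniz IM) [l x _]split_l_j scaler0 addr0.
Qed.

Definition split_U : bimap B (TM M) k.
Proof.
refine (@BiMap R M B (TM M) k (fun x b v => - L (J (ext b)) x v) _ _ _).
- move=> x a u u' v.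
  rewrite (@split_L_tensorial x (ext (a *: u + u')) (smcst a *: ext u + ext u')).
    by rewrite bapp_lin (imc_L_lin IM) opprD scalerN.
  by rewrite sectDE sectZE !extE.
- by move=> x a u v v'; rewrite bfun_lin opprD scalerN.
- move=> s X; have := sectP (- bapp (L (J s)) X); congr smooth_sec.
  apply: functional_extensionality_dep => x.
  rewrite /= scaleN1r; congr (- _).
  by apply: split_L_tensorial; rewrite extE.
Defined.

Definition split_rhoB : bmap B (TM M) := bcomp rho j.
Definition split_brB (a b : sect B) : sect B := P (br (J a) (J b)).

Local Notation D := split_conn.
Local Notation U := split_U.
Local Notation brk := split_brk.
Local Notation brB := split_brB.
Local Notation rB := (bapp split_rhoB).

Lemma split_rhoBE b : rB b = bapp rho (J b). Proof. exact: sect_ext. Qed.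

Lemma split_connE xi X : bapp (L (I xi)) X = nabla D X xi. Proof. by []. Qed.

Lemma split_UE b X : bapp (L (J b)) X = - biapp U b X.
Proof.
apply: sect_ext => x; rewrite /= scaleN1r opprK.
by apply: split_L_tensorial; rewrite extE.
Qed.

Lemma split_br_II xi eta : br (I xi) (I eta) = I (biapp brk xi eta).
Proof.
rewrite split_br_ideal; congr bapp; apply: sect_ext => x.
by apply: split_br_tensorial; rewrite extE.
Qed.

(** The equation for l with second argument in ker l loses its bracket term and expresses l[xi, j a]
    through L; as k is an ideal, this determines the whole bracket. *)
Lemma split_br_IJ xi a : br (I xi) (J a) = - I (nabla D (rB a) xi).
Proof.
have := imc_l_br IM (I xi) (J a).
rewrite split_bapp_l_j bapp0 (br0r LA) add0r split_connE -split_rhoBE => <-.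
by rewrite (lad_skew LA) !bappN -split_br_ideal.
Qed.

Lemma split_br_JI a xi : br (J a) (I xi) = I (nabla D (rB a) xi).
Proof. by rewrite (lad_skew LA) split_br_IJ opprK. Qed.

(** The equation for l gives the k-component: l[j a, j b] = - L(j a)(rho(j b)) = U(a, rho_B b). The
    other component is [split_brB] by definition. *)
Lemma split_br_JJ a b : br (J a) (J b) = J (brB a b) + I (biapp U a (rB b)).
Proof.
rewrite {1}(split_decomp (br (J a) (J b))); congr (_ + _).
by have := imc_l_br IM (J a) (J b); rewrite split_bapp_l_j bapp0 (br0r LA) add0r split_UE -split_rhoBE bappN opprK.
Qed.

Lemma split_lie_algebroid : is_lie_algebroid brB split_rhoB.
Proof.
(* Since k is an ideal, the k-part of c does not affect the bracket modulo k; this lets the Jacobi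
   identity descend. *)
have PJP a c : P (br (J a) (J (P c))) = P (br (J a) c).
  by rewrite split_pK (brBr LA) bappB split_br_ideal split_bapp_p_inc subr0.
split.
- by move=> r a b c; rewrite /brB bapp_lin (lad_lin LA) bapp_lin.
- by move=> a b; rewrite /brB (lad_skew LA) bappN.
- by move=> a b c; rewrite /brB !PJP -!bappD (lad_jacobi LA) bapp0.
- by move=> a f b; rewrite /brB bappZ (lad_leibniz LA) bappD !bappZ split_jK split_rhoBE.
- move=> a b; rewrite !split_rhoBE -(lad_anchor LA) /brB split_pK bappB split_rho_inc.
  by apply: sect_ext => x; rewrite sectBE subr0.
Qed.

Lemma split_brk_lie_algebra x : is_lie_algebra (brk x).
Proof.
have jac xi eta zeta : biapp brk xi (biapp brk eta zeta) + biapp brk eta (biapp brk zeta xi)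
    + biapp brk zeta (biapp brk xi eta) = 0.
  by apply: split_inc_inj; rewrite !bappD -!split_br_II bapp0 (lad_jacobi LA).
split.
- by move=> a u u' v; exact: bifun_linl.
- by move=> a u v v'; exact: bifun_linr.
- move=> u /=; set c := br _ _.
  have : c + c = 0 by rewrite {1}/c (lad_skew LA) addNr.
  move=> /(congr1 (fun s : sect A => l x (s x))) /=.
  rewrite (linD (bfun_lin l (x := x))) (lin0 (bfun_lin l (x := x))).
  by rewrite -mulr2n -scaler_nat => /eqP; rewrite scaler_eq0 pnatr_eq0 => /eqP.
- move=> u v w; have := congr1 (fun s : sect k => s x) (jac (ext u) (ext v) (ext w)).
  have bE s t : biapp brk s t x = brk x (s x) (t x) by [].
  by rewrite !sectDE !bE !extE.
Qed.

Lemma split_S1 X xi eta : nabla D X (biapp brk xi eta) =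
  biapp brk (nabla D X xi) eta + biapp brk xi (nabla D X eta).
Proof.
apply: split_inc_inj; have := imc_L_br IM (I xi) (I eta) X.
rewrite !split_rho_inc vfbr0l !bapp0 !subr0 split_br_II !split_connE => ->.
by rewrite -(lad_skew LA) !split_br_II bappD addrC.
Qed.

Lemma split_coupling : is_coupling_data brB split_rhoB brk D U.
Proof.
split; first exact: split_S1.
- move=> a X xi; apply: split_inc_inj; have := imc_L_br IM (J a) (I xi) X.
  rewrite split_rho_inc vfbr0l bapp0 bapp0 subr0 split_br_JI !split_connE split_UE bappN (brNr LA) split_br_II split_br_JI -split_rhoBE => e.
  by rewrite 2!bappB e -split_br_II (lad_skew LA (I _)) split_br_II; zmod.
- move=> a b X; apply: split_inc_inj; have := imc_L_br IM (J a) (J b) X.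
  rewrite split_br_JJ split_LD !split_UE split_connE !bappN !(brNr LA) !split_br_JI -!split_rhoBE !bappD !bappN => e.
  apply: (eq_addl (esym e)); zmod.
Qed.

Definition split_iso : bmap A (dsum B k).
Proof.
refine (@BMap R M A (dsum B k) (fun x a => (p x a, l x a)) _ _).
- by move=> x a u v; rewrite !bfun_lin.
- by move=> s; exact: sectP (Defs.dpair (P s) (lam s)).
Defined.

Definition split_iso_inv : bmap (dsum B k) A.
Proof.
refine (@BMap R M (dsum B k) A (fun x b => j x b.1 + inc x b.2) _ _).
- by move=> x a u v; rewrite /= !bfun_lin scalerDr addrACA.
- by move=> s; exact: sectP (J (bapp (dpr1 B k) s) + I (bapp (dpr2 B k) s)).
Defined.

Lemma split_isoE b xi : bapp split_iso (J b + I xi) = Defs.dpair b xi.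
Proof.
apply: sect_ext => x; rewrite /=.
by rewrite !(linD (bfun_lin _ (x := x))) jK split_l_j split_p_inc (imc_l_inc IM) addr0 add0r.
Qed.

Lemma split_iso_lie_algebroid : is_lie_algebroid_iso br rho
  (coupling_br brB split_rhoB brk D U) (coupling_anchor k split_rhoB) split_iso.
Proof.
split.
- exists split_iso_inv => x; split=> [a|[b u]] /=; first by rewrite pK subrK.
  rewrite !(linD (bfun_lin _ (x := x))) jK split_l_j split_p_inc (imc_l_inc IM).
  by rewrite addr0 add0r.
- by move=> x a /=; rewrite pK (linB (bfun_lin rho (x := x))) (boi_ker KI) subr0.
- move=> a b; rewrite (split_decomp a) (split_decomp b).
  move: (P a) (lam a) (P b) (lam b) => {}a xi {}b eta.
  rewrite !split_isoE coupling_brE !(brDl LA) !(brDr LA) split_br_JJ split_br_JI split_br_IJ split_br_II.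
  rewrite -split_isoE; congr (bapp split_iso _); rewrite !bappD bappN; zmod.
Qed.

Lemma split_iso_inc x u : split_iso x (inc x u) = dinr B k x u.
Proof. by rewrite /= split_p_inc (imc_l_inc IM). Qed.

Lemma split_quotient : is_lie_algebroid_quotient br rho inc brB split_rhoB
  (bcomp (dpr1 B k) split_iso).
Proof.
split.
- by move=> x b; exists (j x b); exact: jK.
- move=> x a /=; split=> [pa|[u ->]]; last exact: split_p_inc.
  exists (l x a); apply/eqP; rewrite -subr_eq0 -pK pa.
  by apply/eqP; exact: lin0 (bfun_lin j (x := x)).
- by move=> x a /=; rewrite pK (linB (bfun_lin rho (x := x))) (boi_ker KI) subr0.
- move=> a b.
  have e s : bapp (bcomp (dpr1 B k) split_iso) s = P s by exact: sect_ext.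
  rewrite !e {1}(split_decomp a) {1}(split_decomp b) !(brDl LA) !(brDr LA) split_br_JI split_br_IJ split_br_II.
  by rewrite !(bappD, bappN) !split_bapp_p_inc oppr0 !addr0.
Qed.

End Splitting.

Theorem proposition5p13 (R : realType) (M : manifold R) :
  (forall (B k : vbundle M)
     (brB : sect B -> sect B -> sect B) (rhoB : bmap B (TM M))
     (brk : bimap k k k) (D : connection k) (U : bimap B (TM M) k),
     is_lie_algebroid brB rhoB ->
     is_lie_algebra_bundle brk ->
     is_coupling_data brB rhoB brk D U ->
     let A := dsum B k in
     let brA := coupling_br brB rhoB brk D U in
     let rhoA := coupling_anchor k rhoB in
     let inc := dinr B k in
     [/\ @is_lie_algebroid R M A brA rhoA,
         is_bundle_of_ideals brA rhoA inc,
         partially_split brA rhoA inc &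
         is_IM_connection brA rhoA inc (coupling_L D U) (dpr2 B k)])
  /\
  (forall (A k : vbundle M)
     (brA : sect A -> sect A -> sect A) (rhoA : bmap A (TM M))
     (inc : bmap k A),
     is_lie_algebroid brA rhoA ->
     is_bundle_of_ideals brA rhoA inc ->
     partially_split brA rhoA inc ->
     exists (B : vbundle M)
       (brB : sect B -> sect B -> sect B) (rhoB : bmap B (TM M))
       (brk : bimap k k k) (D : connection k) (U : bimap B (TM M) k)
       (Phi : bmap A (dsum B k)),
       [/\ is_lie_algebroid brB rhoB,
           is_lie_algebra_bundle brk &
           is_coupling_data brB rhoB brk D U] /\
       [/\ is_lie_algebroid_iso brA rhoA
             (coupling_br brB rhoB brk D U) (coupling_anchor k rhoB) Phi,
           (forall x u, Phi x (inc x u) = dinr B k x u) &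
           is_lie_algebroid_quotient brA rhoA inc brB rhoB
             (bcomp (dpr1 B k) Phi)]).
Proof.
split=> [B k brB rhoB brk D U LB Lk CD|A k brA rhoA inc LA KI [L [l IM]]].
  exact: coupling_construction.
have [B [j [p [jK pK]]]] := kernel_bundle (imc_l_inc IM).
exists B, (split_brB brA j p), (split_rhoB rhoA j), (split_brk l LA KI), (split_conn IM),
  (split_U KI IM jK pK), (split_iso l p).
split; split.
- exact: split_lie_algebroid LA KI IM jK pK.
- apply: (@parallel_lie_algebra_bundle _ _ _ _ (split_conn IM)).
    exact: split_brk_lie_algebra IM.
  exact: split_S1.
- exact: split_coupling.
- exact: split_iso_lie_algebroid.
- exact: split_iso_inc IM jK pK.
- exact: split_quotient KI IM jK pK.
Qed.
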